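(* Let $q$ be a prime power. (a) Let $\mathcal{L}$ be a generator blocking set of $\mathrm{Q}^-(5,q)$ with $|\mathcal{L}|=q^2+\delta+1$. If $\delta\le\frac12\left(3q-\sqrt{5q^2+2q+1}\right)$, then $\mathcal{L}$ contains the pencil of the $q^2+1$ generators through a point of $\mathrm{Q}^-(5,q)$, or $\mathcal{L}$ contains a cover of a parabolic quadric $\mathrm{Q}(4,q)$ embedded as a hyperplane section in $\mathrm{Q}^-(5,q)$. (b) Let $\mathcal{L}$ be a generator blocking set of $\mathrm{H}(4,q^2)$ with $|\mathcal{L}|=q^3+\delta+1$. If $\delta<q-3$, then $\mathcal{L}$ contains the pencil of the $q^3+1$ generators through a point of $\mathrm{H}(4,q^2)$.
   Context: $\mathrm{Q}^-(5,q)$ is the non-singular elliptic quadric in $\mathrm{PG}(5,q)$, a generalized quadrangle of order $(q,q^2)$; $\mathrm{H}(4,q^2)$ is the non-singular hermitian variety in $\mathrm{PG}(4,q^2)$, a generalized quadrangle of order $(q^2,q^3)$; $\mathrm{Q}(4,q)$ is the non-singular parabolic quadric in $\mathrm{PG}(4,q)$. The generators of these polar spaces are the lines of the ambient projective space completely contained in them. A generator blocking set is a set $\mathcal{L}$ of generators such that every generator of the polar space shares at least one point with some element of $\mathcal{L}$. A cover of $\mathrm{Q}(4,q)$ is a set of lines contained in $\mathrm{Q}(4,q)$ such that every point of $\mathrm{Q}(4,q)$ is on at least one line of the set. *)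

(* Defs.v *)
From HB Require Import structures.
From mathcomp Require Import all_boot all_order all_algebra.

Set Implicit Arguments.
Unset Strict Implicit.
Unset Printing Implicit Defensive.

Import Order.TTheory GRing.Theory Num.Theory.
Local Open Scope ring_scope.

(* A vector space over a finite field has finitely many subspaces, so that
   sets of lines can be handled as elements of {set {vspace _}}. *)
Section FiniteSubspaces.
Import VectorInternalTheory.
Variables (F : finFieldType) (vT : vectType F).
HB.instance Definition _ := [Countable of {vspace vT} by <:].
HB.instance Definition _ := [Finite of {vspace vT} by <:].
End FiniteSubspaces.

Definition prime_power (q : nat) : Prop :=
  exists p k : nat, [/\ prime p, (0 < k)%N & q = (p ^ k)%N].

(* PG(n-1, F) is the lattice of subspaces of 'rV[F]_n: its points, lines and
   hyperplanes are the subspaces of vector dimension 1, 2 and n-1. A variety is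
   given by the predicate Z of the vectors on which its equation vanishes. *)
Section Incidence.
Variables (F : finFieldType) (n : nat).
Implicit Types (Z : pred 'rV[F]_n) (P U H l m : {vspace 'rV[F]_n}).
Implicit Types L C : {set {vspace 'rV[F]_n}}.

Definition is_point P : bool := \dim P == 1%N.
Definition is_line l : bool := \dim l == 2.
Definition is_hyperplane H : bool := (\dim H).+1 == n.

Definition contained_in Z U : bool := [forall v, (v \in U) ==> Z v].

Definition subspace_section Z H : pred 'rV[F]_n := [pred v | (v \in H) && Z v].

Definition lines_of Z : {set {vspace 'rV[F]_n}} :=
  [set l | is_line l && contained_in Z l].

Definition share_point l m : bool :=
  [exists P, [&& is_point P, (P <= l)%VS & (P <= m)%VS]].

(* For polar spaces whose generators are lines. *)
Definition generator_blocking_set Z L : bool :=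
  (L \subset lines_of Z) &&
  [forall g in lines_of Z, exists l in L, share_point g l].

Definition pencil Z P : {set {vspace 'rV[F]_n}} :=
  [set l in lines_of Z | (P <= l)%VS].

Definition is_cover Z C : bool :=
  (C \subset lines_of Z) &&
  [forall P, is_point P && contained_in Z P ==> [exists l in C, (P <= l)%VS]].

End Incidence.

(* The coefficient matrix A is arbitrary rather than symmetric, so that every
   quadratic form is obtained in characteristic 2 as well. *)
Section Quadrics.
Variables (F : finFieldType) (n : nat).
Implicit Types (A : 'M[F]_n) (U H : {vspace 'rV[F]_n}) (v w : 'rV[F]_n).

Definition qform A v : F := (v *m A *m v^T) 0 0.

Definition polar_form A v w : F := qform A (v + w) - qform A v - qform A w.

Definition quadric A : pred 'rV[F]_n := [pred v | qform A v == 0].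

(* The quadric induced on the subspace U has no singular point, a singular
   point being one at which the form and its partial derivatives vanish. For
   #|F| even and \dim U odd the polar form of such a quadric is degenerate. *)
Definition nonsingular_on A U : bool :=
  [forall v in U, (v != 0) && quadric A v ==>
     [exists w in U, polar_form A v w != 0]].

(* The largest vector dimension of a subspace contained in the quadric. *)
Definition witt_index A : nat :=
  \max_(U : {vspace 'rV[F]_n} | contained_in (quadric A) U) \dim U.

(* In PG(2m-1, q) the non-singular quadrics are the hyperbolic ones, of Witt
   index m, and the elliptic ones, of Witt index m-1. *)
Definition elliptic_quadric A : Prop :=
  [/\ ~~ odd n, nonsingular_on A fullv & witt_index A = (n./2).-1].

(* In a projective space of even dimension, every non-singular quadric is
   parabolic. *)
Definition parabolic_section A H : Prop :=
  [/\ ~~ odd n, is_hyperplane H & nonsingular_on A H].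

End Quadrics.

Section HermitianVarieties.
Variables (F : finFieldType) (q n : nat).
Implicit Types (A : 'M[F]_n) (v : 'rV[F]_n).

(* For #|F| = q ^ 2 this is the entrywise field involution x |-> x ^ q. *)
Definition conjq_mx m1 m2 (A : 'M[F]_(m1, m2)) : 'M[F]_(m1, m2) :=
  map_mx (fun a => a ^+ q) A.

Definition hform A v : F := (v *m A *m (conjq_mx v)^T) 0 0.

Definition hermitian_variety A : pred 'rV[F]_n := [pred v | hform A v == 0].

Definition nonsingular_hermitian A : Prop :=
  (conjq_mx A)^T = A /\ A \in unitmx.

End HermitianVarieties.

(* Main.v *)
Require Import Defs.
From HB Require Import structures.
From mathcomp Require Import all_boot all_order all_algebra all_field.
From mathcomp Require Import zify ring lra.

Set Implicit Arguments.
Unset Strict Implicit.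
Unset Printing Implicit Defensive.

(** Both polar spaces are generalized quadrangles, of order (s, t) = (q, q^2) and
    (q^2, q^3) respectively: a point x off a line l is on exactly one line that meets
    l. Let |L| = t + 1 + d, call a point covered if it is on a line of L, and call a
    line full if all its points are covered.

    Each line of L meets exactly one of the t + 1 lines on an uncovered point x, and
    each of these lines meets L; so the numbers of lines of L met by the lines on x
    exceed 1 by d in total (sum_meeting). In particular a line that is not full meets
    at most d + 1 lines of L and has at most d + 1 covered points. It follows that
    either L contains a pencil, or every point is on at most d + 1 lines of L
    (pencil_or_small). In the second case, counting the pairs of lines of L that meet
    a common line on an uncovered point yields two skew lines l, l' of L with many
    full transversals (skew_pair_many_full).

    Let D be the set of points of the quadrangle in a hyperplane that contains l and
    l'. It is a subquadrangle of order (s, t / s). The same excess argument inside D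
    shows that an uncovered point of D is collinear with at most t / s + 1 + d covered
    points of D, and that D is completely covered as soon as it contains more than
    t / s + 1 + d lines of L (all_covered_of_many). Once D is completely covered, at
    most d lines of L are outside D (few_outside), and the lines of L inside D already
    cover D (inner_cover).

    In H(4, q^2), take for D the span H(3, q^2) of l and l'. An uncovered point of D
    would be collinear with a covered point on each full transversal, so D is
    completely covered. But H(3, q^2) has no cover with so few lines
    (no_small_cover): three pairwise skew lines of H(3, q^2) have at least q + 1
    common transversals (many_centers), whereas q^2 + 1 transversals of two lines of L
    meet fewer lines of L than this requires. So L contains a pencil.

    In Q^-(5, q), the span of l and l' meets the quadric in a grid G. The lines of the
    ruling of G opposite to the transversals meet all of these, hence are full, and G
    is completely covered. The q + 1 hyperplanes on G partition the remaining points,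
    so that one of them, D, contains many covered points off G. Since an uncovered
    point of D sees q + 1 covered points on G, it sees at most d others. Averaging
    gives a covered point z of D off G on more than d full lines of D
    (exists_rich_point); an uncovered point of D in general position would see a
    covered point on each of them, so few points of D are uncovered (few_uncovered).
    Then D contains many lines of L and these lines cover D, which is a Q(4, q).

    The quadratic and the hermitian case share the linear algebra that turns isotropic
    points and lines into a quadrangle: quadrangle_form records the properties of the
    form that are used, and in particular the number k of isotropic vectors on an
    affine line parallel to an isotropic vector, from which the number of lines on a
    point follows (card_pencil_points_in). *)

(** * Generalized quadrangles *)

Section Counting.
Variables A B : finType.

Lemma double_count (P : {set A}) (Q : {set B}) (R : A -> B -> bool) :
  \sum_(a in P) #|[set b in Q | R a b]| = \sum_(b in Q) #|[set a in P | R a b]|.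
Proof.
transitivity (\sum_(a in P) \sum_(b in Q) R a b).
  by apply: eq_bigr => a _; rewrite -sum1dep_card big_mkcondr.
rewrite exchange_big; apply: eq_bigr => b _.
by rewrite -sum1dep_card big_mkcondr.
Qed.

Lemma card_sigma_set (P : {set A}) (R : A -> B -> bool) :
  #|[set p : A * B | (p.1 \in P) && R p.1 p.2]| = \sum_(a in P) #|[set b | R a b]|.
Proof.
rewrite -sum1dep_card -(pair_big_dep (mem P) R (fun _ _ => 1)) /=.
by apply: eq_bigr => a _; rewrite sum1dep_card.
Qed.

Lemma leq_card_bigcup (P : {set A}) (S : A -> {set B}) :
  #|\bigcup_(a in P) S a| <= \sum_(a in P) #|S a|.
Proof.
elim/big_ind2: _ => [|n1 U1 n2 U2 le1 le2|//]; first by rewrite cards0.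
by rewrite (leq_trans (leq_card_setU _ _)) // leq_add.
Qed.

End Counting.

(** The order (s, t) enters only through s. The number t + 1 of lines on a point is derived
    for each subspace with two skew lines, where it is constant (deg_const); so the same
    record serves the quadrangle and its subquadrangles. *)
Record quadrangle (X Y : finType) (inc : X -> Y -> bool) (s : nat) : Prop :=
  Quadrangle {
    gq_line : forall l, #|[set x | inc x l]| = s.+1;
    gq_two : forall x y l m, x != y -> inc x l -> inc y l -> inc x m -> inc y m ->
      l = m;
    gq_proj : forall x l, ~~ inc x l ->
      exists2 m, inc x m & exists2 y, inc y m & inc y l;
    gq_notri : forall x l m m' y y', ~~ inc x l ->
      inc x m -> inc y m -> inc y l -> inc x m' -> inc y' m' -> inc y' l -> m = m' }.

Section Incidence.
Variables (X Y : finType) (inc : X -> Y -> bool).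

Definition pts l := [set x | inc x l].
Definition meets l m := [exists x, inc x l && inc x m].
Definition coll x y := [exists l, inc x l && inc y l].
Definition line_in (D : {set X}) l := pts l \subset D.
Definition pencil_in (D : {set X}) x := [set l | inc x l && line_in D l].

(** Choosing for each line one of its points in W is injective. *)
Lemma leq_card_hit (T0 : {set Y}) (W : {set X}) :
  (forall f, f \in T0 -> exists2 w, w \in W & inc w f) ->
  (forall f g w, f \in T0 -> g \in T0 -> w \in W -> inc w f -> inc w g -> f = g) ->
  #|T0| <= #|W|.
Proof.
move=> hit uniqW; have := double_count T0 W (fun f w => inc w f).
have : #|T0| <= \sum_(f in T0) #|[set w in W | inc w f]|.
  rewrite -sum1_card; apply: leq_sum => f /hit[w wW wf].
  by apply/card_gt0P; exists w; rewrite inE wW.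
suff: \sum_(w in W) #|[set f in T0 | inc w f]| <= #|W| by lia.
rewrite -[leqRHS]sum1_card; apply: leq_sum => w wW.
apply/card_le1_eqP => f g; rewrite !inE => /andP[fT wf] /andP[gT wg].
exact: (uniqW _ _ w).
Qed.

End Incidence.

Section Quadrangle.
Variables (X Y : finType) (inc : X -> Y -> bool) (s : nat).
Hypothesis gq : quadrangle inc s.
Local Notation pts := (pts inc).
Local Notation meets := (meets inc).
Local Notation coll := (coll inc).
Local Notation line_in := (line_in inc).
Local Notation pencil_in := (pencil_in inc).
Implicit Types (x y z : X) (l m : Y) (D : {set X}).

Lemma meets_pointP l m : reflect (exists2 x, inc x l & inc x m) (meets l m).
Proof.
by apply: (iffP existsP) => -[x]; [case/andP => ? ?; exists x | move=> ? ?; exists x; apply/andP].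
Qed.

Lemma meetsC l m : meets l m = meets m l.
Proof. by apply/meets_pointP/meets_pointP => -[x ? ?]; exists x. Qed.

Lemma collP x y : reflect (exists2 l, inc x l & inc y l) (coll x y).
Proof.
by apply: (iffP existsP) => -[l]; [case/andP => ? ?; exists l | move=> ? ?; exists l; apply/andP].
Qed.

Lemma point_eq x y l m : l != m -> inc x l -> inc x m -> inc y l -> inc y m -> x = y.
Proof.
move=> lm xl xm yl ym; apply/eqP; apply: contraNT lm => xy.
by apply/eqP; exact: (gq_two gq xy).
Qed.

Lemma card_unique (T : finType) (A : {set T}) a :
  a \in A -> (forall b, b \in A -> b = a) -> #|A| = 1.
Proof.
move=> aA uniqA; apply/eqP/cards1P; exists a; apply/setP => b; rewrite inE.
by apply/idP/eqP => [/uniqA|->].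
Qed.

Definition subspace D :=
  forall x y l, x != y -> x \in D -> y \in D -> inc x l -> inc y l -> line_in D l.

Lemma subspaceT : subspace setT.
Proof. by move=> *; apply: subsetT. Qed.

Lemma line_inP D l : reflect (forall x, inc x l -> x \in D) (line_in D l).
Proof.
apply: (iffP subsetP) => lD x; first by move=> xl; apply: lD; rewrite inE.
by rewrite inE => /lD.
Qed.

Lemma card_pts l : #|pts l| = s.+1.
Proof. exact: gq_line gq l. Qed.

Lemma card_ptsD1 x l : inc x l -> #|pts l :\ x| = s.
Proof. by move=> xl; have := cardsD1 x (pts l); rewrite card_pts inE xl => -[]. Qed.

Lemma join_in D x y l m : subspace D -> x \in D -> line_in D l -> ~~ inc x l ->
  inc x m -> inc y m -> inc y l -> line_in D m.
Proof.
move=> Dsub xD lD xl xm ym yl; apply: (Dsub x y) => //.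
  by apply: contraNneq xl => ->.
by move/line_inP: lD; apply.
Qed.

Lemma card_proj D x l : subspace D -> x \in D -> line_in D l -> ~~ inc x l ->
  #|[set m in pencil_in D x | meets l m]| = 1.
Proof.
move=> Dsub xD lD xl; have [m xm [y ym yl]] := gq_proj gq xl.
apply: (@card_unique _ _ m).
  rewrite !inE xm (join_in Dsub xD lD xl xm ym yl) /=.
  by apply/meets_pointP; exists y.
move=> k; rewrite !inE => /andP[/andP[xk _] /meets_pointP[z zl zk]].
exact: (gq_notri gq xl xk zk zl xm ym yl).
Qed.

(** Projection is a bijection between the lines on x and the lines on y. *)
Lemma deg_noncoll D x y : subspace D -> x \in D -> y \in D -> ~~ coll x y ->
  #|pencil_in D x| = #|pencil_in D y|.
Proof.
move=> Dsub xD yD xy.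
have offx l : inc x l -> ~~ inc y l.
  by move=> xl; apply: contra xy => yl; apply/collP; exists l.
have offy l : inc y l -> ~~ inc x l.
  by move=> xl; apply: contra xy => yl; apply/collP; exists l.
have := double_count (pencil_in D x) (pencil_in D y) meets.
rewrite (eq_bigr (fun=> 1)) => [|l]; last first.
  by rewrite inE => /andP[xl lD]; apply: card_proj => //; apply: offx.
rewrite [in RHS](eq_bigr (fun=> 1)) => [|l]; last first.
  rewrite inE => /andP[yl lD]; rewrite -[RHS](card_proj Dsub xD lD (offy _ yl)).
  by apply: eq_card => m; rewrite !inE meetsC.
by rewrite !sum1_card.
Qed.

Lemma exists_other_point x l : 0 < s -> exists2 y, inc y l & y != x.
Proof.
move=> s_gt0; have: 0 < #|pts l :\ x|.
  have := cardsD1 x (pts l); rewrite card_pts; case: (_ \in _) => /=; lia.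
by case/card_gt0P => y; rewrite !inE => /andP[yx yl]; exists y.
Qed.

Lemma exists_third_point x y l : 1 < s -> exists z, [/\ inc z l, z != x & z != y].
Proof.
move=> s_gt0; have: 0 < #|pts l :\ x :\ y|.
  have := cardsD1 x (pts l); have := cardsD1 y (pts l :\ x).
  rewrite card_pts; do 2!case: (_ \in _) => /=; lia.
by case/card_gt0P => z; rewrite !inE => /and3P[zy zx yl]; exists z.
Qed.

Lemma skew_offP l m x : ~~ meets l m -> inc x l -> ~~ inc x m.
Proof. by move=> lm xl; apply: contra lm => xm; apply/meets_pointP; exists x. Qed.

(** The lines on x that meet l1 and l2 can only coincide with a transversal of l1 and l2;
    in that case a second transversal is used. *)
Lemma second_line D l1 l2 x k : 0 < s -> subspace D -> line_in D l1 -> line_in D l2 ->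
  ~~ meets l1 l2 -> x \in D -> inc x k -> exists k', [/\ inc x k', line_in D k' & k' != k].
Proof.
move=> s_gt0 Dsub l1D l2D l12 xD xk.
have proj_to l : line_in D l -> ~~ inc x l ->
    exists m, [/\ inc x m, line_in D m & meets m l].
  move=> lD xl; have [m xm [y ym yl]] := gq_proj gq xl.
  exists m; split=> //; first exact: (join_in Dsub xD lD xl xm ym yl).
  by apply/meets_pointP; exists y.
(* A line through x other than k exists as soon as two lines l, m of D are such
   that no line through x meets both. *)
have two_proj l m : line_in D l -> line_in D m -> ~~ inc x l -> ~~ inc x m ->
    ~~ (meets k l && meets k m) -> exists k', [/\ inc x k', line_in D k' & k' != k].
  move=> lD mD xl xm; rewrite negb_and => /orP[] kX.
    have [k' [xk' k'D k'l]] := proj_to l lD xl; exists k'; split=> //.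
    by apply: contraNneq kX => <-.
  have [k' [xk' k'D k'l]] := proj_to m mD xm; exists k'; split=> //.
  by apply: contraNneq kX => <-.
have on_l a b : line_in D a -> line_in D b -> ~~ meets a b -> inc x a ->
    exists k', [/\ inc x k', line_in D k' & k' != k].
  move=> aD bD ab xa; have [k' [xk' k'D k'b]] := proj_to b bD (skew_offP ab xa).
  have [eqk|nk] := eqVneq k' k; last by exists k'.
  exists a; split=> //; apply: contraNneq ab => ->; by rewrite -eqk.
have [x1|x1] := boolP (inc x l1); first exact: (on_l l1 l2).
have [x2|x2] := boolP (inc x l2).
  by apply: (on_l l2 l1) => //; rewrite meetsC.
have [/andP[k1 k2]|] := boolP (meets k l1 && meets k l2); last exact: two_proj.
have [y1 y1k y1l] := meets_pointP _ _ k1.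
have [z zl1 zy] := exists_other_point y1 l1 s_gt0.
have [g zg [w wg wl2]] := gq_proj gq (skew_offP l12 zl1).
have gD : line_in D g.
  by apply: (join_in Dsub _ l2D (skew_offP l12 zl1) zg wg wl2); move/line_inP: l1D; apply.
have nkl : k != l1 by apply: contraNneq x1 => <-.
have ngl : g != l1 by apply: contraNneq l12 => <-; apply/meets_pointP; exists w.
have kg : k != g.
  by apply: contraNneq zy => kg; apply/eqP/(point_eq nkl) => //; rewrite kg.
have kNg : ~~ meets k g.
  apply/negP => /meets_pointP[u uk ug].
  have ul1 : ~~ inc u l1.
    apply: contraNN zy => ul1.
    by rewrite (point_eq nkl y1k y1l uk ul1) (point_eq ngl ug ul1 zg zl1).
  by move/eqP: kg; apply; apply: (gq_notri gq ul1 uk y1k y1l ug zg zl1).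
have xg : ~~ inc x g by apply: (skew_offP kNg).
by apply: (two_proj g g) => //; rewrite (negbTE kNg).
Qed.

(** Two collinear points are compared by way of a point collinear with neither of them. *)
Lemma deg_const D l1 l2 x y : 1 < s -> subspace D -> line_in D l1 -> line_in D l2 ->
  ~~ meets l1 l2 -> x \in D -> y \in D -> #|pencil_in D x| = #|pencil_in D y|.
Proof.
move=> s_gt1 Dsub l1D l2D l12 xD yD; have s_gt0 : 0 < s by lia.
have [xy|] := boolP (coll x y); last exact: deg_noncoll.
have [-> //|nxy] := eqVneq x y.
have [h xh yh] := collP _ _ xy.
have [k [xk kD kh]] := second_line s_gt0 Dsub l1D l2D l12 xD xh.
have [k' [yk' k'D k'h]] := second_line s_gt0 Dsub l1D l2D l12 yD yh.
(* The third point z of a line joining k to k' off h is collinear with neither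
   x nor y. *)
have [w wk wx] := exists_other_point x k s_gt0.
have wh : ~~ inc w h by apply: contraNN wx => wh; rewrite (point_eq kh wk wh xk xh).
have xk' : ~~ inc x k'.
  by apply: contraNN nxy => xk'; rewrite (point_eq k'h xk' xh yk' yh).
have yk : ~~ inc y k.
  by apply: contraNN nxy => yk; rewrite (point_eq kh xk xh yk yh).
have wk' : ~~ inc w k'.
  apply/negP => wk'; case/eqP: kh.
  exact: (gq_notri gq xk' xk wk wk' xh yh yk').
have [g wg [v vg vk']] := gq_proj gq wk'.
have wD : w \in D by move/line_inP: kD; apply.
have gD := join_in Dsub wD k'D wk' wg vg vk'.
have gk' : g != k' by apply: contraNneq wk' => <-.
have yg : ~~ inc y g.
  apply: contraNN wh => yg.
  by rewrite -(gq_notri gq yk yg wg wk yh xh xk).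
have vy : v != y by apply: contraNneq yg => <-.
have gk : g != k.
  apply/negP => /eqP gk; case/eqP: kh; rewrite -gk in xk *.
  exact: (gq_notri gq xk' xk vg vk' xh yh yk').
have [z [zg zw zv]] := exists_third_point w v g s_gt1.
have zD : z \in D by move/line_inP: gD; apply.
have zx : ~~ coll x z.
  apply/negP => /collP[m xm zm].
  have zk : ~~ inc z k by apply: contraNN zw => zk; rewrite (point_eq gk zg zk wg wk).
  have eq_mg : m = g by apply: (gq_notri gq zk zm xm xk zg wg wk).
  rewrite eq_mg in xm; case/eqP: wx; exact: (point_eq gk).
have zy : ~~ coll y z.
  apply/negP => /collP[m ym zm].
  have zk : ~~ inc z k' by apply: contraNN zv => zk; rewrite (point_eq gk' zg zk vg vk').
  have eq_mg : m = g by apply: (gq_notri gq zk zm ym yk' zg vg vk').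
  by rewrite -eq_mg ym in yg.
by rewrite (deg_noncoll Dsub xD zD zx) -(deg_noncoll Dsub yD zD zy).
Qed.

Section ConstantDegree.
Variables (D : {set X}) (t' : nat).
Hypothesis Dsub : subspace D.
Hypothesis degD : forall x, x \in D -> #|pencil_in D x| = t'.+1.


(** Each point of D off l is on exactly one line that meets l, so the points in question
    correspond to the flags (z, m) with z in S and m another line on z, followed by the
    choice of a further point of m. *)
Lemma card_joined_off_line l (S : {set X}) : line_in D l -> S \subset pts l ->
  #|[set y in D | ~~ inc y l && [exists z in S, coll y z]]| = #|S| * t' * s.
Proof.
move=> lD SD; set B := [set y in D | _].
pose A := [set p : X * Y | (p.1 \in S) && [&& inc p.1 p.2, line_in D p.2 & p.2 != l]].
have SP z : z \in S -> inc z l by move=> zS; move/subsetP: SD => /(_ z zS); rewrite inE.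
have cardA : #|A| = #|S| * t'.
  rewrite /A (card_sigma_set S (fun z m => [&& inc z m, line_in D m & m != l])).
  rewrite (eq_bigr (fun=> t')) ?sum_nat_const // => z zS.
  have zl := SP _ zS; have zD : z \in D by move/line_inP: lD; apply.
  have := cardsD1 l (pencil_in D z); rewrite degD // !inE zl lD add1n => -[->].
  by apply: eq_card => m; rewrite !inE [RHS]andbC -andbA.
have := double_count A B (fun p y => inc y p.2 && (y != p.1)).
rewrite (eq_bigr (fun=> s)) => [|[z m]]; last first.
  rewrite inE /= => /andP[zS /and3P[zm mD ml]].
  rewrite -(card_ptsD1 zm); apply: eq_card => y; rewrite !inE /=.
  have [->|yz] := eqVneq y z; first by rewrite !andbF.
  have [ym|] := boolP (inc y m); last by rewrite !andbF.
  rewrite !andbT /=; apply/and3P; split; first by move/line_inP: mD; apply.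
    by apply: contraNN yz => yl; rewrite (point_eq ml ym yl zm (SP _ zS)).
  by apply/existsP; exists z; rewrite zS; apply/collP; exists m.
rewrite [in RHS](eq_bigr (fun=> 1)) => [|y]; last first.
  rewrite inE => /and3P[yD yl /existsP[z /andP[zS /collP[m ym zm]]]].
  have zl := SP _ zS.
  have yz : y != z by apply: contraNneq yl => ->.
  apply: (@card_unique _ _ (z, m)).
    rewrite !inE /= zS zm ym yz !andbT /=; apply/andP; split; last first.
      by apply: contraNneq yl => <-.
    by apply: (join_in Dsub yD lD yl ym zm zl).
  move=> [z' m']; rewrite !inE /= => /andP[/and4P[z'S z'm' m'D m'l] /andP[ym' yz']].
  have eqm : m' = m by apply: (gq_notri gq yl ym' z'm' (SP _ z'S) ym zm zl).
  rewrite eqm in z'm' m'l *; congr (_, _).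
  exact: (point_eq m'l z'm' (SP _ z'S) zm zl).
by rewrite !sum_nat_const muln1 cardA.
Qed.

Lemma card_noncoll x l : x \in D -> inc x l -> line_in D l ->
  #|[set y in D | ~~ coll x y]| = s * t' * s.
Proof.
move=> xD xl lD; have := card_joined_off_line lD (subsetDl (pts l) [set x]).
rewrite (card_ptsD1 xl) => <-.
apply: eq_card => y; rewrite !inE; have [yD /=|//] := boolP (y \in D).
have [yl|yl] := boolP (inc y l).
  by apply/negbTE; rewrite negbK; apply/collP; exists l.
rewrite andTb; apply/idP/existsP => [xy|[z]]; last first.
  rewrite !inE => /andP[/andP[zx zl] /collP[m ym zm]].
  apply: contraNN zx => /collP[k xk yk].
  have mk : m = k by apply: (gq_notri gq yl ym zm zl yk xk xl).
  have ml : m != l by apply: contraNneq yl => <-.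
  by rewrite (point_eq ml zm zl _ xl) // mk.
have [m ym [z zm zl]] := gq_proj gq yl; exists z; rewrite !inE zl andbT; apply/andP; split.
  by apply: contraNneq xy => <-; apply/collP; exists m.
by apply/collP; exists m.
Qed.

Lemma card_subspace l : line_in D l -> #|D| = s.+1 * (s * t').+1.
Proof.
move=> lD; have := card_joined_off_line lD (subxx _); rewrite card_pts.
have -> : [set y in D | ~~ inc y l && [exists z in pts l, coll y z]] = D :\: pts l.
  apply/setP => y; rewrite !inE [RHS]andbC; have [yD /=|//] := boolP (y \in D).
  have [//|yl /=] := boolP (inc y l); apply/existsP.
  have [m ym [z zm zl]] := gq_proj gq yl; exists z; rewrite inE zl /=.
  by apply/collP; exists m.
by rewrite cardsD (setIidPr lD) card_pts => ?; have := subset_leq_card lD;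
  rewrite card_pts; nia.
Qed.

End ConstantDegree.

(** * Lines that block every line of a quadrangle *)

Section Blocking.
Variables (t d : nat) (L : {set Y}).
Hypothesis s_gt1 : 1 < s.
Hypothesis degT : forall x, #|pencil_in setT x| = t.+1.
Hypothesis blockL : forall g, exists2 l, l \in L & meets g l.
Implicit Types (g : Y) (W : {set X}) (G : {set Y}).

Definition covered := [set x | [exists l in L, inc x l]].
Local Notation M := covered.
Definition through x := [set l in L | inc x l].
Definition meeting g := [set l in L | meets g l].

Lemma coveredP x : reflect (exists2 l, l \in L & inc x l) (x \in M).
Proof.
rewrite inE; apply: (iffP existsP) => -[l]; first by case/andP => ? ?; exists l.
by move=> ? ?; exists l; apply/andP.
Qed.

Lemma in_pencilT x l : (l \in pencil_in setT x) = inc x l.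
Proof. by rewrite inE /line_in subsetT andbT. Qed.

Lemma meets_self l : meets l l.
Proof.
have /card_gt0P[x] : 0 < #|pts l| by rewrite card_pts.
by rewrite inE => xl; apply/meets_pointP; exists x.
Qed.

Lemma meeting_gt0 g : 0 < #|meeting g|.
Proof. by have [l lL gl] := blockL g; apply/card_gt0P; exists l; rewrite inE lL. Qed.

Lemma card_points : 0 < #|X| -> #|X| = s.+1 * (s * t).+1.
Proof.
case/card_gt0P => x _; rewrite -cardsT.
have /card_gt0P[l _] : 0 < #|pencil_in setT x| by rewrite degT.
by apply: (@card_subspace setT t subspaceT (fun y _ => degT y) l); apply: subsetT.
Qed.

(** A line of L misses x, hence meets exactly one line on x. *)
Lemma sum_meeting_pencil x : x \notin M ->
  \sum_(g in pencil_in setT x) #|meeting g| = #|L|.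
Proof.
move=> xM; rewrite (double_count (pencil_in setT x) L meets) -sum1_card.
apply: eq_bigr => l lL; rewrite -[RHS](card_proj (subspaceT) (in_setT x) (subsetT _) (l := l)).
  by apply: eq_card => m; rewrite !inE meetsC.
by apply: contraNN xM => xl; apply/coveredP; exists l.
Qed.

(** On an uncovered point the t + 1 lines are met by distinct lines of L; and if all points
    are covered then L is large because each line covers only s + 1 points. *)
Lemma card_blocking_ge : 0 < #|X| -> t < #|L|.
Proof.
move=> X_gt0; have [/existsP[x xM]|/existsPn allM] := boolP [exists x, x \notin M].
  rewrite -(sum_meeting_pencil xM) -(degT x) -sum1_card.
  by apply: leq_sum => g _; apply: meeting_gt0.
have : #|X| <= #|L| * s.+1.
  rewrite -sum_nat_const -cardsT; apply: (@leq_trans #|\bigcup_(l in L) pts l|).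
    apply/subset_leq_card/subsetP => x _; have := allM x; rewrite negbK => /coveredP[l lL xl].
    by apply/bigcupP; exists l; rewrite ?inE.
  by apply: leq_trans (leq_card_bigcup _ _) _; apply: leq_sum => l _; rewrite card_pts.
rewrite card_points // [leqRHS]mulnC leq_pmul2l //; apply: leq_trans.
by rewrite ltnS leq_pmull // ltnW.
Qed.

Hypothesis cardL : #|L| = t.+1 + d.

(** Each of the t + 1 lines on x meets L, so that the excess d of the total bounds the
    excess on any subset G of them. *)
Lemma sum_meeting x G : x \notin M -> G \subset pencil_in setT x ->
  \sum_(g in G) #|meeting g| <= #|G| + d.
Proof.
move=> xM Gx; have := sum_meeting_pencil xM; rewrite cardL (big_setID G) /= (setIidPr Gx).
have : #|pencil_in setT x :\: G| <= \sum_(g in pencil_in setT x :\: G) #|meeting g|.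
  by rewrite -sum1_card; apply: leq_sum => g _; apply: meeting_gt0.
have := cardsD (pencil_in setT x) G; rewrite (setIidPr Gx) degT.
have := subset_leq_card Gx; rewrite degT; lia.
Qed.

Lemma meeting_uncovered x g : x \notin M -> inc x g -> #|meeting g| <= d.+1.
Proof.
move=> xM xg; have := @sum_meeting x [set g] xM.
by rewrite big_set1 cards1; apply; rewrite sub1set in_pencilT.
Qed.

Lemma card_covering (K : {set Y}) g W : g \notin K -> W \subset pts g ->
  (forall y, y \in W -> exists2 l, l \in K & inc y l) ->
  #|W| <= #|[set l in K | [exists y in W, inc y l]]|.
Proof.
move=> gK /subsetP Wg WK; set K' := [set l in K | _].
have := double_count W K' (fun y l => inc y l).
have: \sum_(y in W) #|[set l in K' | inc y l]| >= #|W|.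
  rewrite -sum1_card; apply: leq_sum => y yW; have [l lK yl] := WK _ yW.
  by apply/card_gt0P; exists l; rewrite !inE lK yl andbT; apply/existsP; exists y; rewrite yW.
suff: \sum_(l in K') #|[set y in W | inc y l]| <= #|K'| by lia.
rewrite -[leqRHS]sum1_card; apply: leq_sum => l; rewrite inE => /andP[lK _].
apply/card_le1_eqP => y z; rewrite !inE => /andP[/Wg + yl] /andP[/Wg + zl].
rewrite !inE => yg zg; apply: (point_eq _ zg zl yg yl).
by apply: contraNneq gK => ->.
Qed.

Lemma card_covered_pts g : g \notin L -> #|pts g :&: M| <= #|meeting g|.
Proof.
move=> gL; apply: leq_trans (card_covering gL (subsetIl _ _) _) _.
  by move=> y /setIP[_ /coveredP].
apply/subset_leq_card/subsetP => l; rewrite !inE => /andP[-> /existsP[y]].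
by rewrite !inE => /andP[/andP[yg _] yl]; apply/meets_pointP; exists y.
Qed.

Lemma uncovered_notinL x g : x \notin M -> inc x g -> g \notin L.
Proof. by move=> xM xg; apply: contraNN xM => gL; apply/coveredP; exists g. Qed.

Lemma nfullP g : reflect (exists2 x, x \notin M & inc x g) (~~ line_in M g).
Proof.
apply: (iffP subsetPn) => [[x]|[x xM xg]]; first by rewrite inE => ? ?; exists x.
by exists x; rewrite // inE.
Qed.

Lemma card_covered_nfull g : ~~ line_in M g -> #|pts g :&: M| <= d.+1.
Proof.
case/nfullP => x xM xg; apply: leq_trans (meeting_uncovered xM xg).
exact: card_covered_pts (uncovered_notinL xM xg).
Qed.

Lemma full_of_card g : d.+1 < #|pts g :&: M| -> line_in M g.
Proof. by apply: contraTT => /card_covered_nfull; rewrite -leqNgt. Qed.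

Lemma card_uncovered_le n g : n <= #|pts g :&: M| -> #|pts g :\: M| <= s.+1 - n.
Proof. by rewrite cardsD card_pts; apply: leq_sub2l. Qed.

Lemma card_uncovered_nfull g : ~~ line_in M g -> s - d <= #|pts g :\: M|.
Proof. by move/card_covered_nfull; rewrite cardsD card_pts; lia. Qed.

Lemma card_perp_uncovered x G : x \notin M -> G \subset pencil_in setT x ->
  #|[set w in M | [exists g in G, inc w g]]| <= #|G| + d.
Proof.
move=> xM Gx; apply: leq_trans (sum_meeting xM Gx).
apply: (@leq_trans #|\bigcup_(g in G) (pts g :&: M)|).
  apply/subset_leq_card/subsetP => w; rewrite inE => /andP[wM /existsP[g /andP[gG wg]]].
  by apply/bigcupP; exists g => //; rewrite inE wM inE wg.
apply: leq_trans (leq_card_bigcup _ _) _; apply: leq_sum => g /(subsetP Gx).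
rewrite in_pencilT => xg; exact: card_covered_pts (uncovered_notinL xM xg).
Qed.

(** If x is on more than d + 1 lines of L then all lines on x are full. On each line on x
    outside L the s points other than x then need s lines of L of their own, which is more
    than L has unless all lines on x are in L. *)
Lemma pencil_or_small : d.+1 < s ->
  (exists x, pencil_in setT x \subset L) \/ (forall x, #|through x| <= d.+1).
Proof.
move=> ds; have [/existsP[x ltx]|/existsPn small] := boolP [exists x, d.+1 < #|through x|].
  left; exists x.
  pose G := pencil_in setT x :\: L; pose K := L :\: through x.
  have full g : inc x g -> line_in M g.
    move=> xg; apply: contraLR ltx => /nfullP[y yM yg].
    rewrite -leqNgt (leq_trans _ (meeting_uncovered yM yg)) // subset_leq_card //.
    by apply/subsetP => l; rewrite !inE => /andP[-> xl]; apply/meets_pointP; exists x.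
  have low : \sum_(g in G) #|[set l in K | meets g l]| >= #|G| * s.
    rewrite -sum_nat_const; apply: leq_sum => g.
    rewrite in_setD in_pencilT => /andP[gL xg]; rewrite -[leqLHS](card_ptsD1 xg).
    apply: leq_trans (card_covering gL (subsetDl _ _) _) _.
      by move=> y; rewrite !inE => /andP[_ yg]; apply/coveredP/(line_inP _ _ (full _ xg)).
    apply/subset_leq_card/subsetP => l; rewrite !inE => /andP[lL /existsP[y]].
    rewrite !inE => /andP[/andP[yx yg] yl]; rewrite lL /= andbT; apply/andP; split.
      by apply: contraNN yx => xl; rewrite (point_eq _ yg yl xg xl) //;
        apply: contraNneq gL => ->.
    by apply/meets_pointP; exists y.
  have up : \sum_(l in K) #|[set g in G | meets g l]| <= #|K|.
    rewrite -[leqRHS]sum1_card; apply: leq_sum => l; rewrite !inE => /andP[+ lL].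
    rewrite lL /= => xl.
    rewrite -(card_proj subspaceT (in_setT x) (subsetT _) xl).
    apply/subset_leq_card/subsetP => g; rewrite !inE => /andP[/andP[_ ->] /=].
    by rewrite meetsC.
  have eqd := double_count G K meets.
  have cK : #|K| + #|through x| = #|L|.
    rewrite addnC -(cardsID (through x) L); congr (_ + _); apply: eq_card => l.
    by rewrite !inE; case: (l \in L).
  have cG : #|G| + #|through x| = t.+1.
    rewrite -(degT x) addnC -(cardsID L (pencil_in setT x)); congr (_ + _).
    by apply: eq_card => l; rewrite !inE /line_in subsetT andbT andbC.
  rewrite -setD_eq0 -cards_eq0 -/G; rewrite cardL in cK.
  by case: #|G| low cG => // n; nia.
by right=> x; rewrite leqNgt.
Qed.


Lemma card_lines : #|Y| * s.+1 = #|X| * t.+1.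
Proof.
have := double_count [set: Y] [set: X] (fun l x => inc x l).
rewrite (eq_bigr (fun=> s.+1)) => [|l _]; last first.
  by rewrite -[RHS](card_pts l); apply: eq_card => x; rewrite !inE.
rewrite [in RHS](eq_bigr (fun=> t.+1)) => [|x _]; last first.
  by rewrite -[RHS](degT x); apply: eq_card => l; rewrite in_pencilT !inE.
by rewrite !sum_nat_const !cardsT.
Qed.

(** Flags of covered points are counted: every line has a covered point, and the lines of
    L have s + 1 of them. *)
Lemma card_covered_lb : 0 < #|X| -> s * t + s < #|M|.
Proof.
move=> X_gt0; have := double_count M [set: Y] inc.
rewrite (eq_bigr (fun=> t.+1)) => [|x _]; last first.
  by rewrite -[RHS](degT x); apply: eq_card => l; rewrite in_pencilT !inE.
rewrite (bigID (mem L)) /= sum_nat_const => eqM.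
have inL : \sum_(l in setT | l \in L) #|[set x in M | inc x l]| = #|L| * s.+1.
  rewrite -sum_nat_const; apply: eq_big => [l|l /andP[_ lL]]; first by rewrite inE.
  rewrite -[RHS](card_pts l); apply: eq_card => x; rewrite inE [in RHS]inE.
  by have [xl|] := boolP (inc x l); rewrite ?andbF // andbT; apply/coveredP; exists l.
have notL : #|~: L| <= \sum_(l in setT | l \notin L) #|[set x in M | inc x l]|.
  rewrite -sum1_card (eq_bigl (fun l => (l \in setT) && (l \notin L))) => [|l]; last first.
    by rewrite !inE.
  apply: leq_sum => l _; have [k kL /meets_pointP[x xl xk]] := blockL l.
  by apply/card_gt0P; exists x; rewrite inE xl andbT; apply/coveredP; exists k.
have := cardsC L; have := card_lines; rewrite card_points // => cY cL.
rewrite inL cardL in eqM cL.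
have cY' : #|Y| = (s * t).+1 * t.+1.
  by apply/eqP; rewrite -(eqn_pmul2r (ltn0Sn s)); apply/eqP; rewrite cY; lia.
rewrite cY' in cL; set v := s * t in cL *.
have {eqM notL inL} : (t.+1 + d) * s.+1 + #|~: L| <= #|M| * t.+1 by rewrite eqM leq_add2l.
have -> : (t.+1 + d) * s.+1 + #|~: L| = v.+1 * t.+1 + (t.+1 + d) * s by lia.
move=> le; have: (v + s).+1 * t.+1 <= #|M| * t.+1 by apply: leq_trans le; lia.
by rewrite leq_pmul2r.
Qed.

Definition transversals l l' := [set g | meets g l && meets g l'].

Lemma transversal_at l l' x : ~~ meets l l' -> inc x l ->
  exists2 g, g \in transversals l l' & inc x g.
Proof.
move=> ll' xl; have [g xg [y yg yl']] := gq_proj gq (skew_offP ll' xl).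
by exists g; rewrite // inE; apply/andP; split; apply/meets_pointP; [exists x | exists y].
Qed.

Lemma transversal_uniq l l' x g g' : ~~ meets l l' -> inc x l ->
  g \in transversals l l' -> g' \in transversals l l' -> inc x g -> inc x g' -> g = g'.
Proof.
move=> ll' xl; rewrite !inE => /andP[_ /meets_pointP[y yg yl']] /andP[_ /meets_pointP[z zg zl']] xg xg'.
exact: (gq_notri gq (skew_offP ll' xl) xg yg yl' xg' zg zl').
Qed.

Lemma transversal_neq l l' g : ~~ meets l l' -> g \in transversals l l' -> g != l.
Proof. by move=> ll'; rewrite inE => /andP[_]; apply: contraTneq => ->. Qed.

Lemma card_transversals l l' : ~~ meets l l' -> #|transversals l l'| = s.+1.
Proof.
move=> ll'; have := double_count (pts l) (transversals l l') inc.
rewrite (eq_bigr (fun=> 1)) => [|x]; last first.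
  rewrite inE => xl; have [g gT xg] := transversal_at ll' xl.
  apply: (@card_unique _ _ g); first by rewrite inE gT.
  move=> k; rewrite inE => /andP[kT xk]; exact: (transversal_uniq ll' xl).
rewrite [in RHS](eq_bigr (fun=> 1)) => [|g gT]; last first.
  have := gT; rewrite inE => /andP[/meets_pointP[x xg xl] _].
  apply: (@card_unique _ _ x); first by rewrite !inE xl.
  move=> y; rewrite !inE => /andP[yl yg]; have ngl := transversal_neq ll' gT.
  exact: (point_eq ngl).
by rewrite !sum1_card card_pts.
Qed.

Lemma transversal_disjoint l l' g g' x : ~~ meets l l' ->
  g \in transversals l l' -> g' \in transversals l l' -> inc x g -> inc x g' -> g = g'.
Proof.
move=> ll' gT g'T xg xg'; have [xl|xl] := boolP (inc x l).
  exact: (transversal_uniq ll' xl gT g'T).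
have := gT; have := g'T; rewrite !inE => /andP[/meets_pointP[y yg yl] _] /andP[/meets_pointP[z zg zl] _].
exact: (gq_notri gq xl xg zg zl xg' yg yl).
Qed.

Lemma card_transversals_hit l l' (T0 : {set Y}) W : ~~ meets l l' ->
  T0 \subset transversals l l' -> (forall f, f \in T0 -> exists2 w, w \in W & inc w f) ->
  #|T0| <= #|W|.
Proof.
move=> ll' /subsetP T0T hit; apply: (leq_card_hit (inc := inc)) => // f g w /T0T fT /T0T gT _.
exact: transversal_disjoint ll' fT gT.
Qed.

(** This bounds the number of other lines of L that meet l. *)
Definition excess l := \sum_(x in pts l) #|through x|.-1.

Lemma card_meeting_excess l : l \in L -> #|meeting l :\ l| <= excess l.
Proof.
move=> lL; apply: (@leq_trans #|\bigcup_(x in pts l) (through x :\ l)|).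
  apply/subset_leq_card/subsetP => k; rewrite !inE => /and3P[kl kL /meets_pointP[x xl xk]].
  by apply/bigcupP; exists x; rewrite !inE ?kl ?kL.
apply: leq_trans (leq_card_bigcup _ _) _; apply: leq_sum => x; rewrite inE => xl.
by rewrite [X in _ <= X.-1](cardsD1 l) inE lL xl.
Qed.

(** Count the triples of an uncovered point x, a line g on x and an ordered pair of lines of
    L that meet g. For a fixed x the excess over 1 of the numbers of lines of L met by the
    lines on x is d in total, which leaves at most d (d + 1) such pairs. On the other
    hand L has at least (t + 1) (t - s d) skew pairs, and each transversal of such a pair that
    is not full has at least s - d uncovered points. *)
Lemma skew_pair_many_full F : 0 < #|X| -> (forall x, #|through x| <= d.+1) -> d < s ->
  s * (s * t).+1 * (d * d.+1) < t.+1 * (t - s * d) * ((s.+1 - F) * (s - d)) ->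
  exists l l', [/\ l \in L, l' \in L, ~~ meets l l' &
                   F < #|[set g in transversals l l' | line_in M g]|].
Proof.
move=> X_gt0 small ds arith.
pose S := [set p : Y * Y | (p.1 \in L) && ((p.2 \in L) && ~~ meets p.1 p.2)].
have [/existsP[[l l'] /andP[]]|/existsPn few] :=
    boolP [exists p, (p \in S) && (F < #|[set g in transversals p.1 p.2 | line_in M g]|)].
  by rewrite inE /= => /and3P[lL l'L ll'] ltF; exists l, l'.
suff: t.+1 * (t - s * d) * ((s.+1 - F) * (s - d)) <= s * (s * t).+1 * (d * d.+1) by lia.
pose A := [set f : X * Y | (f.1 \in ~: M) && inc f.1 f.2].
have := double_count S A (fun p f => meets f.2 p.1 && meets f.2 p.2).
have lower p : p \in S ->
    (s.+1 - F) * (s - d) <= #|[set f in A | meets f.2 p.1 && meets f.2 p.2]|.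
  move=> pS; have := few p; rewrite pS /= -leqNgt => leF.
  have := pS; rewrite inE => /and3P[_ _ ll'].
  have -> : #|[set f in A | meets f.2 p.1 && meets f.2 p.2]| =
      \sum_(g in transversals p.1 p.2) #|pts g :\: M|.
    rewrite -(card_in_imset (f := fun f => (f.2, f.1))); last by case=> ? ? [? ?] _ _ [-> ->].
    have := card_sigma_set (transversals p.1 p.2) (fun g x => x \in pts g :\: M).
    rewrite (eq_bigr (fun g => #|pts g :\: M|)) => [<-|g _]; last first.
      by apply: eq_card => x; rewrite inE.
    apply: eq_card => -[g x]; rewrite inE /=; apply/imsetP/andP => [[[y h]]|[]].
      by rewrite !inE /= => /andP[/andP[yM yh] /andP[hp hp']] [-> ->]; rewrite hp hp' yM.
    by rewrite !inE => gT /andP[xM xg]; exists (x, g); rewrite // !inE xM xg gT.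
  rewrite (big_setID [set g in transversals p.1 p.2 | line_in M g]) /=.
  apply: leq_trans (leq_addl _ _).
  apply: (@leq_trans (\sum_(g in transversals p.1 p.2 :\:
      [set g in transversals p.1 p.2 | line_in M g]) (s - d))).
    rewrite sum_nat_const leq_mul2r; apply/orP; right.
    rewrite cardsD card_transversals // (setIidPr _); first by lia.
    by apply/subsetP => g; rewrite inE => /andP[].
  apply: leq_sum => g; rewrite !inE => /andP[+ gT]; rewrite gT /=.
  exact: card_uncovered_nfull.
have upper : \sum_(f in A) #|[set p in S | meets f.2 p.1 && meets f.2 p.2]| <=
    s * (s * t).+1 * (d * d.+1).
  apply: (@leq_trans (\sum_(f in A) (#|meeting f.2|.-1 * d.+1))).
    apply: leq_sum => -[x g]; rewrite inE /= => /andP[xM xg].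
    rewrite inE in xM.
    apply: (@leq_trans (#|meeting g| * #|meeting g|.-1)); last first.
      by rewrite mulnC leq_mul2l (meeting_uncovered xM xg) orbT.
    rewrite -sum_nat_const.
    apply: (@leq_trans #|[set p : Y * Y | (p.1 \in meeting g) && (p.2 \in meeting g :\ p.1)]|).
      apply/subset_leq_card/subsetP => -[l l']; rewrite !inE /=.
      move=> /andP[/and3P[-> -> ll'] /andP[-> ->]]; rewrite !andbT /=.
      by apply: contraNneq ll' => ->; apply: meets_self.
    rewrite (card_sigma_set (meeting g) (fun l l' => l' \in meeting g :\ l)).
    apply: leq_sum => l lm; have := cardsD1 l (meeting g); rewrite lm => ->.
    by rewrite add1n /=; apply/subset_leq_card/subsetP => k; rewrite inE.
  rewrite -big_distrl /= mulnCA mulnA leq_mul2r; apply/orP; right.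
  have -> : \sum_(f in A) #|meeting f.2|.-1 =
      \sum_(x in ~: M) \sum_(g in pencil_in setT x) #|meeting g|.-1.
    rewrite pair_big_dep /=; apply: eq_bigl => -[x g].
    by rewrite [LHS]inE [in RHS]in_pencilT.
  apply: (@leq_trans (\sum_(x in ~: M) d)); last first.
    rewrite sum_nat_const mulnC leq_mul2l; apply/orP; right.
    have := card_covered_lb X_gt0; have := cardsC M; rewrite card_points //; nia.
  apply: leq_sum => x; rewrite inE => xM.
  have := sum_meeting xM (subxx _).
  rewrite (eq_bigr (fun g => 1 + #|meeting g|.-1)) => [|g _]; last first.
    by rewrite add1n prednK ?meeting_gt0.
  by rewrite big_split /= sum1_card leq_add2l.
have cardS : t.+1 * (t - s * d) <= #|S|.
  rewrite /S (card_sigma_set L (fun l l' => (l' \in L) && ~~ meets l l')).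
  apply: (@leq_trans (\sum_(l in L) (t - s * d))).
    by rewrite sum_nat_const cardL leq_mul2r leq_addr orbT.
  apply: leq_sum => l lL.
  have -> : #|[set l' | (l' \in L) && ~~ meets l l']| = #|L :\: meeting l|.
    by apply: eq_card => k; rewrite !inE meetsC; case: (k \in L); rewrite /= ?andbF ?andbT.
  have : #|meeting l :\ l| <= s.+1 * d.
    apply: leq_trans (card_meeting_excess lL) _.
    rewrite -(card_pts l) -sum_nat_const; apply: leq_sum => x _.
    by have := small x; lia.
  have := cardsD1 l (meeting l); rewrite inE lL meets_self /=.
  by rewrite (cardsD L) cardL (setIidPr _); [lia | apply/subsetP => k; rewrite inE => /andP[]].
move=> eqsum; apply: leq_trans upper; rewrite -eqsum.
apply: (@leq_trans (\sum_(p in S) ((s.+1 - F) * (s - d)))); last exact: leq_sum.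
by rewrite sum_nat_const leq_mul2r cardS orbT.
Qed.


Section Hyperplane.
Variables (D : {set X}) (t' : nat).
Hypothesis Dsub : subspace D.
Hypothesis degD : forall x, x \in D -> #|pencil_in D x| = t'.+1.
Hypothesis t_eq : t = s * t'.
Hypothesis D_gt0 : 0 < #|D|.
Local Notation LD := [set l in L | line_in D l].

Lemma card_LD : #|LD| + #|L :\: LD| = t.+1 + d.
Proof.
rewrite -cardL -(cardsID LD L) (setIidPr _) //.
by apply/subsetP => l; rewrite inE => /andP[].
Qed.

Lemma card_hyperplane : #|D| = s.+1 * t.+1.
Proof.
have /card_gt0P[x xD] := D_gt0.
have /card_gt0P[l] : 0 < #|pencil_in D x| by rewrite degD.
by rewrite inE => /andP[_ lD]; rewrite (card_subspace Dsub degD lD) t_eq.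
Qed.

Lemma card_pts_notin l : ~~ line_in D l -> #|pts l :&: D| <= 1.
Proof.
move=> lD; apply/card_le1_eqP => y x; rewrite !inE => /andP[yl yD] /andP[xl xD].
by apply/eqP; apply: contraNT lD => xy; apply: (Dsub xy).
Qed.

Lemma sum_through_hyperplane :
  \sum_(x in D) #|through x| <= s.+1 * #|LD| + #|L :\: LD|.
Proof.
rewrite (double_count D L inc) (big_setID LD) /=.
apply: leq_add.
  rewrite mulnC -sum_nat_const; apply: (@leq_trans (\sum_(l in L :&: LD) s.+1)).
    apply: leq_sum => l _; rewrite -(card_pts l).
    by apply/subset_leq_card/subsetP => x; rewrite !inE => /andP[].
  by rewrite !sum_nat_const leq_mul2r subset_leq_card ?orbT // subsetIr.
rewrite -sum1_card; apply: leq_sum => l; rewrite !inE => /andP[+ lL]; rewrite lL /= => lD.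
apply: leq_trans (card_pts_notin lD).
by apply/subset_leq_card/subsetP => x; rewrite !inE andbC.
Qed.

(** The t - t' lines on an uncovered point x of D that leave D can only be met by lines of L
    outside D, each of which meets at most one of them. *)
Lemma all_covered_of_many : t'.+1 + d < #|LD| -> D \subset M.
Proof.
move=> many; apply/subsetP => x xD; apply: contraLR many => xM; rewrite -leqNgt.
pose G := pencil_in setT x :\: pencil_in D x; pose K := L :\: LD.
have low : #|G| <= \sum_(g in G) #|[set l in K | meets g l]|.
  rewrite -sum1_card; apply: leq_sum => g; rewrite in_setD in_pencilT => /andP[gD xg].
  have [l lL gl] := blockL g; apply/card_gt0P; exists l; rewrite !inE lL gl !andbT /=.
  apply: contraNN gD => lD; rewrite inE xg /=; have [y yg yl] := meets_pointP _ _ gl.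
  apply: (Dsub _ xD _ xg yg); last by move/line_inP: lD; apply.
  by apply: contraNneq xM => ->; apply/coveredP; exists l.
have up : \sum_(l in K) #|[set g in G | meets g l]| <= #|K|.
  rewrite -[leqRHS]sum1_card; apply: leq_sum => l; rewrite in_setD => /andP[_ lL].
  have xl : ~~ inc x l by apply: contraNN xM => xl; apply/coveredP; exists l.
  rewrite -(card_proj subspaceT (in_setT x) (subsetT _) xl).
  apply/subset_leq_card/subsetP => g; rewrite inE in_setD [in X in _ -> X]inE.
  by move=> /andP[/andP[_ ->]]; rewrite meetsC.
have := double_count G K meets; have := card_LD.
have : #|G| = t - t'.
  rewrite cardsD degT (setIidPr _) ?degD ?subSS //.
  by apply/subsetP => g; rewrite in_pencilT inE => /andP[].
rewrite -/K; have : t' <= t by rewrite t_eq leq_pmull; lia.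
lia.
Qed.

Lemma transversal_in l l' g : line_in D l -> line_in D l' -> ~~ meets l l' ->
  g \in transversals l l' -> line_in D g.
Proof.
move=> lD l'D ll'; rewrite inE => /andP[/meets_pointP[x xg xl] /meets_pointP[y yg yl']].
apply: (join_in Dsub _ l'D (skew_offP ll' xl) xg yg yl').
by move/line_inP: lD; apply.
Qed.

Definition star x := [set w | [exists g in pencil_in D x, inc w g]].

Lemma star_hits x f : x \in D -> line_in D f -> ~~ inc x f ->
  exists2 w, w \in star x & inc w f.
Proof.
move=> xD fD xf; have [m xm [y ym yf]] := gq_proj gq xf; exists y => //.
rewrite inE; apply/existsP; exists m; rewrite inE xm ym andbT.
exact: (join_in Dsub xD fD xf xm ym yf).
Qed.

Lemma card_star_covered x : x \in D -> x \notin M -> #|M :&: star x| <= t'.+1 + d.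
Proof.
move=> xD xM; rewrite -(degD xD).
have Gx : pencil_in D x \subset pencil_in setT x.
  by apply/subsetP => g; rewrite in_pencilT inE => /andP[].
apply: leq_trans (card_perp_uncovered xM Gx); apply/subset_leq_card/subsetP => w.
by case/setIP => wM wx; rewrite in_set wM; move: wx; rewrite in_set.
Qed.

(** An uncovered point of D projects to different covered points on the full transversals,
    because these are disjoint. *)
Lemma all_covered_of_transversals l l' : line_in D l -> line_in D l' -> ~~ meets l l' ->
  t'.+1 + d < #|[set g in transversals l l' | line_in M g]| -> D \subset M.
Proof.
move=> lD l'D ll' many; apply/subsetP => x xD; apply: contraLR many => xM.
rewrite -leqNgt; apply: leq_trans (card_star_covered xD xM).
apply: (card_transversals_hit ll') => [|f].
  by apply/subsetP => g; rewrite inE => /andP[].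
rewrite inE => /andP[fT fM]; have fD := transversal_in lD l'D ll' fT.
have [|w wx wf] := star_hits xD fD.
  by apply: contraNN xM => xf; move/line_inP: fM; apply.
by exists w => //; rewrite inE wx andbT; move/line_inP: fM; apply.
Qed.

Hypothesis DM : D \subset M.
Hypothesis d_lt_s : d < s.

(** A line outside D covers at most one point of D instead of s + 1. *)
Lemma few_outside : #|L :\: LD| <= d.
Proof.
have := sum_through_hyperplane; have := card_LD; have := card_hyperplane.
have : #|D| <= \sum_(x in D) #|through x|.
  rewrite -sum1_card; apply: leq_sum => x /(subsetP DM)/coveredP[l lL xl].
  by apply/card_gt0P; exists l; rewrite inE lL.
set k := #|L :\: LD|; set n := #|LD| => h1 h2 h3 h4.
have : s.+1 * t.+1 <= s.+1 * n + k by lia.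
have [//|dk] := leqP k d; nia.
Qed.

(** Let the holes be the points of D on no line of L in D; there are at most as many as
    there are lines of L outside D. If x is a hole, then the (t' + 1) s points of D collinear
    with x that are not holes are on different lines of L in D, and L would have at least
    t + 1 + s elements. *)
Lemma inner_cover x : x \in D -> exists l, [/\ l \in L, line_in D l & inc x l].
Proof.
move=> xD; have [/existsP[l]|/existsPn noLD] := boolP [exists l, (l \in LD) && inc x l].
  by rewrite inE => /andP[/andP[lL lD] xl]; exists l.
pose holes := [set y in D | [forall l, ~~ ((l \in LD) && inc y l)]].
have card_holes : #|holes| <= #|L :\: LD|.
  have := double_count holes (L :\: LD) inc.
  have : #|holes| <= \sum_(y in holes) #|[set l in L :\: LD | inc y l]|.
    rewrite -sum1_card; apply: leq_sum => y; rewrite inE => /andP[yD /forallP hy].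
    have /coveredP[l lL yl] := subsetP DM _ yD; apply/card_gt0P; exists l.
    by have := hy l; rewrite !inE yl !andbT lL /= => ->.
  suff: \sum_(l in L :\: LD) #|[set y in holes | inc y l]| <= #|L :\: LD| by lia.
  rewrite -[leqRHS]sum1_card; apply: leq_sum => l; rewrite !inE => /andP[+ lL].
  rewrite lL /= => lD; apply: leq_trans (card_pts_notin lD).
  by apply/subset_leq_card/subsetP => y; rewrite !inE => /andP[/andP[-> _] ->].
have xholes : x \in holes by rewrite inE xD; apply/forallP.
have linesE : \sum_(g in pencil_in D x) #|[set l in LD | meets g l]| = #|LD|.
  rewrite double_count -sum1_card; apply: eq_bigr => l; have := noLD l.
  rewrite inE => xl /andP[lL lD]; move: xl; rewrite lL lD /= => xl.
  by rewrite -[RHS](card_proj Dsub xD lD xl); apply: eq_card => g; rewrite !inE meetsC.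
have holesE : \sum_(g in pencil_in D x) #|[set y in holes :\ x | inc y g]| < #|holes|.
  rewrite double_count [ltnRHS](cardsD1 x) xholes add1n ltnS -[leqRHS]sum1_card.
  apply: leq_sum => y; rewrite 2!inE => /andP[yx _].
  apply/card_le1_eqP => g h; rewrite !inE => /andP[/andP[xg _] yg] /andP[/andP[xh _] yh].
  exact: (gq_two gq yx).
have : \sum_(g in pencil_in D x) s <=
    \sum_(g in pencil_in D x) (#|[set l in LD | meets g l]| + #|[set y in holes :\ x | inc y g]|).
  apply: leq_sum => g; rewrite inE => /andP[xg gD].
  rewrite -(card_ptsD1 xg) -(cardsID holes (pts g :\ x)) addnC; apply: leq_add.
    apply: leq_trans (card_covering (K := LD) (g := g) _ _ _) _.
    - by have := noLD g; rewrite xg andbT.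
    - by apply/subsetP => y; rewrite !inE => /and3P[].
    - move=> y; rewrite !inE => /and3P[+ yx yg].
      have yD : y \in D by move/line_inP: gD; apply.
      rewrite yD /= negb_forall => /existsP[l]; rewrite negbK => /andP[lLD yl].
      by exists l.
    apply/subset_leq_card/subsetP => l; rewrite inE [in X in _ -> X]inE => /andP[-> /existsP[y]].
    by rewrite !inE => /andP[/and3P[_ _ yg] yl]; apply/meets_pointP; exists y.
  by apply/subset_leq_card/subsetP => y; rewrite !inE => /andP[/andP[-> ->] ->].
rewrite big_split /= linesE sum_nat_const degD //; have := card_LD; nia.
Qed.


Section NoSmallCover.
Variable q : nat.
Hypotheses (sE : s = q ^ 2) (t'E : t' = q) (dq : d + 3 < q).
Hypothesis small : forall x, #|through x| <= d.+1.
Hypothesis triad : forall l l' r, line_in D l -> line_in D l' -> line_in D r ->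
  ~~ meets l l' -> ~~ meets r l -> ~~ meets r l' ->
  q < #|[set g in transversals l l' | meets g r]|.

Let E := \sum_(x in D) #|through x|.-1.

Lemma total_excess : E <= s.+1 * d.
Proof.
have := sum_through_hyperplane; have := few_outside; have := card_LD.
rewrite (eq_bigr (fun x => 1 + #|through x|.-1)) =>
  [|x /(subsetP DM)/coveredP[l lL xl]]; last first.
  by rewrite add1n prednK //; apply/card_gt0P; exists l; rewrite inE lL.
rewrite big_split /= sum1_card card_hyperplane -/E.
set k := #|L :\: LD|; set n := #|LD| => h1 h2 h3; nia.
Qed.

Lemma LDP l : reflect (l \in L /\ line_in D l) (l \in LD).
Proof. by rewrite inE; apply: andP. Qed.

Lemma sum_excess : \sum_(l in LD) excess l <= d.+1 * (s.+1 * d).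
Proof.
apply: (@leq_trans (d.+1 * E)); last by rewrite leq_mul2l total_excess orbT.
rewrite /excess (exchange_big_dep (mem D)) /=; last first.
  by move=> l x /LDP[_ /line_inP lD]; rewrite inE => /lD.
rewrite big_distrr; apply: leq_sum => x xD.
rewrite sum_nat_const leq_mul2r; apply/orP; right; apply: leq_trans (small x).
apply/subset_leq_card/subsetP => l; rewrite unfold_in => /andP[/LDP[lL _]].
by rewrite !inE lL.
Qed.

(** The lines of D that are covered more than once on average are few, so that there are
    two skew lines l, l' in L that meet few other lines of L. Nearly all of the q^3 + 1 or
    more lines of L in D are skew to both and meet at least q + 1 of the q^2 + 1
    transversals of l and l'. These incidences, about q^4 + q^3, exceed the number (q^2 + 1)^2
    of points on the transversals by more than the total excess (q^2 + 1) d. *)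
Lemma no_small_cover : False.
Proof.
have s_eq : s = q * q by rewrite sE mulnn.
have s1 : s.+1 = q * q + 1 by lia.
have tE : t = q * q * q by rewrite t_eq t'E s_eq.
pose good := [set l in LD | excess l <= q + q - 3].
have n_LD : q * q * q < #|LD|.
  by have := card_LD; have := few_outside; rewrite tE; lia.
have bad : (2 * q - 2) * #|LD :\: good| <= d.+1 * (s.+1 * d).
  apply: leq_trans sum_excess; rewrite (big_setID good) /=; apply: leq_trans (leq_addl _ _).
  rewrite mulnC -sum_nat_const; apply: leq_sum => l; rewrite inE => /andP[+ lLD].
  by rewrite inE lLD /= -ltnNge; lia.
have card_good : q + q - 1 <= #|good|.
  have := cardsID good LD; rewrite (setIidPr _); last first.
    by apply/subsetP => l /setIdP[].
  have : d.+1 * (s.+1 * d) <= (q - 3) * ((q * q + 1) * (q - 4)).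
    by rewrite s1; apply: leq_mul; [lia | apply: leq_mul; lia].
  move: bad n_LD; set b := #|_ :\: _|; set g := #|good|; set n := #|LD|.
  have [u ->] : exists u, q = u + 4 by exists (q - 4); lia.
  have [-> -> -> ->] : [/\ 2 * (u + 4) - 2 = 2 * u + 6, u + 4 - 3 = u + 1,
    u + 4 - 4 = u & u + 4 + (u + 4) - 1 = 2 * u + 7] by split; lia.
  move=> bad n_gt le eqn; have {le bad} := leq_trans bad le => le.
  rewrite leqNgt; apply/negP => g_lt.
  have b_ge : (u + 4) * (u + 4) * (u + 4) <= b + (2 * u + 5) by lia.
  have : (2 * u + 6) * ((u + 4) * (u + 4) * (u + 4)) <= (2 * u + 6) * (b + (2 * u + 5)).
    by rewrite leq_mul2l b_ge orbT.
  rewrite mulnDr; lia.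
have [l lgood] : exists l, l \in good by apply/card_gt0P; lia.
have goodP k : k \in good -> [/\ k \in L, line_in D k & excess k <= q + q - 3].
  by rewrite inE => /andP[/LDP[? ?] ?].
have [lL lD lex] := goodP _ lgood.
have [l' l'good ll'] : exists2 l', l' \in good & ~~ meets l l'.
  have : 0 < #|good :\: meeting l|.
    have := card_meeting_excess lL; have := cardsD1 l (meeting l).
    rewrite inE lL meets_self /= => h1 h2.
    have := subset_leq_card (subsetIr good (meeting l)).
    rewrite cardsD; lia.
  case/card_gt0P => l'; rewrite !inE => /andP[+ /andP[/andP[l'L l'D] l'ex]].
  by rewrite l'L /= => ll'; exists l'; rewrite // /good inE l'ex andbT; apply/LDP.
have [l'L l'D l'ex] := goodP _ l'good.
pose T := transversals l l'.
have TD g : g \in T -> line_in D g.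
  rewrite inE => /andP[/meets_pointP[x xg xl] /meets_pointP[y yg yl']].
  apply: (join_in Dsub _ l'D (skew_offP ll' xl) xg yg yl').
  by move/line_inP: lD; apply.
have cardT : #|T| = s.+1 by apply: card_transversals.
have upper : \sum_(g in T) \sum_(x in pts g) #|through x| <= s.+1 * s.+1 + s.+1 * d.
  apply: (@leq_trans (\sum_(g in T) (s.+1 + excess g))).
    apply: leq_sum => g _; rewrite -(card_pts g) -sum1_card /excess -big_split /=.
    by apply: leq_sum => x _; lia.
  rewrite big_split /= sum_nat_const cardT leq_add2l; apply: leq_trans total_excess.
  rewrite /excess (exchange_big_dep (mem D)) /=; last first.
    by move=> g x /TD/line_inP gD; rewrite inE => /gD.
  apply: leq_sum => x _; rewrite sum_nat_const -[leqRHS]mul1n leq_mul2r; apply/orP; right.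
  apply/card_le1_eqP => g h /andP[gT +] /andP[hT +]; rewrite !inE => xg xh.
  exact: (transversal_disjoint ll' hT gT xh xg).
pose R := LD :\: (meeting l :|: meeting l').
have cardR : q * q * q < #|R| + (2 * (q + q - 3) + 2).
  have : #|LD| <= #|R| + #|meeting l :|: meeting l'|.
    by rewrite -(cardsID (meeting l :|: meeting l') LD) addnC leq_add2l subset_leq_card ?subsetIr.
  have := (leq_card_setU (meeting l) (meeting l')).1.
  have := card_meeting_excess lL; have := cardsD1 l (meeting l).
  have := card_meeting_excess l'L; have := cardsD1 l' (meeting l').
  rewrite !inE lL l'L !meets_self /=; lia.
have lower : s.+1 + (s.+1 + #|R| * q.+1) <= \sum_(g in T) \sum_(x in pts g) #|through x|.
  have swap : \sum_(r in LD) #|[set g in T | meets g r]| <=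
      \sum_(g in T) \sum_(x in pts g) #|through x|.
    rewrite -double_count; apply: leq_sum => g gT.
    apply: (@leq_trans #|\bigcup_(x in pts g) through x|).
      apply/subset_leq_card/subsetP => r; rewrite inE => /andP[/LDP[rL _] /meets_pointP[x xg xr]].
      by apply/bigcupP; exists x; rewrite inE ?rL.
    exact: leq_card_bigcup.
  apply: leq_trans swap.
  have lLD : l \in LD by apply/LDP.
  have l'LD : l' \in LD :\ l.
    rewrite !inE l'L l'D !andbT; apply: contraNneq ll' => ->; exact: meets_self.
  rewrite (big_setD1 l) //= (big_setD1 l') //=; apply: leq_add.
    rewrite -cardT; apply/subset_leq_card/subsetP => g gT; rewrite inE gT.
    by move: gT; rewrite inE => /andP[].
  apply: leq_add.
    rewrite -cardT; apply/subset_leq_card/subsetP => g gT; rewrite inE gT.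
    by move: gT; rewrite inE => /andP[].
  rewrite (big_setID R) /= (setIidPr _); last first.
    apply/subsetP => r; rewrite !inE => /andP[+ /andP[rL rD]].
    rewrite rL rD !andbT negb_or /= => /andP[rl rl'].
    by apply/andP; split; [apply: contraNneq rl' => -> | apply: contraNneq rl => ->];
      apply: meets_self.
  apply: leq_trans (leq_addr _ _); rewrite -sum_nat_const; apply: leq_sum => r.
  rewrite !inE => /andP[+ /andP[rL rD]]; rewrite rL /= negb_or => /andP[rl rl'].
  by apply: triad; rewrite // meetsC.
have {upper lower} := leq_trans lower upper; rewrite s1.
move: cardR; set r := #|R|; have [u qE] : exists u, q = u + 4 by exists (q - 4); lia.
have du : d <= u by lia.
rewrite qE => cardR.
have r_ge : (u + 4) * (u + 4) * (u + 4) <= r + (4 * u + 11) by lia.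
have : (u + 4).+1 * ((u + 4) * (u + 4) * (u + 4)) <= (u + 4).+1 * (r + (4 * u + 11)).
  by rewrite leq_mul2l r_ge orbT.
have : ((u + 4) * (u + 4) + 1) * d <= ((u + 4) * (u + 4) + 1) * u by rewrite leq_mul2l du orbT.
rewrite mulnDr; lia.
Qed.

End NoSmallCover.

End Hyperplane.


Definition grid l l' := [set x | [exists g in transversals l l', inc x g]].

Section Grid.
Variables (l1 l2 : Y) (J : finType) (P : {set J}) (H : J -> {set X}).
Local Notation T := (transversals l1 l2).
Local Notation G := (grid l1 l2).
Hypotheses (l12 : ~~ meets l1 l2) (tE : t = s * s) (Gsub : subspace G).
Hypothesis ruling : forall y, y \in G -> exists2 r, inc y r & forall g, g \in T -> meets r g.
Hypothesis cardP : #|P| <= s.+1.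
Hypothesis coverP : forall x, exists2 j, j \in P & x \in H j.
Hypothesis subH : forall j, j \in P -> subspace (H j).
Hypothesis degH : forall j x, j \in P -> x \in H j -> #|pencil_in (H j) x| = s.+1.
Hypothesis GH : forall j, j \in P -> G \subset H j.
Hypothesis meetG : forall j g, j \in P -> line_in (H j) g -> exists2 x, x \in G & inc x g.
Hypothesis many : d.+1 < #|[set g in T | line_in M g]|.
Hypothesis d_lt_s : d < s.

Lemma in_grid x : reflect (exists2 g, g \in T & inc x g) (x \in G).
Proof.
by rewrite inE; apply: (iffP existsP) => -[g]; [case/andP => ? ?; exists g | move=> ? ?; exists g; apply/andP].
Qed.

Lemma ruling_full r : (forall g, g \in T -> meets r g) -> line_in M r.
Proof.
move=> rT; apply: full_of_card; apply: leq_trans many _.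
apply: (card_transversals_hit l12) => [|f]; first by apply/subsetP => g; rewrite inE => /andP[].
rewrite inE => /andP[/rT/meets_pointP[w wr wf] /line_inP fM]; exists w => //.
by rewrite inE fM // andbT inE.
Qed.

Lemma grid_covered : G \subset M.
Proof.
apply/subsetP => y yG; have [r yr rT] := ruling yG.
by move/line_inP: (ruling_full rT); apply.
Qed.

Lemma card_grid : #|G| = s.+1 * s.+1.
Proof.
have := double_count T G (fun g x => inc x g).
rewrite (eq_bigr (fun=> s.+1)) => [|g gT]; last first.
  rewrite -[RHS](card_pts g); apply: eq_card => x; rewrite inE [RHS]inE.
  by have [xg|] := boolP (inc x g); rewrite ?andbF // andbT; apply/in_grid; exists g.
rewrite [in RHS](eq_bigr (fun=> 1)) => [|x /in_grid[g gT xg]]; last first.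
  apply: (@card_unique _ _ g); first by rewrite inE gT.
  by move=> h; rewrite inE => /andP[hT xh]; apply: (transversal_disjoint l12 hT gT xh).
by rewrite !sum_nat_const muln1 card_transversals.
Qed.

Let M' j := (M :&: H j) :\: G.

(** The hyperplanes cover all points, there are at most s + 1 of them, and at least
    s^3 + s + 1 points are covered, of which (s + 1)^2 are on the grid. *)
Lemma exists_rich_hyperplane : 0 < #|X| -> exists2 j, j \in P & (s - 1) * (s - 1) <= #|M' j|.
Proof.
move=> X_gt0; have [/existsP[j /andP[jP ?]]|/existsPn poor] :=
  boolP [exists j, (j \in P) && ((s - 1) * (s - 1) <= #|M' j|)]; first by exists j.
have := card_covered_lb X_gt0.
have : #|M| <= #|G| + \sum_(j in P) #|M' j|.
  apply: leq_trans (leq_add (leqnn _) (leq_card_bigcup P M')).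
  apply: leq_trans (leq_card_setU _ _).1; apply/subset_leq_card/subsetP => x xM.
  rewrite in_setU; have [//|xG /=] := boolP (x \in G); have [j jP xj] := coverP x.
  by apply/bigcupP; exists j; rewrite // in_setD xG in_setI xM.
have : \sum_(j in P) #|M' j| <= \sum_(j in P) ((s - 1) * (s - 1) - 1).
  by apply: leq_sum => j jP; have := poor j; rewrite jP /= -ltnNge; lia.
rewrite sum_nat_const card_grid tE.
have := cardP; set p := #|P|; set m := #|M|; set w := \sum_(j in _) _.
have [u ->] : exists u, s = u + 2 by exists (s - 2); move: s_gt1; lia.
have -> : u + 2 - 1 = u.+1 by lia.
have -> : u.+1 * u.+1 - 1 = u * u + 2 * u by lia.
move=> ple wle mle mge; have : p * (u * u + 2 * u) <= (u + 3) * (u * u + 2 * u).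
  by rewrite leq_mul2r; lia.
lia.
Qed.

Section InHyperplane.
Variable j : J.
Hypothesis jP : j \in P.
Local Notation D := (H j).
Let Dsub : subspace D := subH jP.
Let degD x (xD : x \in D) := degH jP xD.

Lemma T_in_D g : g \in T -> line_in D g.
Proof.
move=> gT; apply/line_inP => x xg; apply: (subsetP (GH jP)); apply/in_grid; by exists g.
Qed.

(** The s + 1 disjoint lines T of the grid already provide s + 1 covered points collinear
    with x. *)
Lemma card_star_off_grid x : x \in D -> x \notin M -> #|M' j :&: star D x| <= d.
Proof.
move=> xD xM; have := card_star_covered degD xD xM.
rewrite -(cardsID G (M :&: star D x)).
have : s.+1 <= #|M :&: star D x :&: G|.
  rewrite -(card_transversals l12); apply: (card_transversals_hit l12) => // f fT.
  have [|w wx wf] := star_hits Dsub xD (T_in_D fT).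
    apply: contraNN xM => xf; apply: (subsetP grid_covered); apply/in_grid; by exists f.
  have wG : w \in G by apply/in_grid; exists f.
  by exists w => //; rewrite !in_setI wx wG (subsetP grid_covered).
have : #|M' j :&: star D x| <= #|M :&: star D x :\: G|.
  apply/subset_leq_card/subsetP => w /setIP[/setDP[/setIP[wM _] wG] wx].
  by rewrite in_setD wG in_setI wM.
lia.
Qed.

Lemma card_uncovered_D : #|D :\: M| + s.+1 * s.+1 + #|M' j| = s.+1 * (s * s).+1.
Proof.
have Dgt0 : 0 < #|D| by apply: leq_trans (subset_leq_card (GH jP)); rewrite card_grid.
rewrite -tE -(card_hyperplane Dsub degD tE Dgt0) -card_grid.
rewrite -(cardsID M D) -(cardsID G (D :&: M)) [D :&: M]setIC.
rewrite (setIidPr _) ?subsetI ?grid_covered ?GH //; rewrite /M'; lia.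
Qed.

(** Averaging over the pairs of a covered point off the grid and an uncovered point
    collinear with it. *)
Lemma exists_rich_point : d * (s * s + 1) < (s.+1 - d) * (s - d) * (s - 1) ->
  (s - 1) * (s - 1) <= #|M' j| ->
  exists2 z, z \in M' j & d < #|[set f in pencil_in D z | line_in M f]|.
Proof.
move=> arith1 rich; have [/existsP[z /andP[zM ?]]|/existsPn poor] :=
  boolP [exists z, (z \in M' j) && (d < #|[set f in pencil_in D z | line_in M f]|)].
  by exists z.
have := double_count (M' j) (D :\: M) (fun z x => z \in star D x).
have up : \sum_(x in D :\: M) #|[set z in M' j | z \in star D x]| <= #|D :\: M| * d.
  rewrite -sum_nat_const; apply: leq_sum => x /setDP[xD xM].
  by apply: leq_trans (card_star_off_grid xD xM); rewrite subset_leq_card //;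
     apply/subsetP => z; rewrite !inE.
have low : #|M' j| * ((s.+1 - d) * (s - d)) <=
    \sum_(z in M' j) #|[set x in D :\: M | z \in star D x]|.
  rewrite -sum_nat_const; apply: leq_sum => z zM'.
  have := poor z; rewrite zM' /= -leqNgt => few.
  have /setDP[/setIP[zM zD] zG] := zM'.
  pose N := pencil_in D z :\: [set f in pencil_in D z | line_in M f].
  have cN : s.+1 - d <= #|N|.
    rewrite cardsD (setIidPr _) ?degD ?leq_sub2l //.
    by apply/subsetP => f; rewrite inE => /andP[].
  have NP g : g \in N -> [/\ inc z g, line_in D g & ~~ line_in M g].
    by rewrite 3!inE => /andP[+ /andP[zg gD]]; rewrite zg gD.
  set W := [set x in _ | _]; have := double_count N W (fun g x => inc x g).
  have : \sum_(x in W) #|[set g in N | inc x g]| <= #|W|.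
    rewrite -[leqRHS]sum1_card; apply: leq_sum => x; rewrite inE => /andP[/setDP[_ xM] _].
    apply/card_le1_eqP => h g /setIdP[/NP[zh _ _] xh] /setIdP[/NP[zg _ _] xg].
    by apply: (gq_two gq (x := x) (y := z)) => //; apply: contraNneq xM => ->.
  have : \sum_(g in N) (s - d) <= \sum_(g in N) #|[set x in W | inc x g]|.
    apply: leq_sum => g /NP[zg gD gM]; apply: leq_trans (card_uncovered_nfull gM) _.
    apply/subset_leq_card/subsetP => x /setDP[xg xM].
    have {}xg : inc x g by rewrite inE in xg.
    apply/setIdP; split=> //; apply/setIdP; split.
      by rewrite in_setD xM (line_inP _ _ gD).
    by rewrite inE; apply/existsP; exists g; rewrite inE xg gD.
  rewrite sum_nat_const => h1 h2 h3; apply: leq_trans (leq_mul cN (leqnn _)) _; lia.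
move=> eqsum; have {up low eqsum} : #|M' j| * ((s.+1 - d) * (s - d)) <= #|D :\: M| * d.
  by apply: leq_trans low _; rewrite eqsum.
move: card_uncovered_D rich arith1; set m := #|M' j|; set u := #|D :\: M|.
set K := (s.+1 - d) * (s - d).
have [v ->] : exists v, s = v.+1 by exists (s - 1); move: s_gt1; lia.
rewrite !subn1 /= => eq_u rich ar le.
have : u <= v * (v.+1 * v.+1 + 1) by lia.
move=> le_u; have : u * d <= v * (v.+1 * v.+1 + 1) * d by rewrite leq_mul2r le_u orbT.
have : v * v * K <= m * K by rewrite leq_mul2r rich orbT.
have : v * (d * (v.+1 * v.+1 + 1)) < v * (K * v).
  by rewrite ltn_mul2l ar andbT; move: ar; case: (v) => //; rewrite muln0.
lia.
Qed.

(** Choose d + 1 full lines of D on z, and let y be the grid point on such a line f. An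
    uncovered point x of D that is collinear neither with z nor with any y sees on each
    f a covered point off the grid, and these d + 1 points are different, which is one too
    many. The points collinear with z or with some y are few, because every y is on three
    full lines of D. *)
Lemma few_uncovered z : z \in M' j -> d < #|[set f in pencil_in D z | line_in M f]| ->
  #|D :\: M| <= s.+1 * (s - 1) + d.+1 * ((s - 2) * s).
Proof.
move=> zM' rich; have /setDP[/setIP[zM zD] zG] := zM'.
set Phi := [set f in pencil_in D z | line_in M f] in rich.
pose Phi0 := [set f in take d.+1 (enum Phi)].
have card0 : #|Phi0| = d.+1.
  rewrite cardsE (card_uniqP _) ?take_uniq ?enum_uniq // size_take -cardE.
  by case: ifP => // /negbT; rewrite -leqNgt; lia.
have PhiP f : f \in Phi0 -> [/\ inc z f, line_in D f & line_in M f].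
  rewrite inE => /mem_take; rewrite mem_enum => /setIdP[].
  by rewrite inE => /andP[].
have star_le y : y \in D :&: M -> #|[set x in D :\: M | x \in star D y]| <=
    \sum_(h in pencil_in D y | ~~ line_in M h) #|pts h :\: M|.
  move=> _; pose N := pencil_in D y :\: [set h | line_in M h].
  have -> : \sum_(h in pencil_in D y | ~~ line_in M h) #|pts h :\: M| = \sum_(h in N) #|pts h :\: M|.
    by apply: eq_bigl => h; rewrite in_setD [h \in [set _ | _]]inE andbC.
  apply: leq_trans (leq_card_bigcup N (fun h => pts h :\: M)).
  apply/subset_leq_card/subsetP => x.
  case/setIdP => /setDP[xD xM]; rewrite inE => /existsP[h /andP[hy xh]].
  apply/bigcupP; exists h; last by rewrite in_setD xM inE.
  rewrite in_setD hy andbT inE; apply: contraNN xM => /line_inP; exact.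
have grid_pt f : f \in Phi0 -> exists2 y, y \in G & inc y f.
  by case/PhiP => _ fD _; exact: meetG jP fD.
have near_z : #|[set x in D :\: M | x \in star D z]| <= s.+1 * (s - 1).
  apply: leq_trans (star_le z _) _; first by rewrite in_setI zD.
  rewrite -(degD zD) -sum_nat_const; apply: (@leq_trans (\sum_(h in pencil_in D z) (s - 1))) => //.
  rewrite [leqRHS](bigID (fun h => ~~ line_in M h)) /=; apply: leq_trans (leq_addr _ _).
  apply: leq_sum => h /andP[]; rewrite inE => /andP[zh hD] _.
  have [y yG yh] := meetG jP hD.
  apply: (@card_uncovered_le 2); apply/card_gt1P; exists z, y; split.
  - by rewrite in_setI zM inE zh.
  - by rewrite in_setI (subsetP grid_covered) // inE yh.
  - by apply: contraNneq zG => ->.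
have near_y y f : y \in G -> f \in Phi0 -> inc y f ->
    #|[set x in D :\: M | x \in star D y]| <= (s - 2) * s.
  move=> yG f0 yf; have yD := subsetP (GH jP) _ yG.
  have yM := subsetP grid_covered _ yG.
  apply: leq_trans (star_le y _) _; first by rewrite in_setI yD.
  (* Three of the s + 1 lines on y are full: f and the two lines of the grid. *)
  have [zf fD fM] := PhiP _ f0.
  have [g gT yg] := in_grid _ yG; have [r yr rT] := ruling yG.
  have other k : k \in T -> exists2 k', k' \in T & k' != k.
    move=> kT; have := cardsD1 k T; rewrite kT card_transversals // add1n => -[eqs].
    have /card_gt0P[k'] : 0 < #|T :\ k| by rewrite -eqs ltnW.
    by rewrite !in_setD1 => /andP[k'k k'T]; exists k'.
  have gG : line_in G g by apply/line_inP => x xg; apply/in_grid; exists g.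
  have rg : r != g.
    have [k kT kg] := other g gT; apply: contraNneq kg => eq_rg.
    have /meets_pointP[w wr wk] := rT k kT; rewrite eq_rg in wr.
    by rewrite (transversal_disjoint l12 kT gT wk wr).
  have rG : line_in G r.
    have [k kT kg] := other g gT; have /meets_pointP[w wr wk] := rT k kT.
    apply: (Gsub (x := y) (y := w)) => //; last by apply/in_grid; exists k.
    apply: contraNneq kg => eq_yw; rewrite -eq_yw in wk.
    by rewrite (transversal_disjoint l12 kT gT wk yg).
  have GD : forall h, line_in G h -> line_in D h /\ line_in M h.
    by move=> h hG; split; apply: (subset_trans hG); [exact: GH | exact: grid_covered].
  have fG : ~~ line_in G f by apply: contraNN zG => /line_inP; apply.
  have fr : f != r by apply: contraNneq fG => ->.
  have fg : f != g by apply: contraNneq fG => ->.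
  apply: (@leq_trans (\sum_(h in pencil_in D y | ~~ line_in M h) s)).
    apply: leq_sum => h /andP[]; rewrite inE => /andP[yh _] _.
    rewrite -[leqRHS]/(s.+1.-1) -subn1; apply: (@card_uncovered_le 1).
    by apply/card_gt0P; exists y; rewrite in_setI yM inE yh.
  rewrite sum_nat_const leq_mul2r; apply/orP; right.
  have : #|[set f; g; r]| = 3.
    by rewrite setUC cardsU1 cards2 !inE negb_or fg eq_sym fr rg.
  have : #|[set f; g; r] :|: [set h in pencil_in D y | ~~ line_in M h]| <= s.+1.
    rewrite -(degD yD); apply/subset_leq_card/subsetP => h; rewrite !inE.
    case/orP => [/orP[/orP[]|]/eqP->|/andP[-> //]].
    + by rewrite yf.
    + by rewrite yg (GD _ gG).1.
    + by rewrite yr (GD _ rG).1.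
  rewrite cardsU disjoint_setI0 ?cards0 ?subn0; last first.
    rewrite disjoint_subset; apply/subsetP => h; rewrite !inE.
    by case/orP => [/orP[]|]/eqP->; rewrite ?fM ?(GD _ gG).2 ?(GD _ rG).2 ?andbF.
  by move=> le_s eq3; move: le_s; rewrite eq3 cardsE leq_subRL.
pose near f := [set x in D :\: M | [exists y in G, inc y f && (x \in star D y)]].
have card_near_f f : f \in Phi0 -> #|near f| <= (s - 2) * s.
  move=> f0; have [y yG yf] := grid_pt f f0; apply: leq_trans (near_y y f yG f0 yf).
  apply/subset_leq_card/subsetP => x /setIdP[xDM /existsP[w /and3P[wG wf xw]]].
  apply/setIdP; split=> //; suff -> : y = w by [].
  apply/eqP; apply: contraNT zG => yw; have [zf _ _] := PhiP _ f0.
  by have /line_inP := Gsub yw yG wG yf wf; apply.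
apply: (@leq_trans #|[set x in D :\: M | x \in star D z] :|: \bigcup_(f in Phi0) near f|).
  apply/subset_leq_card/subsetP => x xDM; have /setDP[xD xM] := xDM.
  rewrite in_setU; apply: contraT; rewrite negb_or => /andP[xz xnear].
  suff: #|Phi0| <= #|M' j :&: star D x|.
    by move=> le; have := leq_trans le (card_star_off_grid xD xM); rewrite card0 ltnn.
  have starC w : w \in star D x -> x \in star D w.
    rewrite !inE => /existsP[g /andP[]]; rewrite inE => /andP[xg gD] wg.
    by apply/existsP; exists g; rewrite inE wg xg gD.
  have xz' w : w \in star D x -> w != z.
    by move=> wx; apply: contraNneq xz => <-; apply/setIdP; split=> //; apply: starC.
  apply: (leq_card_hit (inc := inc)) => [f f0|f g w f0 g0 /setIP[_ wx] wf wg]; last first.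
    have [[zf _ _] [zg _ _]] := (PhiP _ f0, PhiP _ g0).
    exact: (gq_two gq (xz' w wx)).
  have [zf fD fM] := PhiP _ f0.
  have [|w wx wf] := star_hits Dsub xD fD; first by apply: contraNN xM => /(line_inP _ _ fM).
  exists w => //; rewrite in_setI wx andbT in_setD in_setI (line_inP _ _ fM) // (line_inP _ _ fD) //.
  rewrite !andbT; apply: contraNN xnear => wG; apply/bigcupP; exists f => //.
  apply/setIdP; split=> //; apply/existsP; exists w; rewrite wG wf /=; exact: starC.
apply: leq_trans (leq_card_setU _ _).1 _; apply: leq_add => //.
apply: leq_trans (leq_card_bigcup _ _) _; rewrite -card0 -sum_nat_const.
exact: leq_sum.
Qed.

(** If D contained at most s + 1 + d lines of L then these, and the single points covered by
    the other lines of L, could not account for all the covered points of D. *)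
Lemma hyperplane_covered z : d * (s * s - s + 1) <= s * (s - 1) * (s - 2) ->
  z \in M' j -> d < #|[set f in pencil_in D z | line_in M f]| ->
  D \subset M.
Proof.
move=> arith2 zM' rich; have Dgt0 : 0 < #|D| by apply: leq_trans (subset_leq_card (GH jP)); rewrite card_grid.
apply: (all_covered_of_many Dsub degD tE Dgt0).
rewrite ltnNge; apply/negP => few.
have := few_uncovered zM' rich; have := card_hyperplane Dsub degD tE Dgt0.
have := sum_through_hyperplane Dsub; have := card_LD D; have := cardsID M D.
have : #|D :&: M| <= \sum_(x in D) #|through x|.
  rewrite (big_setID M) /= -sum1_card; apply: leq_trans (leq_addr _ _).
  apply: leq_sum => x /setIP[_ /coveredP[l lL xl]]; apply/card_gt0P; exists l.
  by rewrite inE lL.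
move: few; rewrite tE.
set k := #|L :\: _|; set n := #|[set _ in _ | _]|; set a := #|D :&: M|; set u := #|D :\: M|.
move=> few le_a card_a eqL le_sum cardD le_u.
have : s * n <= s * (s.+1 + d) by rewrite leq_mul2l few orbT.
move: arith2 le_u eqL le_sum cardD; have [v ->] : exists v, s = v + 2 by exists (s - 2); move: s_gt1; lia.
have -> : v + 2 - 1 = v.+1 by lia.
have -> : v + 2 - 2 = v by lia.
have -> : (v + 2) * (v + 2) - (v + 2) = v * v + 3 * v + 2 by lia.
lia.
Qed.

End InHyperplane.

Lemma exists_inner_cover : 0 < #|X| ->
  d * (s * s + 1) < (s.+1 - d) * (s - d) * (s - 1) ->
  d * (s * s - s + 1) <= s * (s - 1) * (s - 2) -> exists2 j, j \in P &
  forall x, x \in H j -> exists l, [/\ l \in L, line_in (H j) l & inc x l].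
Proof.
move=> X_gt0 arith1 arith2; have [j jP rich] := exists_rich_hyperplane X_gt0.
have [z zM' zrich] := exists_rich_point jP arith1 rich.
exists j => // x xD.
have Dgt0 : 0 < #|H j| by apply/card_gt0P; exists x.
apply: (inner_cover (subH jP) (fun y yD => degH jP yD) tE Dgt0 _ d_lt_s xD).
exact: hyperplane_covered arith2 zM' zrich.
Qed.

End Grid.

End Blocking.

End Quadrangle.

Import Order.TTheory GRing.Theory Num.Theory.
Local Open Scope ring_scope.

(** * Subspaces and quadrangles of isotropic points and lines *)

Lemma degree_arith s k t d : (0 < s)%N -> (3 < d)%N ->
  (k * s ^ (d - 2) = s * t * s)%N -> t = (k * s ^ (d - 4))%N.
Proof.
move=> s_gt0 d_gt3; have -> : (d - 2 = (d - 4).+2)%N by lia.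
rewrite !expnS => eqn; apply/eqP; rewrite -(eqn_pmul2l (m := s * s)) ?muln_gt0 ?s_gt0 //.
by apply/eqP; lia.
Qed.

Section Subspaces.
Variables (F : finFieldType) (n : nat).
Implicit Types (u v w : 'rV[F]_n) (U l P : {vspace 'rV[F]_n}).

Lemma card_rV_vspace U : #|[set v | v \in U]| = (#|F| ^ \dim U)%N.
Proof. by rewrite cardsE (card_vspace U). Qed.

Lemma pointE P : is_point P -> P = <[vpick P]>%VS.
Proof.
move=> /eqP dimP; apply/eqP; rewrite eq_sym eqEdim -memvE memv_pick dimP dim_vline.
by rewrite vpick0 -dimv_eq0 dimP.
Qed.

Lemma pick_neq0 P : is_point P -> vpick P != 0.
Proof. by move=> /eqP dimP; rewrite vpick0 -dimv_eq0 dimP. Qed.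

Lemma is_point_line v : v != 0 -> is_point <[v]>%VS.
Proof. by move=> v0; rewrite /is_point dim_vline v0. Qed.

Lemma line_scale (c : F) v : c != 0 -> <[c *: v]>%VS = <[v]>%VS.
Proof.
move=> c0; have [->|v0] := eqVneq v 0; first by rewrite scaler0.
apply/eqP; rewrite eqEdim -memvE memvZ ?memv_line //= !dim_vline scaler_eq0.
by rewrite (negbTE c0) v0.
Qed.

Lemma line_eq u v : u != 0 -> u \in <[v]>%VS -> <[u]>%VS = <[v]>%VS.
Proof.
move=> u0 /vlineP[c uE]; rewrite uE line_scale //.
by apply: contraNneq u0 => c0; rewrite uE c0 scale0r.
Qed.

Lemma dim_add_line U v : v \notin U -> \dim (U + <[v]>) = (\dim U).+1.
Proof.
move=> vU; have := dimv_sum_cap U <[v]>%VS.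
have v0 : v != 0 by apply: contraNneq vU => ->; apply: mem0v.
have /eqP-> : (\dim (U :&: <[v]>) == 0)%N.
  rewrite dimv_eq0 -subv0; apply/subvP => w /memv_capP[wU wv]; rewrite memv0.
  apply: contraNT vU => w0; rewrite memvE -(line_eq w0 wv) -memvE //.
by rewrite dim_vline v0 addn0 addn1.
Qed.

Lemma dim_span2 u v : u != 0 -> v \notin <[u]>%VS -> \dim (<[u]> + <[v]>) = 2.
Proof. by move=> u0 vu; rewrite dim_add_line // dim_vline u0. Qed.

Lemma mem_span2 u v w : w \in (<[u]> + <[v]>)%VS -> exists a b, w = a *: u + b *: v.
Proof. by case/memv_addP => _ /vlineP[a ->] [_ /vlineP[b ->] ->]; exists a, b. Qed.

Lemma span2_sub u v U : u \in U -> v \in U -> (<[u]> + <[v]> <= U)%VS.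
Proof. by move=> uU vU; rewrite subv_add -!memvE uU. Qed.

Lemma line_span2 l u v : \dim l = 2 -> u \in l -> v \in l -> u != 0 ->
  v \notin <[u]>%VS -> l = (<[u]> + <[v]>)%VS.
Proof.
move=> diml ul vl u0 vu; apply/eqP; rewrite eq_sym eqEdim span2_sub //=.
by rewrite dim_span2 // diml.
Qed.

Lemma line_basis l u : \dim l = 2 -> u \in l -> u != 0 ->
  exists2 v, v \notin <[u]>%VS & l = (<[u]> + <[v]>)%VS.
Proof.
move=> diml ul u0; have : ~~ (l <= <[u]>)%VS.
  by apply/negP => /dimvS; rewrite diml dim_vline u0.
by case/subvPn => v vl vu; exists v => //; apply: line_span2.
Qed.

Lemma dim2_neq0 l : \dim l = 2 -> exists2 u, u \in l & u != 0.
Proof.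
move=> diml; exists (vpick l); first exact: memv_pick.
by rewrite vpick0 -dimv_eq0 diml.
Qed.

End Subspaces.

(** Z is the set of isotropic vectors of a quadratic or hermitian form and b its polar form,
    bilinear or sesquilinear. The constant k is 1 for a quadratic form and q for a hermitian
    form over the field of order q^2. *)
Record quadrangle_form (F : finFieldType) (n : nat) (Z : pred 'rV[F]_n)
    (b : 'rV[F]_n -> 'rV[F]_n -> F) (k : nat) : Prop := QuadrangleForm {
  qfZ : forall c v, Z v -> Z (c *: v);
  qf_lin : forall v, scalar (b^~ v);
  qf_sym : forall u v, b u v = 0 -> b v u = 0;
  qf_add : forall u v, Z u -> Z v -> b u v = 0 -> Z (u + v);
  qf_perp : forall u v, Z u -> Z v -> (forall c, Z (u + c *: v)) -> b u v = 0;
  qf_count : forall e w, Z e -> b w e != 0 -> #|[set c | Z (w + c *: e)]| = k;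
  qf_rank : forall U, contained_in Z U -> (\dim U <= 2)%N }.

Section QuadrangleForm.
Variables (F : finFieldType) (n : nat) (Z : pred 'rV[F]_n).
Variables (b : 'rV[F]_n -> 'rV[F]_n -> F) (k : nat).
Hypothesis qf : quadrangle_form Z b k.
Implicit Types (u v w e : 'rV[F]_n) (U l m P : {vspace 'rV[F]_n}).

Lemma form_lin c u w v : b (c *: u + w) v = c * b u v + b w v.
Proof. exact: (qf_lin qf). Qed.

Lemma form0l v : b 0 v = 0.
Proof. by have := form_lin 1 0 0 v; rewrite scaler0 addr0 mul1r -{1}[b 0 v]addr0 => /addrI. Qed.

Lemma formZl c u v : b (c *: u) v = c * b u v.
Proof. by rewrite -[c *: u]addr0 form_lin form0l addr0. Qed.

Lemma formDl u w v : b (u + w) v = b u v + b w v.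
Proof. by rewrite -[u]scale1r form_lin mul1r scale1r. Qed.

Lemma formBl u w v : b (u - w) v = b u v - b w v.
Proof. by rewrite formDl -scaleN1r formZl mulN1r. Qed.

Lemma form_sym0 u v : (b u v == 0) = (b v u == 0).
Proof. by apply/eqP/eqP; apply: (qf_sym qf). Qed.

Lemma formZr0 c u v : b u v = 0 -> b u (c *: v) = 0.
Proof. by move=> /eqP; rewrite form_sym0 => /eqP buv; apply/eqP; rewrite form_sym0 formZl buv mulr0. Qed.

Lemma Z_span u v c d : Z u -> Z v -> b u v = 0 -> Z (c *: u + d *: v).
Proof.
move=> Zu Zv buv; apply: (qf_add qf); try exact: (qfZ qf).
by rewrite formZl (formZr0 _ buv) mulr0.
Qed.

Lemma containedP U : reflect (forall v, v \in U -> Z v) (contained_in Z U).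
Proof. by apply: (iffP forallP) => h v; [move=> vU; have := h v; rewrite vU | apply/implyP/h]. Qed.

Lemma contained_perp U u v : contained_in Z U -> u \in U -> v \in U -> b u v = 0.
Proof.
move=> /containedP ZU uU vU; apply: (qf_perp qf) => [||c]; apply: ZU => //.
by rewrite memvD ?memvZ.
Qed.

Lemma contained_add_line U e : contained_in Z U -> Z e ->
  (forall u, u \in U -> b u e = 0) -> contained_in Z (U + <[e]>).
Proof.
move=> /containedP ZU Ze Ue; apply/containedP => _ /memv_addP[u uU [_ /vlineP[c ->] ->]].
by apply: (qf_add qf); [exact: ZU | exact: (qfZ qf) | exact/formZr0/Ue].
Qed.

Lemma contained_span2 u v : Z u -> Z v -> b u v = 0 -> contained_in Z (<[u]> + <[v]>).
Proof. by move=> Zu Zv buv; apply/containedP => w /mem_span2[c [d ->]]; apply: Z_span. Qed.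

Lemma contained_line v : Z v -> contained_in Z <[v]>.
Proof. by move=> Zv; apply/containedP => w /vlineP[c ->]; apply: (qfZ qf). Qed.

Lemma contained_sub U l : contained_in Z U -> (l <= U)%VS -> contained_in Z l.
Proof. by move=> /containedP ZU /subvP lU; apply/containedP => v /lU/ZU. Qed.

Lemma lineP l : reflect (\dim l = 2 /\ contained_in Z l) (l \in lines_of Z).
Proof. by rewrite inE; apply: (iffP andP) => -[/eqP ? ?]; split=> //; apply/eqP. Qed.

(** Otherwise l and e would span a singular plane. *)
Lemma not_perp_line l e : l \in lines_of Z -> Z e -> e \notin l ->
  exists2 u, u \in l & b u e != 0.
Proof.
move=> /lineP[diml Zl] Ze el.
have [/existsP[u /andP[ul ue]]|/existsPn perp] := boolP [exists u, (u \in l) && (b u e != 0)].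
  by exists u.
suff /(qf_rank qf) : contained_in Z (l + <[e]>) by rewrite dim_add_line // diml.
apply: contained_add_line => // u ul.
by have := perp u; rewrite ul negbK => /eqP.
Qed.

Lemma perp_on_line l e : \dim l = 2 -> exists2 u, u \in l & (u != 0) && (b u e == 0).
Proof.
move=> diml; have [a al a0] := dim2_neq0 diml.
have [c ca lE] := line_basis diml al a0.
have cl : c \in l by rewrite lE (subvP (addvSr _ _)) ?memv_line.
have [ae|ae] := eqVneq (b a e) 0; first by exists a; rewrite // a0 ae eqxx.
exists (c - (b c e / b a e) *: a); first by rewrite memvB ?memvZ.
rewrite formBl formZl mulfVK // subrr eqxx andbT subr_eq0.
by apply: contraNneq ca => ->; rewrite memvZ ?memv_line.
Qed.

Lemma perp_on_line_uniq l e u w : l \in lines_of Z -> Z e -> e \notin l ->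
  u \in l -> u != 0 -> b u e = 0 -> w \in l -> b w e = 0 -> w \in <[u]>%VS.
Proof.
move=> lZ Ze el ul u0 ue wl we; have [diml _] := lineP _ lZ.
apply: contraT => wu; have [x xl] := not_perp_line lZ Ze el.
move: xl; rewrite (line_span2 diml ul wl u0 wu) => /mem_span2[c [d ->]].
by rewrite form_lin formZl ue we !mulr0 addr0 eqxx.
Qed.

Definition qpoint := {P : {vspace 'rV[F]_n} | is_point P && contained_in Z P}.
Definition qline := {l : {vspace 'rV[F]_n} | l \in lines_of Z}.
Definition qinc (x : qpoint) (l : qline) := (val x <= val l)%VS.


Implicit Types (x y z : qpoint) (g h : qline).

Lemma qpointP v : Z v -> v != 0 -> is_point <[v]> && contained_in Z <[v]>.
Proof. by move=> Zv v0; rewrite is_point_line // contained_line. Qed.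

Definition mkpoint v (Zv : Z v) (v0 : v != 0) : qpoint := exist _ <[v]>%VS (qpointP Zv v0).

Definition mkline l (lZ : l \in lines_of Z) : qline := exist (fun l => l \in lines_of Z) l lZ.

Definition rep x := vpick (val x).

Lemma val_rep x : val x = <[rep x]>%VS.
Proof. by have /andP[/pointE] := valP x. Qed.

Lemma rep_neq0 x : rep x != 0.
Proof. by have /andP[/pick_neq0] := valP x. Qed.

Lemma Z_rep x : Z (rep x).
Proof. by have /andP[_ /containedP] := valP x; apply; apply: memv_pick. Qed.

Lemma qincE x g : qinc x g = (rep x \in val g).
Proof. by rewrite /qinc val_rep memvE. Qed.

Lemma qpoint_eq x y : rep x \in <[rep y]>%VS -> x = y.
Proof. by move=> xy; apply/val_inj; rewrite val_rep (line_eq (rep_neq0 x) xy) -val_rep. Qed.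

Lemma qlineP g : \dim (val g) = 2 /\ contained_in Z (val g).
Proof. by case: g => l /= /lineP. Qed.

Lemma qline_span x y g : x != y -> qinc x g -> qinc y g ->
  val g = (<[rep x]> + <[rep y]>)%VS.
Proof.
rewrite !qincE => xy xg yg; apply: line_span2 (qlineP g).1 xg yg (rep_neq0 x) _.
by apply: contraNN xy => /qpoint_eq->.
Qed.

Lemma join_line u v : Z u -> Z v -> b u v = 0 -> u != 0 -> v \notin <[u]>%VS ->
  exists g : qline, val g = (<[u]> + <[v]>)%VS.
Proof.
move=> Zu Zv buv u0 vu.
have gP : (<[u]> + <[v]>)%VS \in lines_of Z.
  by apply/lineP; rewrite dim_span2 // contained_span2.
by exists (mkline gP).
Qed.

Lemma form_self v : Z v -> b v v = 0.
Proof. by move=> Zv; apply: (qf_perp qf) => // c; rewrite -[v in v + _]scale1r -scalerDl (qfZ qf). Qed.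

Lemma qincP x y g : val g = (<[rep x]> + <[rep y]>)%VS -> qinc x g /\ qinc y g.
Proof.
move=> gE; rewrite !qincE gE !memvE addvSl; split=> //; exact: addvSr.
Qed.

Lemma collE x y : x != y -> coll qinc x y = (b (rep x) (rep y) == 0).
Proof.
move=> nxy; apply/collP/eqP => [[g]|xy].
  by rewrite !qincE => xg yg; apply: contained_perp xg yg; have [] := qlineP g.
have [|g /qincP[xg yg]] := join_line (Z_rep x) (Z_rep y) xy (rep_neq0 x).
  by apply: contraNN nxy => /qpoint_eq->.
by exists g.
Qed.

Lemma line_of_mem x v : v \in val x -> v != 0 -> <[v]>%VS = val x.
Proof. by rewrite val_rep => vx v0; rewrite (line_eq v0 vx). Qed.

(** Points are counted through the vectors that represent them. *)
Lemma card_cone (S : {set 'rV[F]_n}) : (forall v, v \in S -> Z v /\ v != 0) ->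
  (forall c v, c != 0 -> v \in S -> c *: v \in S) ->
  #|S| = (#|[set x : qpoint | rep x \in S]| * #|F|.-1)%N.
Proof.
move=> SP Sscale.
have := double_count [set x : qpoint | rep x \in S] S (fun x v => v \in val x).
rewrite (eq_bigr (fun=> #|F|.-1)) => [|x]; last first.
  rewrite inE => xS.
  have -> : [set v in S | v \in val x] = [set v | v \in val x] :\ 0.
    apply/setP => v; rewrite !inE val_rep.
    have [/vlineP[c ->]|] := boolP (v \in <[rep x]>%VS); last by rewrite !andbF.
    rewrite !andbT scaler_eq0 (negbTE (rep_neq0 x)) orbF.
    have [->|c0] := eqVneq c 0; last by rewrite Sscale.
    by apply/negP => /SP[_]; rewrite scale0r eqxx.
  have := cardsD1 0 [set v | v \in val x]; rewrite card_rV_vspace inE mem0v.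
  by have /andP[/eqP-> _] := valP x; rewrite expn1 => ->.
rewrite sum_nat_const [in RHS](eq_bigr (fun=> 1%N)) => [|v vS]; last first.
  have [Zv v0] := SP v vS; apply: (@card_unique _ _ (mkpoint Zv v0)).
    have /vlineP[c pE] : rep (mkpoint Zv v0) \in <[v]>%VS by apply: memv_pick.
    rewrite !inE memv_line andbT pE Sscale //.
    by apply: contraNneq (rep_neq0 (mkpoint Zv v0)) => c0; rewrite pE c0 scale0r.
  by move=> y; rewrite !inE => /andP[_ vy]; apply/val_inj; rewrite /= (line_of_mem vy).
by rewrite sum1_card => ->.
Qed.


Lemma card_finField_gt1 : (1 < #|F|)%N.
Proof. exact: finNzRing_gt1. Qed.

Lemma rep_mkpoint v (Zv : Z v) (v0 : v != 0) : rep (mkpoint Zv v0) \in <[v]>%VS.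
Proof. exact: memv_pick. Qed.

(** For an isotropic point <e> off a line l the functional b(., e) vanishes on exactly one
    point of l: otherwise <e> and l would span an isotropic plane. *)
Lemma quadrangle_qinc : quadrangle qinc #|F|.
Proof.
split=> [g|x y g h xy xg yg xh yh|x g xg|x l m m' y y' xl xm ym yl xm' y'm' y'l].
- have [dimg /containedP Zg] := qlineP g; pose S := [set v | v \in val g] :\ 0.
  have SP v : v \in S -> Z v /\ v != 0 by rewrite !inE => /andP[v0 /Zg].
  have Sscale c v : c != 0 -> v \in S -> c *: v \in S.
    by rewrite !inE scaler_eq0 negb_or => c0 /andP[v0 vg]; rewrite c0 v0 memvZ.
  have := cardsD1 0 [set v | v \in val g]; rewrite card_rV_vspace inE mem0v dimg -/S.
  rewrite (card_cone SP Sscale).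
  have -> : [set x | rep x \in S] = [set x | qinc x g].
    by apply/setP => x; rewrite !inE rep_neq0 qincE.
  by have := card_finField_gt1; set c := #|_|; case: #|F| => // -[//|q] _ /=; rewrite -mulnn; nia.
- apply/val_inj; rewrite (qline_span xy xg yg).
  by rewrite (qline_span xy xh yh).
- have [u ug /andP[u0 /eqP bu]] := perp_on_line (rep x) (qlineP g).1.
  have [_ /containedP Zg] := qlineP g; rewrite qincE in xg.
  pose y := mkpoint (Zg u ug) u0; have yu := rep_mkpoint (Zg u ug) u0.
  have yg : qinc y g by rewrite /qinc /= -memvE.
  have bxy : b (rep x) (rep y) = 0.
    by have /vlineP[c ->] := yu; apply/formZr0/eqP; rewrite form_sym0 bu.
  have [|m /qincP[xm ym]] := join_line (Z_rep x) (Z_rep y) bxy (rep_neq0 x).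
    apply: contraNN xg => /qpoint_eq eq_yx; by rewrite -qincE -eq_yx.
  by exists m => //; exists y.
have perp z h : qinc x h -> qinc z h -> b (rep z) (rep x) = 0.
  by rewrite !qincE => xh zh; apply: contained_perp zh xh; have [] := qlineP h.
rewrite qincE in xl; have yP := yl; have y'P := y'l; rewrite !qincE in yP y'P.
have := perp_on_line_uniq (valP l) (Z_rep x) xl yP (rep_neq0 y) (perp y m xm ym) y'P
  (perp y' m' xm' y'm').
move=> /qpoint_eq eq_y; rewrite eq_y in y'm'.
have xy : x != y by apply: contraNneq xl => ->.
apply/val_inj; rewrite (qline_span xy xm ym); by rewrite (qline_span xy xm' y'm').
Qed.

Definition points_in U : {set qpoint} := [set x : qpoint | (val x <= U)%VS].

Lemma mem_points_in U x : (x \in points_in U) = (rep x \in U).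
Proof. by rewrite inE val_rep -memvE. Qed.

Lemma line_inE U g : line_in qinc (points_in U) g = (val g <= U)%VS.
Proof.
apply/line_inP/subvP => [gU v vg|gU x xg]; last by rewrite mem_points_in gU // -qincE.
have [->|v0] := eqVneq v 0; first exact: mem0v.
have Zv : Z v by have [_ /containedP] := qlineP g; apply.
have := gU (mkpoint Zv v0); rewrite inE -memvE; apply.
by rewrite /qinc /= -memvE.
Qed.

Lemma subspace_points_in U : subspace qinc (points_in U).
Proof.
move=> x y g xy; rewrite !mem_points_in line_inE => xU yU xg yg.
by rewrite (qline_span xy xg yg) span2_sub.
Qed.

(** All level sets of the functional b(., e) on U have the same size. *)
Lemma card_not_perp U e u0 : u0 \in U -> b u0 e != 0 ->
  (#|[set v | (v \in U) && (b v e != 0)%R]| * #|F| = #|F| ^ \dim U * #|F|.-1)%N.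
Proof.
move=> u0U bu0; set N := #|[set v | (v \in U) && (b v e == 0)]|.
have level c : #|[set v | (v \in U) && (b v e == c)]| = N.
  pose w := (c / b u0 e) *: u0; have wU : w \in U by apply: memvZ.
  have bw : b w e = c by rewrite formZl divfK.
  rewrite -(card_imset _ (addIr (- w))); apply: eq_card => v; rewrite inE.
  apply/imsetP/andP => [[z]|[vU /eqP bv]].
    by rewrite inE => /andP[zU /eqP bz] ->; rewrite memvB // formBl bz bw subrr.
  by exists (v + w); rewrite ?addrK // inE memvD // formDl bv bw add0r eqxx.
have total : (#|F| ^ \dim U = #|F| * N)%N.
  rewrite -card_rV_vspace -sum_nat_const.
  have := double_count [set v | v \in U] setT (fun v c => b v e == c).
  rewrite (eq_bigr (fun=> 1%N)) => [|v _]; last first.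
    by apply: (@card_unique _ _ (b v e)) => [|c]; rewrite !inE ?eqxx // => /eqP.
  rewrite sum1_card => ->; apply: eq_big => c; first by rewrite inE.
  by move=> _; rewrite -(level c); apply: eq_card => v; rewrite !inE.
have -> : #|[set v | (v \in U) && (b v e != 0)]| = (#|F| ^ \dim U - N)%N.
  rewrite -card_rV_vspace -(cardsID [set v | b v e == 0] [set v | v \in U]).
  have -> : [set v | v \in U] :&: [set v | b v e == 0] = [set v | (v \in U) && (b v e == 0)].
    by apply/setP => v; rewrite !inE.
  by rewrite -/N addKn; apply: eq_card => v; rewrite !inE andbC.
rewrite total; have := card_finField_gt1; case: #|F| => // q _ /=.
by rewrite mulSn addKn; lia.
Qed.

(** The vectors of U that are not perpendicular to e are partitioned into cosets of <e>,
    and each coset has k isotropic vectors. *)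
Lemma card_isotropic_not_perp U e u0 : Z e -> e \in U -> u0 \in U -> b u0 e != 0 ->
  (1 < \dim U)%N ->
  #|[set v | [&& v \in U, Z v & b v e != 0]]| = (k * #|F| ^ (\dim U - 2) * #|F|.-1)%N.
Proof.
move=> Ze eU u0U bu0 dimU.
set S := [set v | _]; pose W := [set v | (v \in U) && (b v e != 0)].
have cW := card_not_perp u0U bu0; rewrite -/W in cW.
have shift c v : b (v + c *: e) e = b v e by rewrite formDl formZl (form_self Ze) mulr0 addr0.
have := double_count W setT (fun w c => Z (w + c *: e)).
rewrite (eq_bigr (fun=> k)) => [|w]; last first.
  rewrite inE => /andP[_ bw]; rewrite -[RHS](qf_count qf Ze bw).
  by apply: eq_card => c; rewrite !inE.
rewrite [in RHS](eq_bigr (fun=> #|S|)) => [|c _]; last first.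
  rewrite -[RHS](card_imset _ (addIr (- (c *: e)))); apply: eq_card => w.
  rewrite !inE; apply/andP/imsetP => [[/andP[wU bw] Zw]|[v]].
    by exists (w + c *: e); rewrite ?addrK // inE memvD ?memvZ // Zw shift.
  rewrite inE => /and3P[vU Zv bv] ->.
  by rewrite memvB ?memvZ // subrK -scaleNr shift bv.
rewrite !sum_nat_const cardsT => eq1.
have q_gt0 : (0 < #|F|)%N by have := card_finField_gt1; lia.
apply/eqP; rewrite -(eqn_pmul2l q_gt0) -eq1 -(eqn_pmul2r q_gt0) mulnAC cW.
have -> : (\dim U = 2 + (\dim U - 2))%N by lia.
by rewrite addKn !expnS; apply/eqP; lia.
Qed.

Lemma card_noncoll_points_in U x u0 g : rep x \in U -> u0 \in U -> b u0 (rep x) != 0 ->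
  qinc x g -> (1 < \dim U)%N ->
  #|[set y in points_in U | ~~ coll qinc x y]| = (k * #|F| ^ (\dim U - 2))%N.
Proof.
move=> xU u0U bu0 xg dimU.
set S := [set v | [&& v \in U, Z v & b v (rep x) != 0]].
have SP v : v \in S -> Z v /\ v != 0.
  by rewrite inE => /and3P[_ Zv bv]; split=> //; apply: contraNneq bv => ->; rewrite form0l.
have Sscale c v : c != 0 -> v \in S -> c *: v \in S.
  move=> c0; rewrite !inE => /and3P[vU Zv bv].
  by rewrite memvZ // (qfZ qf) // formZl mulf_neq0.
have := card_cone SP Sscale; rewrite (card_isotropic_not_perp (Z_rep x) xU u0U bu0 dimU).
move/eqP; rewrite eqn_pmul2r => [/eqP->|]; last by have := card_finField_gt1; lia.
apply: eq_card => y; rewrite !inE val_rep -memvE Z_rep /=; congr (_ && ~~ _).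
have [<-|xy] := eqVneq x y; last by rewrite (collE xy) form_sym0.
by rewrite form_self ?Z_rep // eqxx; apply/collP; exists g.
Qed.

(** The number of lines on a point is read off from the number of points that are not
    collinear with it. *)
Lemma card_pencil_points_in U g1 g2 x :
  (val g1 <= U)%VS -> (val g2 <= U)%VS -> ~~ meets qinc g1 g2 ->
  (3 < \dim U)%N -> x \in points_in U ->
  #|pencil_in qinc (points_in U) x| = (k * #|F| ^ (\dim U - 4)).+1.
Proof.
move=> g1U g2U g12 dimU xU; have gq := quadrangle_qinc; have q_gt1 := card_finField_gt1.
have sub1 : line_in qinc (points_in U) g1 by rewrite line_inE.
have sub2 : line_in qinc (points_in U) g2 by rewrite line_inE.
have degE y : y \in points_in U -> #|pencil_in qinc (points_in U) y| = #|pencil_in qinc (points_in U) x|.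
  by move=> yU; apply: (deg_const gq q_gt1 (@subspace_points_in U) sub1 sub2 g12).
have [g xg gU] : exists2 g, qinc x g & line_in qinc (points_in U) g.
  have [xg1|xg1] := boolP (qinc x g1); first by exists g1.
  have [m xm [y ym yg1]] := gq_proj gq xg1; exists m => //.
  exact: (join_in (@subspace_points_in U) xU sub1 xg1 xm ym yg1).
have [t' degx] : exists t', #|pencil_in qinc (points_in U) x| = t'.+1.
  have : (0 < #|pencil_in qinc (points_in U) x|)%N by apply/card_gt0P; exists g; rewrite inE xg gU.
  by case: #|_| => // t' _; exists t'.
have [u0 u0U bu0] : exists2 u0, u0 \in U & b u0 (rep x) != 0.
  have [xg1|xg1] := boolP (qinc x g1); last first.
    have [|u ug bu] := not_perp_line (valP g1) (Z_rep x); first by rewrite -qincE.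
    by exists u => //; apply: (subvP g1U).
  have [|u ug bu] := not_perp_line (valP g2) (Z_rep x).
    by rewrite -qincE; apply: skew_offP g12 xg1.
  by exists u => //; apply: (subvP g2U).
rewrite degx; congr _.+1.
have xU' : rep x \in U by rewrite -mem_points_in.
have := card_noncoll gq (@subspace_points_in U) (fun y yU => etrans (degE y yU) degx) xU xg gU.
rewrite (card_noncoll_points_in xU' u0U bu0 xg) ?(leq_trans _ dimU) // => eq_t.
by rewrite (degree_arith (ltnW q_gt1) dimU eq_t).
Qed.

Lemma meetsE g h : meets qinc g h = share_point (val g) (val h).
Proof.
apply/idP/idP => [/meets_pointP[x xg xh]|/existsP[P /and3P[Pp Pg Ph]]].
  by apply/existsP; exists (val x); apply/and3P; split=> //; have /andP[] := valP x.
have ZP : contained_in Z P by apply: contained_sub Pg; have [] := qlineP g.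
apply/meets_pointP.
by exists (exist (fun P => is_point P && contained_in Z P) P (introT andP (conj Pp ZP))).
Qed.

Lemma skew_lineP g h u : ~~ meets qinc g h -> u \in val g -> u \in val h -> u = 0.
Proof.
move=> gh ug uh; apply/eqP; apply: contraNT gh => u0; apply/meets_pointP.
have Zu : Z u by have [_ /containedP] := qlineP g; apply.
by exists (mkpoint Zu u0); rewrite /qinc /= -memvE.
Qed.

Lemma skew_capv g h : ~~ meets qinc g h -> (val g :&: val h = 0)%VS.
Proof.
move=> gh; apply/eqP; rewrite -subv0; apply/subvP => u /memv_capP[ug uh].
by rewrite memv0 (skew_lineP gh ug uh).
Qed.

Lemma dim_span_skew g h : ~~ meets qinc g h -> \dim (val g + val h) = 4%N.
Proof.
move=> gh; have := dimv_sum_cap (val g) (val h); rewrite (skew_capv gh) dimv0 addn0 => ->.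
by have [-> _] := qlineP g; have [-> _] := qlineP h.
Qed.

(** A common point would be perpendicular to all of g. *)
Lemma skew_of_perp g h : (forall v, v \in val h -> (forall u, u \in val g -> b v u = 0) -> v = 0) ->
  ~~ meets qinc g h.
Proof.
move=> triv; apply/meets_pointP => -[x]; rewrite !qincE => xg xh.
have /eqP := rep_neq0 x; apply; apply: triv => // u ug.
by apply: contained_perp xg ug; have [] := qlineP g.
Qed.

Hypothesis k_gt0 : (0 < k)%N.

Lemma isotropic_adjust e w : Z e -> b w e != 0 -> exists c, Z (w + c *: e).
Proof.
by move=> Ze bw; have := k_gt0; rewrite -(qf_count qf Ze bw) => /card_gt0P[c]; rewrite inE; exists c.
Qed.

(** A line <f, h> skew to the given line <u, a> is built as a dual pair: f is perpendicular
    to a but not to u, and h is perpendicular to u and f but not to a. Both are made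
    isotropic by adding multiples of u and a. *)
Lemma exists_skew_lines (g : qline) :
  (forall e, Z e -> e != 0 -> exists w, b w e != 0) ->
  exists g1 g2 : qline, ~~ meets qinc g1 g2.
Proof.
move=> nondeg; have [dimg /containedP Zg] := qlineP g.
have [u ug u0] := dim2_neq0 dimg; have Zu := Zg u ug.
have [w bw] := nondeg u Zu u0; have [c Zf] := isotropic_adjust Zu bw.
set f := w + c *: u in Zf.
have bfu : b f u != 0 by rewrite formDl formZl (form_self Zu) mulr0 addr0.
have buf : b u f != 0 by rewrite form_sym0.
have [a ag /andP[a0 /eqP baf]] := perp_on_line f dimg.
have Za := Zg a ag; have bua : b u a = 0 by apply: contained_perp ug ag; have [] := qlineP g.
have bfa : b f a = 0 by apply/eqP; rewrite form_sym0 baf.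
have bau : b a u = 0 by apply/eqP; rewrite form_sym0 bua.
have [w2 bw2] := nondeg a Za a0.
set w' := w2 - (b w2 u / b f u) *: f - (b w2 f / b u f) *: u.
have bw'u : b w' u = 0.
  by rewrite !formBl !formZl divfK // (form_self Zu) mulr0 subr0 subrr.
have bw'f : b w' f = 0.
  by rewrite !formBl !formZl divfK // (form_self Zf) mulr0 subr0 subrr.
have bw'a : b w' a != 0 by rewrite !formBl !formZl bfa bua !mulr0 !subr0.
have [d Zh] := isotropic_adjust Za bw'a; set h := w' + d *: a in Zh.
have bhu : b h u = 0 by rewrite formDl formZl bw'u bau mulr0 addr0.
have bhf : b h f = 0 by rewrite formDl formZl bw'f baf mulr0 addr0.
have bha : b h a != 0 by rewrite formDl formZl (form_self Za) mulr0 addr0.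
have bfh : b f h = 0 by apply/eqP; rewrite form_sym0 bhf.
have f0 : f != 0 by apply: contraNneq bfu => ->; rewrite form0l.
have hf : h \notin <[f]>%VS.
  apply: contraNN bha => /vlineP[r hE]; rewrite hE.
  have /eqP := bhu; rewrite hE formZl mulf_eq0 (negbTE bfu) orbF => /eqP->.
  by rewrite scale0r form0l.
have [g2 g2E] := join_line Zf Zh bfh f0 hf.
exists g, g2; apply: skew_of_perp => v; rewrite g2E => /mem_span2[r [s ->]] perp.
have /eqP := perp u ug; rewrite form_lin formZl bhu mulr0 addr0 mulf_eq0 (negbTE bfu) orbF => /eqP->.
have /eqP := perp a ag; rewrite form_lin formZl bfa mulr0 add0r mulf_eq0 (negbTE bha) orbF => /eqP->.
by rewrite !scale0r addr0.
Qed.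

End QuadrangleForm.

(** * Elliptic quadrics *)

Section QuadricForm.
Variables (F : finFieldType) (n : nat) (A : 'M[F]_n).
Implicit Types (u v w e : 'rV[F]_n) (U l m : {vspace 'rV[F]_n}).

Definition bil v w : F := (v *m A *m w^T) 0 0.

Lemma bilDl u v w : bil (u + v) w = bil u w + bil v w.
Proof. by rewrite /bil !mulmxDl mxE. Qed.

Lemma bilDr u v w : bil u (v + w) = bil u v + bil u w.
Proof. by rewrite /bil linearD mulmxDr mxE. Qed.

Lemma bilZl c v w : bil (c *: v) w = c * bil v w.
Proof. by rewrite /bil -!scalemxAl mxE. Qed.

Lemma bilZr c v w : bil v (c *: w) = c * bil v w.
Proof. by rewrite /bil linearZ /= -scalemxAr mxE. Qed.

Lemma polarE v w : polar_form A v w = bil v w + bil w v.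
Proof. by rewrite /polar_form /qform -!/(bil _ _) bilDl !bilDr; ring. Qed.

Lemma polarC v w : polar_form A v w = polar_form A w v.
Proof. by rewrite !polarE addrC. Qed.

Lemma polarDl u v w : polar_form A (u + v) w = polar_form A u w + polar_form A v w.
Proof. by rewrite !polarE bilDl bilDr; ring. Qed.

Lemma polarZl c v w : polar_form A (c *: v) w = c * polar_form A v w.
Proof. by rewrite !polarE bilZl bilZr; ring. Qed.

Lemma polarDr u v w : polar_form A u (v + w) = polar_form A u v + polar_form A u w.
Proof. by rewrite polarC polarDl !(polarC u). Qed.

Lemma polarZr c v w : polar_form A v (c *: w) = c * polar_form A v w.
Proof. by rewrite polarC polarZl polarC. Qed.

Lemma qformD v w : qform A (v + w) = qform A v + qform A w + polar_form A v w.
Proof. by rewrite /polar_form; ring. Qed.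

Lemma qformZ c v : qform A (c *: v) = c ^+ 2 * qform A v.
Proof. by rewrite /qform -!/(bil _ _) bilZl bilZr; ring. Qed.

Hypothesis witt2 : witt_index A = 2%N.

Lemma quadric_quadrangle_form : quadrangle_form (quadric A) (polar_form A) 1.
Proof.
split=> [c v /eqP Zv|v a u w|u v <-|u v /eqP Zu /eqP Zv buv|u v /eqP Zu /eqP Zv /(_ 1)
  |e w /eqP Ze bwe|U ZU].
- by apply/eqP; rewrite qformZ Zv mulr0.
- by rewrite polarDl polarZl.
- exact: polarC.
- by apply/eqP; rewrite qformD Zu Zv buv !addr0.
- by move=> /eqP; rewrite scale1r qformD Zu Zv !add0r.
- pose c := - (qform A w / polar_form A w e).
  have qE d : qform A (w + d *: e) = qform A w + d * polar_form A w e.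
    by rewrite qformD qformZ Ze mulr0 addr0 polarZr.
  apply: (@card_unique _ _ c) => [|d]; rewrite inE -[quadric A _]/(_ == 0) qE.
    by rewrite /c mulNr divfK // subrr.
  by rewrite addrC addr_eq0 => /eqP dE; rewrite /c -mulNr -dE mulfK.
- by rewrite -witt2 /witt_index; apply: (leq_bigmax_cond (F := fun U => \dim U)) ZU.
Qed.

Lemma exists_quadric_line : exists l, l \in lines_of (quadric A).
Proof.
have [|U ZU maxU] := @eq_bigmax_cond _ (contained_in (quadric A)) (fun U : {vspace 'rV[F]_n} => \dim U).
  apply/card_gt0P; exists 0%VS; apply/forallP => v; apply/implyP; rewrite memv0 => /eqP->.
  by apply/eqP; rewrite /qform !mul0mx mxE.
by exists U; apply/lineP; split=> //; apply: etrans (esym maxU) witt2.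
Qed.


Let qf := quadric_quadrangle_form.
Local Notation inc := (@qinc F n (quadric A)).
Local Notation B := (polar_form A).
Implicit Types (g h : qline (quadric A)) (x y z : qpoint (quadric A)).

(** The lines <a, c> and <a', c'> are paired so that a + a' and c + c' span a line
    of the opposite ruling. *)
Lemma opposite_ruling (l1 l2 : qline (quadric A)) y :
  ~~ meets inc l1 l2 -> rep y \in (val l1 + val l2)%VS ->
  exists2 r, inc y r & forall g, g \in transversals inc l1 l2 -> meets inc r g.
Proof.
move=> l12 /memv_addP[a al1 [a' al2 yE]].
have [d1 /(containedP _ _) Z1] := qlineP l1; have [d2 /(containedP _ _) Z2] := qlineP l2.
have [a0|a0] := eqVneq a 0.
  exists l2; first by rewrite qincE yE a0 add0r.
  by move=> g; rewrite inE (meetsC _ l2 g) => /andP[].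
have [a'0|a'0] := eqVneq a' 0.
  exists l1; first by rewrite qincE yE a'0 addr0.
  by move=> g; rewrite inE (meetsC _ l1 g) => /andP[].
have Baa : B a a' = 0.
  have /eqP := Z_rep y; rewrite yE qformD.
  by rewrite (eqP (Z1 a al1)) (eqP (Z2 a' al2)) !add0r.
have [c ca l1E] := line_basis d1 al1 a0.
have cl1 : c \in val l1 by rewrite l1E (subvP (addvSr _ _)) ?memv_line.
have [c0 c0l2 /andP[c00 /eqP Bc0c]] := perp_on_line qf c d2.
have nl2 u : u \in val l1 -> u != 0 -> u \notin val l2.
  by move=> ul1; apply: contraNN => /(skew_lineP qf l12 ul1)->.
have cn0 : c != 0 by apply: contraNneq ca => ->; apply: mem0v.
have perp1 u v : u \in val l1 -> v \in val l1 -> B u v = 0.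
  by apply: (contained_perp qf); have [] := qlineP l1.
have perp2 u v : u \in val l2 -> v \in val l2 -> B u v = 0.
  by apply: (contained_perp qf); have [] := qlineP l2.
have Bac0 : B a c0 != 0.
  apply/negP => /eqP Bac0; have [|u ul1] := not_perp_line qf (valP l1) (Z2 c0 c0l2).
  - by apply: contraNN c00 => c0l1; rewrite (skew_lineP qf l12 c0l1 c0l2).
  move: ul1; rewrite l1E => /mem_span2[p [r ->]] /negP[].
  by rewrite polarDl !polarZl Bac0 (polarC c) Bc0c !mulr0 addr0.
pose c' := - (B c a' / B a c0) *: c0.
have c'l2 : c' \in val l2 by apply: memvZ.
have Bcc : B c c' = 0 by rewrite polarZr (polarC c c0) Bc0c mulr0.
have Bsum : B a c' + B c a' = 0 by rewrite polarZr mulNr divfK // addNr.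
clearbody c'.
have Zy : quadric A (a + a') by rewrite -yE Z_rep.
have Zc : quadric A (c + c').
  by apply/eqP; rewrite qformD (eqP (Z1 c cl1)) (eqP (Z2 c' c'l2)) Bcc !addr0.
have Byc : B (a + a') (c + c') = 0.
  by rewrite polarDl !polarDr perp1 // (perp2 a' c') // add0r addr0 (polarC a' c).
have y0 : a + a' != 0 by rewrite -yE rep_neq0.
have cy : c + c' \notin <[a + a']>%VS.
  apply: contraNN ca => /vlineP[p eq_p]; apply/vlineP; exists p.
  apply/eqP; rewrite -subr_eq0; apply/eqP; apply: (skew_lineP qf l12).
    by rewrite memvB ?memvZ.
  have -> : c - p *: a = p *: a' - c'.
    by apply/eqP; rewrite -subr_eq0 opprB addrACA -opprD -scalerDr eq_p subrr.
  by rewrite memvB ?memvZ.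
have [r rE] := join_line qf Zy Zc Byc y0 cy.
exists r; first by rewrite qincE rE yE (subvP (addvSl _ _)) ?memv_line.
move=> g; rewrite inE => /andP[/meets_pointP[x xg xl1] /meets_pointP[z zg zl2]].
rewrite !qincE in xg xl1 zg zl2.
move: (xl1); rewrite {1}l1E => /mem_span2[p [s xE]].
pose w := p *: a' + s *: c'; have wl2 : w \in val l2 by rewrite memvD ?memvZ.
have Bwx : B w (rep x) = 0.
  rewrite xE polarDl !polarDr !polarZl !polarZr (polarC a' a) (polarC c' a) (polarC a' c).
  rewrite (polarC c' c) Baa Bcc.
  by transitivity (p * s * (B a c' + B c a')); [ring | rewrite Bsum mulr0].
have Bzx : B (rep z) (rep x) = 0.
  by apply: (contained_perp qf) zg xg; have [] := qlineP g.
have xl2 := nl2 _ xl1 (rep_neq0 x).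
have wz := perp_on_line_uniq qf (valP l2) (Z_rep x) xl2 zl2 (rep_neq0 z) Bzx wl2 Bwx.
have wg : w \in val g by case/vlineP: wz => d ->; rewrite memvZ.
have vr : rep x + w \in val r.
  rewrite rE xE /w; apply/memv_addP; exists (p *: (a + a')); rewrite ?memvZ ?memv_line //.
  by exists (s *: (c + c')); rewrite ?memvZ ?memv_line // !scalerDr; rewrite !addrA; congr (_ + _); rewrite addrAC.
have vg : rep x + w \in val g by rewrite memvD.
have v0 : rep x + w != 0.
  rewrite addr_eq0; apply: contraNneq xl2 => ->; by rewrite memvN.
have Zv : quadric A (rep x + w) by have [_ /(containedP _ _)] := qlineP g; apply.
by apply/meets_pointP; exists (mkpoint qf Zv v0); rewrite /qinc /= -memvE.
Qed.

End QuadricForm.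

Section HyperplanePencil.
Variables (F : finFieldType) (n : nat).
Implicit Types (v : 'rV[F]_n) (S H : {vspace 'rV[F]_n}).

Lemma hyperplane_over S H v : \dim H = (\dim S).+1 -> (S <= H)%VS -> v \in H -> v \notin S ->
  H = (S + <[v]>)%VS.
Proof.
move=> dimH SH vH vS; apply/eqP; rewrite eq_sym eqEdim subv_add SH -memvE vH.
by rewrite dim_add_line //= dimH leqnn.
Qed.

(** Distinct hyperplanes over S have no vector off S in common. *)
Lemma card_hyperplanes_over S : n = (\dim S).+2 ->
  (#|[set H | (\dim H == (\dim S).+1) && (S <= H)%VS]| <= #|F|.+1)%N.
Proof.
move=> nE; set P := [set H | _]; set d := \dim S in nE P *.
have PP H : H \in P -> \dim H = d.+1 /\ (S <= H)%VS by rewrite inE => /andP[/eqP].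
have := double_count P (~: [set v | v \in S]) (fun H v => v \in H).
have q_gt0 : (0 < #|F|)%N := ltnW (finNzRing_gt1 F).
have nE' : (#|F| ^ n = #|F| ^ d.+2)%N by congr (_ ^ _)%N.
have cS : #|~: [set v | v \in S]| = (#|F| ^ d * (#|F| * #|F| - 1))%N.
  have := cardsC [set v | v \in S]; rewrite card_rV_vspace card_mx mul1n nE' !expnS -/d.
  by move: (_ ^ d)%N #|~: _| => a c; nia.
rewrite (eq_bigr (fun=> (#|F| ^ d * (#|F| - 1))%N)) => [|H /PP[dimH SH]]; last first.
  have -> : [set v in ~: [set v | v \in S] | v \in H] = [set v | v \in H] :\: [set v | v \in S].
    by apply/setP => v; rewrite !inE.
  rewrite cardsD card_rV_vspace (setIidPr _) ?card_rV_vspace ?dimH -/d ?expnS ?mulnBr ?muln1.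
    by rewrite mulnC.
  by apply/subsetP => v; rewrite !inE; apply: (subvP SH).
rewrite sum_nat_const => eqP'.
have : (#|P| * (#|F| ^ d * (#|F| - 1)) <= #|F| ^ d * (#|F| * #|F| - 1))%N.
  rewrite eqP' -cS -[leqRHS]sum1_card; apply: leq_sum => v; rewrite !inE => vS.
  apply/card_le1_eqP => H H'; rewrite !inE => /andP[HP vH] /andP[H'P vH'].
  have [dimH SH] : \dim H = d.+1 /\ (S <= H)%VS by case/andP: HP => /eqP.
  have [dimH' SH'] : \dim H' = d.+1 /\ (S <= H')%VS by case/andP: H'P => /eqP.
  by rewrite (hyperplane_over dimH SH vH vS) (hyperplane_over dimH' SH' vH' vS).
have -> : (#|F| * #|F| - 1 = #|F|.+1 * (#|F| - 1))%N by nia.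
rewrite mulnCA leq_pmul2l ?expn_gt0 ?q_gt0 // leq_pmul2r // subn_gt0.
exact: finNzRing_gt1.
Qed.

Lemma exists_hyperplane_over S v : n = (\dim S).+2 ->
  exists H, [/\ \dim H = (\dim S).+1, (S <= H)%VS & v \in H].
Proof.
move=> nE; have [vS|vS] := boolP (v \in S); last first.
  exists (S + <[v]>)%VS; rewrite dim_add_line // addvSl; split=> //.
  by rewrite (subvP (addvSr _ _)) ?memv_line.
have /subvPn[w _ wS] : ~~ (fullv <= S)%VS.
  by apply/negP => /dimvS; rewrite dimvf /= dim_matrix mul1r => le; move: nE; lia.
exists (S + <[w]>)%VS; rewrite dim_add_line // addvSl; split=> //.
by rewrite (subvP (addvSl _ _)).
Qed.

End HyperplanePencil.

Section EllipticQuadric.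
Variables (F : finFieldType) (A : 'M[F]_6).
Hypothesis witt2 : witt_index A = 2%N.
Let qf := quadric_quadrangle_form witt2.
Let gq := quadrangle_qinc qf.
Local Notation Z := (quadric A).
Local Notation inc := (@qinc F 6 Z).
Implicit Types (g h : qline Z) (x y z : qpoint Z) (H S : {vspace 'rV[F]_6}).

(** Every singular point a + b of the span, with a on l1 and b on l2, is on the
    transversal through <a> and <b>. *)
Lemma grid_points (l1 l2 : qline Z) x : ~~ meets inc l1 l2 ->
  (x \in points_in Z (val l1 + val l2)) = (x \in grid inc l1 l2).
Proof.
move=> l12; rewrite [RHS]inE; apply/idP/existsP => [|[g /andP[]]]; last first.
  rewrite inE => /andP[/meets_pointP[y yg y1] /meets_pointP[z zg z2]] xg.
  have yz : y != z by apply: contraNneq l12 => eq_yz; apply/meets_pointP; exists y; rewrite // eq_yz.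
  rewrite mem_points_in; have := xg; rewrite qincE (qline_span yz yg zg); apply: subvP.
  by rewrite addvS // -memvE -qincE.
rewrite mem_points_in => /memv_addP[a a1 [c c2 xE]].
have [d1 /(containedP _ _) Z1] := qlineP l1; have [d2 /(containedP _ _) Z2] := qlineP l2.
have [a0|a0] := eqVneq a 0.
  have x2 : inc x l2 by rewrite qincE xE a0 add0r.
  have l21 : ~~ meets inc l2 l1 by rewrite meetsC.
  have [g] := transversal_at gq l21 x2; rewrite inE => gT xg.
  by exists g; rewrite inE andbC [X in _ && X]andbC xg.
have [c0|c0] := eqVneq c 0.
  have x1 : inc x l1 by rewrite qincE xE c0 addr0.
  by have [g gT xg] := transversal_at gq l12 x1; exists g; rewrite gT.
have Zx := Z_rep x; have Bac : polar_form A a c = 0.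
  by move/eqP: Zx; rewrite xE qformD (eqP (Z1 a a1)) (eqP (Z2 c c2)) !add0r.
have ca : c \notin <[a]>%VS.
  apply: contraNN c0 => /vlineP[k cE]; apply/eqP/(skew_lineP qf l12) => //.
  by rewrite cE memvZ.
have [g gE] := join_line qf (Z1 a a1) (Z2 c c2) Bac a0 ca.
exists g; rewrite qincE gE xE memv_add ?memv_line // andbT inE.
apply/andP; split; apply/meets_pointP.
  by exists (mkpoint qf (Z1 a a1) a0); rewrite /qinc /= -?memvE // gE memvE addvSl.
by exists (mkpoint qf (Z2 c c2) c0); rewrite /qinc /= -?memvE // gE memvE addvSr.
Qed.

Lemma hyperplane_meets S H g : \dim H = 5%N -> \dim S = 4%N -> (S <= H)%VS ->
  (val g <= H)%VS -> exists2 x, x \in points_in Z S & inc x g.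
Proof.
move=> dimH dimS SH gH; have [dimg /(containedP _ _) Zg] := qlineP g.
have : \dim (val g :&: S) != 0%N.
  have := dimv_sum_cap (val g) S; rewrite dimg dimS.
  have : (\dim (val g + S) <= 5)%N.
    by apply: (@leq_trans (\dim H)); [rewrite dimvS // subv_add gH | rewrite dimH].
  move=> le eqn; apply/eqP => d0; rewrite d0 addn0 in eqn; by rewrite eqn in le.
rewrite dimv_eq0 -vpick0 => u0; have := memv_pick (val g :&: S)%VS.
move: (vpick _) u0 => u u0 /memv_capP[ug uS].
exists (mkpoint qf (Zg u ug) u0); last by rewrite /qinc /= -memvE.
by rewrite inE /= -memvE.
Qed.

Lemma quadric_inner_cover (L : {set qline Z}) d (l1 l2 : qline Z) :
  #|L| = ((#|F| * #|F|).+1 + d)%N -> (forall g, exists2 l, l \in L & meets inc g l) ->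
  ~~ meets inc l1 l2 -> (d < #|F|)%N ->
  (d.+1 < #|[set g in transversals inc l1 l2 | line_in inc (covered inc L) g]|)%N ->
  (d * (#|F| * #|F| + 1) < (#|F|.+1 - d) * (#|F| - d) * (#|F| - 1))%N ->
  (d * (#|F| * #|F| - #|F| + 1) <= #|F| * (#|F| - 1) * (#|F| - 2))%N ->
  exists H, [/\ \dim H = 5%N, (val l1 + val l2 <= H)%VS &
    forall x, x \in points_in Z H -> exists l, [/\ l \in L, (val l <= H)%VS & inc x l]].
Proof.
move=> cardL block l12 dq many arith1 arith2; have q_gt1 := card_finField_gt1 F.
set S := (val l1 + val l2)%VS; have dimS : \dim S = 4%N := dim_span_skew qf l12.
pose P := [set H : {vspace 'rV[F]_6} | (\dim H == (\dim S).+1) && (S <= H)%VS].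
have PP H : H \in P -> \dim H = 5%N /\ (S <= H)%VS by rewrite inE dimS => /andP[/eqP].
have GE : grid inc l1 l2 = points_in Z S by apply/setP => x; rewrite grid_points.
have l1S : (val l1 <= S)%VS := addvSl _ _.
have l2S : (val l2 <= S)%VS := addvSr _ _.
have degH H x : H \in P -> x \in points_in Z H -> #|pencil_in inc (points_in Z H) x| = #|F|.+1.
  case/PP => dimH SH xH.
  rewrite (card_pencil_points_in qf (subv_trans l1S SH) (subv_trans l2S SH) l12) ?dimH //.
  by rewrite mul1n expn1.
have degT x : #|pencil_in inc setT x| = (#|F| * #|F|).+1.
  have <- : points_in Z fullv = setT by apply/setP => y; rewrite !inE subvf.
  rewrite (card_pencil_points_in qf (subvf _) (subvf _) l12) ?dimvf /= ?dim_matrix //.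
    by rewrite mul1n mulnn.
  by rewrite inE subvf.
have [H HP cover] : exists2 H, H \in P & forall x, x \in points_in Z H ->
    exists l, [/\ l \in L, line_in inc (points_in Z H) l & inc x l].
  apply: (exists_inner_cover gq q_gt1 degT block cardL (l1 := l1) (l2 := l2)) => //.
  - by rewrite GE; apply: subspace_points_in qf _.
  - by move=> y; rewrite GE mem_points_in; apply: opposite_ruling.
  - by apply: card_hyperplanes_over; rewrite dimS.
  - move=> x; have [|H [dimH SH xH]] := @exists_hyperplane_over _ _ S (rep x); first by rewrite dimS.
    by exists H; rewrite ?mem_points_in // inE dimH eqxx SH.
  - by move=> H _; apply: subspace_points_in qf _.
  - move=> H /PP[_ SH]; rewrite GE; apply/subsetP => x; rewrite !mem_points_in; exact: (subvP SH).
  - move=> H g /PP[dimH SH]; rewrite (line_inE qf) GE; exact: hyperplane_meets dimH dimS SH.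
  - by apply/card_gt0P; have [x xl1 _] := meets_pointP _ _ _ (meets_self gq l1); exists x.
have [dimH SH] := PP H HP; exists H; split=> // x xH.
by have [l [lL lH xl]] := cover x xH; exists l; rewrite -(line_inE qf).
Qed.

End EllipticQuadric.

(** * Hermitian varieties *)

(** The fibers add up to P, so that none of them can be smaller than the common bound m. *)
Lemma fibers_full (A B : finType) (P : {set A}) (Q : {set B}) (f : A -> B) m :
  (forall a, a \in P -> f a \in Q) -> (#|Q| * m <= #|P|)%N ->
  (forall b, #|[set a in P | f a == b]| <= m)%N ->
  forall b, b \in Q -> #|[set a in P | f a == b]| = m.
Proof.
move=> PQ leP fib b bQ; apply/eqP; rewrite eqn_leq fib /=.
have := double_count P Q (fun a b => f a == b).
rewrite (eq_bigr (fun=> 1%N)) => [|a aP]; last first.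
  by apply: (@card_unique _ _ (f a)) => [|c]; rewrite inE ?PQ ?eqxx // => /andP[_ /eqP].
rewrite sum1_card (big_setD1 b) //= => eqP'.
have : (\sum_(c in Q :\ b) #|[set a in P | f a == c]| <= #|Q :\ b| * m)%N.
  by rewrite -sum_nat_const; apply: leq_sum => c _; apply: fib.
by have := cardsD1 b Q; rewrite bQ; move: leP; rewrite eqP'; nia.
Qed.

Section Conjugation.
Variables (F : finFieldType) (q : nat).
Hypotheses (hq : prime_power q) (cardF : #|F| = (q ^ 2)%N).

Lemma q_gt1 : (1 < q)%N.
Proof.
case: hq => p [k [pr_p k_gt0 ->]]; by rewrite -(exp1n k) ltn_exp2r ?prime_gt1.
Qed.

Lemma conjD (x y : F) : (x + y) ^+ q = x ^+ q + y ^+ q.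
Proof.
case: hq => p [k [pr_p k_gt0 qE]].
have pF : p \in [pchar F] by apply: (@card_finPcharP F p (k * 2)); rewrite // cardF qE expnM.
apply: exprDn_pchar; rewrite qE pnatX; apply/orP; left; rewrite pnatE //.
Qed.

Lemma conjN (x : F) : (- x) ^+ q = - x ^+ q.
Proof.
have := conjD x (- x); rewrite subrr expr0n; have := q_gt1; case: q => // k _ /= /eqP.
by rewrite eq_sym addrC addr_eq0 => /eqP.
Qed.

Lemma conjK (x : F) : (x ^+ q) ^+ q = x.
Proof. by rewrite -exprM mulnn -cardF expf_card. Qed.

Lemma card_roots_le (p : {poly F}) n : p != 0 -> (size p <= n.+1)%N ->
  (#|[set x | root p x]| <= n)%N.
Proof.
move=> p0 sz; rewrite cardE -ltnS (leq_trans _ sz) //.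
apply: max_poly_roots => //; last exact: enum_uniq.
by apply/allP => x; rewrite mem_enum inE.
Qed.

Lemma q_gt0 : (0 < q)%N. Proof. exact: ltnW q_gt1. Qed.

Lemma size_XnD (r : {poly F}) n : (size r <= n)%N -> size ('X^n + r) = n.+1.
Proof. by move=> sz; rewrite size_polyDl size_polyXn. Qed.

Lemma card_fixed_le : (#|[set a : F | a ^+ q == a]| <= q)%N.
Proof.
have sz := @size_XnD (- 'X) q; rewrite size_polyN size_polyX q_gt1 in sz.
rewrite (_ : [set a | _] = [set a | root ('X^q - 'X) a]).
  by apply: card_roots_le; rewrite -?size_poly_gt0 sz.
by apply/setP => a; rewrite !inE /root !hornerE subr_eq0.
Qed.

(** The trace is additive with kernel and image of size at most q each. *)
Lemma card_trace (a : F) : a ^+ q = a -> #|[set x : F | x + x ^+ q == a]| = q.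
Proof.
move=> fa; pose Q := [set a : F | a ^+ q == a].
have fib b : (#|[set x : F | (x + x ^+ q == b)%R]| <= q)%N.
  have sz := @size_XnD ('X - b%:P) q; rewrite size_XsubC q_gt1 in sz.
  rewrite (_ : [set x | _] = [set x | root ('X^q + ('X - b%:P)) x]).
    by apply: card_roots_le; rewrite -?size_poly_gt0 sz.
  by apply/setP => x; rewrite !inE /root hornerD hornerXn hornerXsubC addrA subr_eq0 addrC.
rewrite -[RHS](@fibers_full _ _ [set: F] Q (fun x => x + x ^+ q) q _ _ _ a).
- by apply: eq_card => x; rewrite !inE.
- by move=> x _; rewrite inE conjD conjK addrC.
- by rewrite cardsT cardF -mulnn leq_mul2r card_fixed_le orbT.
- by move=> b; apply: leq_trans (fib b); apply/subset_leq_card/subsetP => x; rewrite !inE.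
- by rewrite inE fa.
Qed.

(** The norm of a nonzero element is one of the q - 1 nonzero fixed elements, and its
    fibers have at most q + 1 elements. *)
Lemma card_norm (a : F) : a != 0 -> a ^+ q = a -> #|[set x : F | x ^+ q.+1 == a]| = q.+1.
Proof.
move=> a0 fa; pose Q := [set a : F | a ^+ q == a] :\ 0.
have fib b : b != 0 -> (#|[set x : F | x ^+ q.+1 == b]| <= q.+1)%N.
  move=> b0; have sz : size ('X^(q.+1) - b%:P) = q.+2 by rewrite size_XnsubC.
  rewrite (_ : [set x | _] = [set x | root ('X^(q.+1) - b%:P) x]).
    by apply: card_roots_le; rewrite -?size_poly_gt0 sz.
  by apply/setP => x; rewrite !inE /root !hornerE subr_eq0.
rewrite -[RHS](@fibers_full _ _ (~: [set 0]) Q (fun x => x ^+ q.+1) q.+1 _ _ _ a).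
- apply: eq_card => x; rewrite !inE; case: (eqVneq x 0) => //= ->.
  by rewrite expr0n eq_sym (negbTE a0).
- by move=> x; rewrite !inE => x0; rewrite expf_neq0 //= exprAC exprS conjK -exprSr.
- have := cardsC [set (0 : F)]; rewrite cards1 cardF => eqF.
  have := cardsD1 0 [set a : F | a ^+ q == a]; rewrite inE expr0n (gtn_eqF q_gt0) eqxx.
  move: card_fixed_le eqF q_gt1; rewrite -/Q -mulnn => h1 h2 h3 h4; rewrite h4 add1n in h1.
  have -> : #|[set~ (0 : F)]| = ((q - 1) * q.+1)%N by nia.
  by rewrite leq_mul2r -ltnS subn1 prednK ?h1 ?orbT // ltnW.
- move=> b; have [->|b0] := eqVneq b 0.
    rewrite (_ : [set _ in _ | _] = set0) ?cards0 //; apply/setP => x; rewrite !inE.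
    by rewrite expf_eq0 /= andNb.
  by apply: leq_trans (fib b b0); apply/subset_leq_card/subsetP => x; rewrite !inE => /andP[].
- by rewrite !inE a0 fa eqxx.
Qed.

End Conjugation.

Section HermitianForm.
Variables (F : finFieldType) (q n : nat) (A : 'M[F]_n).
Hypotheses (hq : prime_power q) (cardF : #|F| = (q ^ 2)%N).
Hypothesis Aherm : nonsingular_hermitian q A.
Implicit Types (u v w e : 'rV[F]_n) (U l : {vspace 'rV[F]_n}).

Definition frob (x : F) := x ^+ q.

Lemma frob_zmod : zmod_morphism frob.
Proof. by move=> x y; rewrite /frob (conjD hq cardF) (conjN hq cardF). Qed.

Lemma frob_monoid : monoid_morphism frob.
Proof. by split=> [|x y]; rewrite /frob ?expr1n ?exprMn. Qed.

HB.instance Definition _ := GRing.isZmodMorphism.Build F F frob frob_zmod.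
HB.instance Definition _ := GRing.isMonoidMorphism.Build F F frob frob_monoid.

Lemma conjq_mxK m1 m2 (B : 'M[F]_(m1, m2)) : conjq_mx q (conjq_mx q B) = B.
Proof. by apply/matrixP => i j; rewrite !mxE (conjK cardF). Qed.

Lemma conjq_mxE m1 m2 (B : 'M[F]_(m1, m2)) : conjq_mx q B = map_mx frob B.
Proof. by []. Qed.

Definition sesq v w : F := (v *m A *m (conjq_mx q w)^T) 0 0.

Lemma sesqDl u v w : sesq (u + v) w = sesq u w + sesq v w.
Proof. by rewrite /sesq !mulmxDl mxE. Qed.

Lemma sesqZl c v w : sesq (c *: v) w = c * sesq v w.
Proof. by rewrite /sesq -!scalemxAl mxE. Qed.

Lemma sesqDr u v w : sesq u (v + w) = sesq u v + sesq u w.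
Proof. by rewrite /sesq !conjq_mxE map_mxD linearD mulmxDr mxE. Qed.

Lemma sesqZr c v w : sesq v (c *: w) = c ^+ q * sesq v w.
Proof. by rewrite /sesq !conjq_mxE map_mxZ linearZ /= -scalemxAr mxE. Qed.

Lemma sesqC v w : sesq w v = sesq v w ^+ q.
Proof.
have cA : conjq_mx q A = A^T by have [AE _] := Aherm; rewrite -{2}AE trmxK.
have -> : sesq v w ^+ q = (map_mx frob (v *m A *m (conjq_mx q w)^T)) 0 0 by rewrite mxE.
rewrite !map_mxM map_trmx -!conjq_mxE conjq_mxK cA /sesq.
rewrite -[w *m A *m _]trmxK [in LHS]mxE !trmx_mul !trmxK mulmxA //.
Qed.

Lemma sesq_eq0C v w : (sesq w v == 0) = (sesq v w == 0).
Proof. by rewrite sesqC expf_eq0 (q_gt0 hq). Qed.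

Lemma sesq_self v : sesq v v ^+ q = sesq v v.
Proof. by rewrite -sesqC. Qed.

Lemma sesq_nondeg e : e != 0 -> exists w, sesq w e != 0.
Proof.
move=> e0; have [/existsP[i]|/existsPn perp] := boolP [exists i, sesq (delta_mx 0 i) e != 0].
  by exists (delta_mx 0 i).
have Ae0 : A *m (conjq_mx q e)^T = 0.
  apply/colP => i; have := perp i; rewrite negbK /sesq -mulmxA -rowE mxE => /eqP->.
  by rewrite mxE.
have [_ Aunit] := Aherm; case/negP: e0; rewrite -(conjq_mxK e) conjq_mxE map_mx_eq0.
by rewrite -trmx_eq0 -[_^T](mulKmx Aunit) Ae0 mulmx0.
Qed.

(** If the product does not vanish then the trace map would be zero on the whole field. *)
Lemma isotropic_perp u v : sesq u u = 0 -> sesq v v = 0 ->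
  (forall c, sesq (u + c *: v) (u + c *: v) = 0) -> sesq u v = 0.
Proof.
move=> Zu Zv Zuv; apply/eqP; rewrite sesq_eq0C; apply: contraT => bvu.
have trace0 (d : F) : d + d ^+ q = 0.
  have := Zuv (d / sesq v u).
  rewrite !sesqDl !sesqDr !sesqZl !sesqZr Zu Zv !mulr0 !addr0 add0r divfK // addrC.
  by rewrite [sesq u v]sesqC exprMn exprVn divfK ?expf_neq0.
have := card_trace hq cardF (a := 0); rewrite expr0n (gtn_eqF (q_gt0 hq)) => /(_ erefl).
rewrite (_ : [set x | _] = setT); last by apply/setP => x; rewrite !inE trace0 eqxx.
rewrite cardsT cardF => eq_q; have := q_gt1 hq; nia.
Qed.

Lemma card_isotropic_coset e w : sesq e e = 0 -> sesq w e != 0 ->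
  #|[set c | hermitian_variety q A (w + c *: e)]| = q.
Proof.
move=> Ze bwe; have bew : sesq e w != 0 by rewrite sesq_eq0C.
have aq : (- sesq w w) ^+ q = - sesq w w by rewrite (conjN hq cardF) sesq_self.
rewrite -[RHS](card_trace hq cardF aq) -[LHS](card_imset _ (mulIf bew)).
apply: eq_card => x; rewrite [RHS]inE.
have ZE c : hermitian_variety q A (w + c *: e) =
    (c * sesq e w + (c * sesq e w) ^+ q == - sesq w w).
  rewrite -[LHS]/(sesq _ _ == 0) !sesqDl !sesqDr !sesqZl !sesqZr Ze !mulr0 addr0.
  rewrite [sesq w e]sesqC -exprMn -[RHS]subr_eq0 opprK; congr (_ == 0).
  by rewrite -addrA addrC [_ ^+ q + _]addrC.
apply/imsetP/idP => [[c]|xP]; first by rewrite inE ZE => cP ->.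
by exists (x / sesq e w); rewrite ?inE ?ZE divfK.
Qed.


(** A totally isotropic subspace is contained in its perpendicular space. *)
Lemma isotropic_dim U : contained_in (hermitian_variety q A) U -> (\dim U + \dim U <= n)%N.
Proof.
move=> /(containedP _ _) ZU; pose M := \matrix_(i < \dim U) (vbasis U)`_i.
have freeM : row_free M.
  apply: inj_row_free => v; rewrite mulmx_sum_row => v0; apply/rowP => i; rewrite mxE.
  have /freeP : free (vbasis U) := basis_free (vbasisP U).
  move=> /(_ (fun i => v 0 i)); apply; rewrite -[RHS]v0.
  by apply: eq_bigr => j _; rewrite rowK.
have MU i : row i M \in U by rewrite rowK vbasis_mem // mem_nth // size_tuple.
have M0 : M *m A *m (conjq_mx q M)^T = 0.
  apply/matrixP => i j; rewrite [RHS]mxE.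
  have -> : (M *m A *m (conjq_mx q M)^T) i j = sesq (row i M) (row j M).
    rewrite /sesq !mxE; apply: eq_bigr => k _; rewrite !mxE; congr (_ * _).
    by apply: eq_bigr => k' _; rewrite !mxE.
  apply: isotropic_perp => [||c]; apply/eqP/ZU => //.
  by rewrite memvD ?memvZ.
have := mulmx0_rank_max M0; have [_ Aunit] := Aherm.
rewrite mxrankMfree ?row_free_unit // mxrank_tr conjq_mxE mxrank_map.
by rewrite (eqP freeM).
Qed.

Hypothesis n_le5 : (n <= 5)%N.

Lemma hermitian_quadrangle_form : quadrangle_form (hermitian_variety q A) sesq q.
Proof.
split=> [c v /eqP Zv|v a u w|u v /eqP buv|u v /eqP Zu /eqP Zv buv|u v /eqP Zu /eqP Zv Zuv
  |e w /eqP Ze bwe|U ZU].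
- by apply/eqP; rewrite -[hform _ _ _]/(sesq _ _) sesqZl sesqZr [sesq v v]Zv !mulr0.
- by rewrite sesqDl sesqZl.
- by apply/eqP; rewrite sesq_eq0C.
- have bvu : sesq v u = 0 by apply/eqP; rewrite sesq_eq0C buv.
  by apply/eqP; rewrite -[hform _ _ _]/(sesq _ _) sesqDl !sesqDr [sesq u u]Zu [sesq v v]Zv buv bvu !addr0.
- by apply: isotropic_perp => // c; apply/eqP/Zuv.
- exact: card_isotropic_coset.
- by have := isotropic_dim ZU; lia.
Qed.

Let qf := hermitian_quadrangle_form.

Lemma exists_norm (a b : F) : a ^+ q = a -> b ^+ q = b -> b != 0 ->
  exists c, a + c * c ^+ q * b = 0.
Proof.
move=> fa fb b0; have [->|a0] := eqVneq a 0.
  by exists 0; rewrite mul0r mul0r addr0.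
have fx : (- a / b) ^+ q = - a / b by rewrite exprMn exprVn (conjN hq cardF) fa fb.
have x0 : - a / b != 0 by rewrite mulf_neq0 ?oppr_eq0 ?invr_eq0.
have : (0 < #|[set x : F | x ^+ q.+1 == - a / b]|)%N by rewrite (card_norm hq cardF x0 fx).
case/card_gt0P => c; rewrite inE exprS => /eqP cE; exists c.
by rewrite cE divfK // subrr.
Qed.

(** On an orthogonal pair w, u the equation is a + c c^q b = 0 with a and b fixed by the
    involution, which the surjectivity of the norm solves. *)
Lemma exists_isotropic_span2 u v : u != 0 -> v \notin <[u]>%VS ->
  exists c d, [/\ (c != 0) || (d != 0) & hermitian_variety q A (c *: u + d *: v)].
Proof.
move=> u0 vu; have [Zu|Zu] := eqVneq (sesq u u) 0.
  exists 1, 0; rewrite oner_neq0 scale1r scale0r addr0; split=> //; exact/eqP.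
pose k := sesq v u / sesq u u; pose w := v - k *: u.
have bwu : sesq w u = 0.
  by rewrite /w sesqDl -scaleNr sesqZl mulNr divfK // subrr.
have buw : sesq u w = 0 by apply/eqP; rewrite sesq_eq0C bwu.
have [c cE] := exists_norm (sesq_self w) (sesq_self u) Zu.
exists (c - k), 1; rewrite oner_neq0 orbT; split=> //; apply/eqP.
have -> : (c - k) *: u + 1 *: v = w + c *: u.
  by rewrite scale1r scalerBl /w addrC addrA addrAC.
clearbody w; rewrite -[LHS]/(sesq _ _) sesqDl !sesqDr !sesqZl !sesqZr bwu buw !mulr0 addr0 add0r.
by rewrite -[RHS]cE mulrA.
Qed.


Lemma memZ_inv (c : F) v U : c != 0 -> c *: v \in U -> v \in U.
Proof. by move=> c0 cvU; rewrite -[v]scale1r -(mulVf c0) -scalerA memvZ. Qed.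

Lemma exists_notin U : (\dim U < n)%N -> exists v, v \notin U.
Proof.
move=> dimU; have /subvPn[v _ vU] : ~~ (fullv <= U)%VS.
  by apply/negP => /dimvS; rewrite dimvf dim_matrix mul1r leqNgt dimU.
by exists v.
Qed.

(** The perpendicular space of an isotropic vector e contains two vectors that are
    independent modulo e; an isotropic combination of them spans a line together with e. *)
Lemma exists_hermitian_line : (3 < n)%N -> exists l, l \in lines_of (hermitian_variety q A).
Proof.
move=> n_gt3; have [|u u0] := @exists_notin 0%VS; first by rewrite dimv0 ltnW // ltnW // ltnW.
rewrite memv0 in u0; have [|v vu] := @exists_notin <[u]>%VS.
  by rewrite dim_vline u0 ltnW // ltnW.
have [c [d [cd Ze]]] := exists_isotropic_span2 u0 vu; set e := _ + _ in Ze.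
have e0 : e != 0.
  rewrite /e addrC addr_eq0; apply: contraNneq vu => dv.
  have dv' : d *: v \in <[u]>%VS by rewrite dv memvN memvZ ?memv_line.
  have [d0|d0] := eqVneq d 0; last exact: memZ_inv d0 dv'.
  move: dv cd; rewrite d0 scale0r eqxx orbF => /esym/eqP.
  by rewrite oppr_eq0 scaler_eq0 (negbTE u0) orbF => /eqP->; rewrite eqxx.
have [f bf] := sesq_nondeg e0.
have dimS : (\dim (<[e]> + <[f]>) <= 2)%N.
  by apply: leq_trans (dimv_add_leqif _ _).1 _; rewrite !dim_vline; case: (e != 0); case: (f != 0).
have [|x xS] := @exists_notin (<[e]> + <[f]>)%VS.
  exact: leq_ltn_trans dimS (ltnW n_gt3).
have [|y yT] := @exists_notin (<[e]> + <[f]> + <[x]>)%VS.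
  by rewrite dim_add_line //; apply: leq_ltn_trans n_gt3.
pose S := (<[e]> + <[f]>)%VS; pose T := (S + <[x]>)%VS.
have eS : e \in S by rewrite (subvP (addvSl _ _)) ?memv_line.
have fS : f \in S by rewrite (subvP (addvSr _ _)) ?memv_line.
have [eT fT] : e \in T /\ f \in T by split; apply: (subvP (addvSl _ _)).
pose x' := x - (sesq x e / sesq f e) *: f; pose y' := y - (sesq y e / sesq f e) *: f.
have bx : sesq x' e = 0 by rewrite /x' sesqDl -scaleNr sesqZl mulNr divfK // subrr.
have by' : sesq y' e = 0 by rewrite /y' sesqDl -scaleNr sesqZl mulNr divfK // subrr.
have x'S : x' \notin S by apply: contraNN xS => x'S; rewrite -[x](subrK ((sesq x e / sesq f e) *: f)) memvD ?memvZ.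
have y'T : y' \notin T.
  by apply: contraNN yT => y'T; rewrite -[y](subrK ((sesq y e / sesq f e) *: f)) memvD ?memvZ.
have x'T : x' \in T by rewrite memvB ?memvZ // (subvP (addvSr _ _)) ?memv_line.
have x'0 : x' != 0 by apply: contraNneq x'S => ->; apply: mem0v.
have y'x' : y' \notin <[x']>%VS by apply: contraNN y'T => /vlineP[r ->]; apply: memvZ.
have [a [b [ab Zz]]] := exists_isotropic_span2 x'0 y'x'; set z := _ + _ in Zz.
have bze : sesq z e = 0 by rewrite /z sesqDl !sesqZl bx by' !mulr0 addr0.
have bez : sesq e z = 0 by apply/eqP; rewrite sesq_eq0C bze.
have ze : z \notin <[e]>%VS.
  apply/negP => /vlineP[r zE]; have zS : z \in S by rewrite zE memvZ.
  have [b0|b0] := eqVneq b 0.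
    move: ab zS; rewrite /z b0 eqxx orbF scale0r addr0 => a0 /(memZ_inv a0).
    exact/negP.
  have : b *: y' \in T by rewrite -[b *: y'](addKr (a *: x')) memvD ?memvN ?memvZ // -/z zE memvZ.
  by move/(memZ_inv b0); apply/negP.
exists (<[e]> + <[z]>)%VS; apply/lineP; rewrite dim_span2 //; split=> //.
exact: (contained_span2 qf Ze Zz bez).
Qed.

Local Notation Z := (hermitian_variety q A).
Local Notation inc := (@qinc F n Z).

(** On r = l + l' the form g(v, w) = (v1, w2) built on the components is
    skew-hermitian and nondegenerate; its singular points are the points of r that are
    on a transversal of l and l'. *)
Lemma many_centers (l l' r : qline Z) : ~~ meets inc l l' -> ~~ meets inc r l ->
  ~~ meets inc r l' -> (val r <= val l + val l')%VS ->
  (q < #|[set g in transversals inc l l' | meets inc g r]|)%N.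
Proof.
move=> ll' rl rl' rS; have gq := quadrangle_qinc qf.
have cap := skew_capv qf ll'.
have cap' : (val l' :&: val l = 0)%VS by rewrite capvC.
pose p1 := daddv_pi (val l) (val l'); pose p2 := daddv_pi (val l') (val l).
have p12 v : v \in val r -> p1 v + p2 v = v.
  by move=> /(subvP rS) vS; apply: daddv_pi_add.
have p1l v : p1 v \in val l := memv_pi _ _ _.
have p2l v : p2 v \in val l' := memv_pi _ _ _.
have [dimr /(containedP _ _) Zr] := qlineP r.
have [diml /(containedP _ _) Zl] := qlineP l; have [diml' /(containedP _ _) Zl'] := qlineP l'.
have perp (h : qline Z) u v : u \in val h -> v \in val h -> sesq u v = 0.
  by move=> uh vh; apply: (contained_perp qf) uh vh; have [] := qlineP h.
have p1_neq0 v : v \in val r -> v != 0 -> p1 v != 0.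
  move=> vr; apply: contraNneq => p1v; apply/eqP.
  by apply: (skew_lineP qf rl' vr); rewrite -(p12 v vr) p1v add0r.
have p2_neq0 v : v \in val r -> v != 0 -> p2 v != 0.
  move=> vr; apply: contraNneq => p2v; apply/eqP.
  by apply: (skew_lineP qf rl vr); rewrite -(p12 v vr) p2v addr0.
pose g v w := sesq (p1 v) (p2 w).
have gDl u v w : g (u + v) w = g u w + g v w by rewrite /g linearD sesqDl.
have gDr u v w : g u (v + w) = g u v + g u w by rewrite /g linearD sesqDr.
have gZl c v w : g (c *: v) w = c * g v w by rewrite /g linearZ sesqZl.
have gZr c v w : g v (c *: w) = c ^+ q * g v w by rewrite /g linearZ sesqZr.
have g_skew v w : v \in val r -> w \in val r -> g v w ^+ q = - g w v.
  move=> vr wr; apply/eqP; rewrite -addr_eq0 -sesqC; apply/eqP.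
  have := perp r w v wr vr; rewrite -{1}(p12 w wr) -{1}(p12 v vr) sesqDl !sesqDr.
  rewrite (perp l _ _ (p1l w) (p1l v)) (perp l' _ _ (p2l w) (p2l v)) add0r addr0.
  by rewrite addrC.
(* A point of r singular for g is on a transversal. *)
have hit v (Zv : Z v) (v0 : v != 0) : v \in val r -> g v v = 0 ->
    exists2 h, h \in transversals inc l l' & inc (mkpoint qf Zv v0) h.
  move=> vr gv; have nl : p2 v \notin <[p1 v]>%VS.
    apply: contraNN (p2_neq0 v vr v0) => /vlineP[c p2E]; apply/eqP.
    by apply: (skew_lineP qf ll') => //; rewrite p2E memvZ.
  have [h hE] := join_line qf (Zl _ (p1l v)) (Zl' _ (p2l v)) gv (p1_neq0 v vr v0) nl.
  exists h; last by rewrite /qinc /= -memvE hE -{1}(p12 v vr) memv_add ?memv_line.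
  rewrite inE; apply/andP; split; apply/meets_pointP.
    exists (mkpoint qf (Zl _ (p1l v)) (p1_neq0 v vr v0)); rewrite /qinc /= -?memvE //.
    by rewrite hE memvE addvSl.
  exists (mkpoint qf (Zl' _ (p2l v)) (p2_neq0 v vr v0)); rewrite /qinc /= -?memvE //.
  by rewrite hE memvE addvSr.
pose Y0 := [set y | inc y r & [exists h in transversals inc l l', inc y h]].
have Y0T : (#|Y0| <= #|[set h in transversals inc l l' | meets inc h r]|)%N.
  apply: (leq_card_hit (inc := fun (h : qline Z) (y : qpoint Z) => inc y h)) => [y|y z h].
    rewrite inE => /andP[yr /existsP[h /andP[hT yh]]]; exists h => //.
    by rewrite inE hT; apply/meets_pointP; exists y.
  rewrite !inE => /andP[yr _] /andP[zr _] /andP[/andP[hl _] _] yh zh.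
  by apply: (point_eq gq (l := h) (m := r)) => //; apply: contraNneq rl => <-.
apply: leq_trans Y0T.
have [/existsP[w /andP[wr gw]]|/existsPn all0] := boolP [exists w, (w \in val r) && (g w w != 0)];
  last first.
  apply: (@leq_trans #|pts inc r|).
    by rewrite (card_pts gq) cardF -mulnn; have := q_gt1 hq; nia.
  apply/subset_leq_card/subsetP => y; rewrite !inE => yr; rewrite yr /=.
  have := all0 (rep y); rewrite -qincE yr negbK /= => /eqP gy; rewrite qincE in yr.
  have [h hT yh] := hit _ (Z_rep y) (rep_neq0 y) yr gy.
  apply/existsP; exists h; rewrite hT /=; suff <- : mkpoint qf (Z_rep y) (rep_neq0 y) = y by [].
  by apply/val_inj; rewrite /= -val_rep.
have w0 : w != 0 by apply: contraNneq gw => ->; rewrite /g linear0 (form0l qf).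
have [a aw rE] := line_basis dimr wr w0.
have ar : a \in val r by rewrite rE (subvP (addvSr _ _)) ?memv_line.
pose v := a - (g a w / g w w) *: w.
have vr : v \in val r by rewrite memvB ?memvZ.
have gvw : g v w = 0 by rewrite /v gDl -scaleNr gZl mulNr divfK // subrr.
have gwv : g w v = 0.
  by apply/eqP; rewrite -oppr_eq0 -g_skew // gvw expr0n (gtn_eqF (q_gt0 hq)).
have vw : v \notin <[w]>%VS.
  apply: contraNN aw => vw; rewrite -[a](subrK ((g a w / g w w) *: w)) memvD //.
  by rewrite memvZ ?memv_line.
have v0 : v != 0 by apply: contraNneq vw => ->; apply: mem0v.
have rE' : val r = (<[w]> + <[v]>)%VS by apply: line_span2.
clearbody v.
(* Otherwise the component of v on l would be perpendicular to l'. *)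
have gv : g v v != 0.
  apply/negP => /eqP gv.
  have [|u ul'] := not_perp_line qf (valP l') (Zl _ (p1l v)).
    by apply: contraNN (p1_neq0 v vr v0) => p1v; rewrite (skew_lineP qf ll' (p1l v) p1v).
  rewrite sesq_eq0C => /negP[].
  have nl : p2 v \notin <[p2 w]>%VS.
    apply: contraNN vw => /vlineP[c p2E]; apply/vlineP; exists c.
    apply/eqP; rewrite -subr_eq0; apply/eqP; apply: (skew_lineP qf rl).
      by rewrite memvB ?memvZ.
    rewrite -(p12 v vr) -(p12 w wr) p2E scalerDr opprD addrACA subrr addr0.
    by rewrite memvB ?memvZ.
  move: ul'; rewrite (line_span2 diml' (p2l w) (p2l v) (p2_neq0 w wr w0) nl).
  move=> /mem_span2[c [d ->]]; rewrite sesqDr !sesqZr -![sesq _ _]/(g _ _).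
  by rewrite gv gvw !mulr0 addr0.
pose x := - g v v / g w w.
have fx : x ^+ q = x.
  by rewrite exprMn exprVn (conjN hq cardF) !g_skew // opprK invrN mulrN -mulNr.
have x0 : x != 0 by rewrite mulf_neq0 ?oppr_eq0 ?invr_eq0.
rewrite -(card_norm hq cardF x0 fx).
apply: (leq_card_hit (inc := fun (y : qpoint Z) (c : F) => v + c *: w \in val y)) => [c|c d y].
  rewrite inE exprS => /eqP cx; set u := v + c *: w.
  have ur : u \in val r by rewrite memvD ?memvZ.
  have u0 : u != 0.
    rewrite /u addr_eq0; apply: contraNneq vw => ->.
    by rewrite memvN memvZ ?memv_line.
  have gu : g u u = 0.
    rewrite /u gDl !gDr !gZl !gZr gvw gwv !mulr0 addr0 add0r mulrA cx.
    by rewrite divfK // subrr.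
  have [h hT uh] := hit u (Zr u ur) u0 ur gu.
  exists (mkpoint qf (Zr u ur) u0); last by rewrite /= memv_line.
  rewrite inE /qinc /= -memvE ur; apply/existsP; exists h; by rewrite hT.
move=> _ _ _; rewrite val_rep => /vlineP[s sE] /vlineP[s' s'E].
have s'0 : s' != 0.
  apply: contraNneq vw => s'0; move/eqP: s'E; rewrite s'0 scale0r addr_eq0 => /eqP->.
  by rewrite memvN memvZ ?memv_line.
have : (s' - s) *: v \in <[w]>%VS.
  have -> : (s' - s) *: v = (s * d - s' * c) *: w.
    have : s' *: (v + c *: w) = s *: (v + d *: w) by rewrite sE s'E !scalerA mulrC.
    move/eqP; rewrite !scalerDr !scalerA -subr_eq0 opprD addrACA -!scalerBl addr_eq0 => /eqP->.
    by rewrite -scaleNr opprB.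
  by rewrite memvZ ?memv_line.
have [eqs|nes] := eqVneq s' s; last by rewrite -subr_eq0 in nes => /(memZ_inv nes); rewrite (negbTE vw).
have := sE; rewrite -eqs -s'E => /addrI/eqP; rewrite -subr_eq0 -scalerBl scaler_eq0 (negbTE w0) orbF subr_eq0.
by move=> /eqP.
Qed.

End HermitianForm.

(** * Arithmetic of the bounds on the excess *)

Section Numerics.
Local Open Scope nat_scope.
Lemma elliptic_excess_lt_half q d :
  2 * d <= 3 * q -> 2 * q + 1 + 12 * (q * d) <= 4 * (q * q) + 4 * (d * d) ->
  2 * d < q.
Proof. by move=> le3 bound; rewrite ltnNge; apply/negP => le2; nia. Qed.

(** With q = d + e the bound on d reads 4 e^2 > 4 q d + 2 q. *)
Lemma elliptic_gap e d :
  2 * (d + e) + 1 + 12 * ((d + e) * d) <= 4 * ((d + e) * (d + e)) + 4 * (d * d) ->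
  4 * ((d + e) * d) + 2 * (d + e) < 4 * (e * e).
Proof. lia. Qed.

Lemma elliptic_arith_pairs q d : 2 * d < q ->
  2 * q + 1 + 12 * (q * d) <= 4 * (q * q) + 4 * (d * d) ->
  q * (q * (q * q)).+1 * (d * d.+1) <
    (q * q).+1 * (q * q - q * d) * ((q.+1 - d.+1) * (q - d)).
Proof.
move=> lt2; have [e qE] : exists e, q = d + e by exists (q - d); lia.
move: lt2; rewrite qE -mulnBr subSS addKn => lt2 /elliptic_gap gap.
have de : d < e by lia.
set q' := d + e in gap *; have q'_gt0 : 0 < q' by lia.
have cube : q' * d * d.+1 < e * e * e.
  have h1 : 4 * (q' * d) * d.+1 <= (4 * (q' * d)) * e by rewrite leq_mul2l de orbT.
  have h2 : 4 * (q' * d) * e < 4 * (e * e) * e by rewrite ltn_mul2r; lia.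
  lia.
have -> : q' * (q' * (q' * q')).+1 * (d * d.+1) = (q' * q' * q').+1 * (q' * d * d.+1) by lia.
have -> : (q' * q').+1 * (q' * e) * (e * e) = (q' * q').+1 * q' * (e * e * e) by lia.
have h : (q' * q' * q').+1 * (q' * d * d.+1) <= (q' * q').+1 * q' * (q' * d * d.+1).
  by rewrite leq_mul2r; apply/orP; right; lia.
by apply: leq_ltn_trans h _; rewrite ltn_mul2l muln_gt0 q'_gt0.
Qed.

Lemma elliptic_arith_points q d : 1 < q -> 2 * d < q ->
  2 * q + 1 + 12 * (q * d) <= 4 * (q * q) + 4 * (d * d) ->
  d * (q * q + 1) < (q.+1 - d) * (q - d) * (q - 1).
Proof.
move=> q_gt1 lt2; have [e qE] : exists e, q = d + e by exists (q - d); lia.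
move: q_gt1 lt2; rewrite qE subSn ?leq_addr // addKn => q_gt1 lt2 /elliptic_gap gap.
have [p pE] : exists p, d + e = p.+1 by exists (d + e).-1; lia.
move: gap q_gt1 lt2; rewrite pE subn1 /= => gap q_gt1 lt2.
have h1 : (4 * (p.+1 * d) + 2 * p.+1) * p <= 4 * (e * e) * p by rewrite leq_mul2r ltnW ?orbT.
have h2 : 2 * d * p <= p * p by rewrite leq_mul2r; lia.
have h3 : d * p + e * p = p.+1 * p by rewrite -mulnDl pE.
have h4 : 2 * (d * p.+1) <= p * p.+1 by rewrite mulnA leq_mul2r; lia.
nia.
Qed.

Lemma elliptic_arith_hyperplane q d : 1 < q -> 2 * d < q ->
  2 * q + 1 + 12 * (q * d) <= 4 * (q * q) + 4 * (d * d) ->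
  d * (q * q - q + 1) <= q * (q - 1) * (q - 2).
Proof.
move=> q_gt1 lt2 bound; have [q4|q4] := leqP 4 q; last first.
  have d0 : d = 0.
    have [//|d_gt0] := posnP d; have d1 : d = 1 by lia.
    have q3 : q = 3 by lia.
    by move: bound; rewrite d1 q3.
  by rewrite d0.
have le2 : 2 * d <= q - 1 by lia.
have h : 2 * d * (q * q - q + 1) <= (q - 1) * (q * q - q + 1) by rewrite leq_mul2r le2 orbT.
suff : (q - 1) * (q * q - q + 1) <= (q - 1) * (2 * (q * (q - 2))) by lia.
rewrite leq_mul2l; apply/orP; right.
have [u ->] : exists u, q = u + 4 by exists (q - 4); lia.
by nia.
Qed.

Lemma hermitian_arith_pairs q d : d + 3 < q ->
  q ^ 2 * (q ^ 2 * q ^ 3).+1 * (d * d.+1) <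
    (q ^ 3).+1 * (q ^ 3 - q ^ 2 * d) * (((q ^ 2).+1 - (q.+1 + d)) * (q ^ 2 - d)).
Proof.
move=> dq; have -> : q ^ 3 - q ^ 2 * d = q ^ 2 * (q - d) by rewrite mulnBr -expnSr.
have q2 : q ^ 2 = q * q by rewrite mulnn.
have f1 : 4 <= q - d by lia.
have f2 : q * (q - 2) <= (q ^ 2).+1 - (q.+1 + d) by rewrite q2 mulnBr; lia.
have f3 : q * (q - 1) <= q ^ 2 - d by rewrite q2 mulnBr; lia.
have f4 : (q ^ 2 * q ^ 3).+1 <= (q ^ 3).+1 * q ^ 2 by rewrite q2; nia.
have f5 : d * d.+1 < 4 * ((q - 2) * (q - 1)) by nia.
have f6 : q ^ 2 * (4 * ((q - 2) * (q - 1))) <=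
    (q - d) * (((q ^ 2).+1 - (q.+1 + d)) * (q ^ 2 - d)).
  apply: (@leq_trans (4 * (q * (q - 2) * (q * (q - 1))))); first by rewrite q2; lia.
  by rewrite !leq_mul.
have q_gt0 : 0 < q ^ 2 by rewrite q2 muln_gt0; lia.
apply: (@leq_trans ((q ^ 2 * q ^ 3).+1 * (q ^ 2 * (4 * ((q - 2) * (q - 1)))))).
  by rewrite mulnAC [ltnLHS]mulnC !ltn_pmul2l.
by rewrite mulnA -mulnA; apply: leq_trans (leq_mul f4 f6) _; rewrite -!mulnA.
Qed.

End Numerics.

(** * Blocking sets of generators *)

Section Transfer.
Variables (F : finFieldType) (n : nat) (Z : pred 'rV[F]_n).
Local Notation inc := (@qinc F n Z).
Implicit Types L : {set {vspace 'rV[F]_n}}.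

Definition qlines L : {set qline Z} := [set g | val g \in L].

Lemma card_qlines L : L \subset lines_of Z -> #|qlines L| = #|L|.
Proof.
move=> /subsetP LZ; rewrite -(card_imset _ val_inj); apply: eq_card => l.
apply/imsetP/idP => [[g gL ->]|lL]; first by rewrite inE in gL.
by exists (mkline (LZ l lL)); rewrite ?inE.
Qed.

Lemma qlines_blocking L : generator_blocking_set Z L ->
  forall g, exists2 l, l \in qlines L & meets inc g l.
Proof.
case/andP => /subsetP LZ /forallP block g; have := block (val g).
rewrite (valP g) => /existsP[l /andP[lL gl]].
by exists (mkline (LZ l lL)); rewrite ?inE // meetsE.
Qed.

Lemma pencil_of_qlines L t x : #|pencil_in inc setT x| = t -> pencil_in inc setT x \subset qlines L ->
  [/\ is_point (val x), contained_in Z (val x), #|pencil Z (val x)| = t & pencil Z (val x) \subset L].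
Proof.
move=> cx /subsetP xL; have /andP[xP xZ] := valP x.
have pE : pencil Z (val x) = val @: pencil_in inc setT x.
  apply/setP => l; apply/idP/imsetP => [|[g]].
    rewrite inE => /andP[lZ xl]; exists (mkline lZ) => //.
    by rewrite in_pencilT.
  by rewrite in_pencilT => xg ->; rewrite inE (valP g).
split=> //; first by rewrite pE card_imset //; apply: val_inj.
by rewrite pE; apply/subsetP => _ /imsetP[g /xL gL ->]; rewrite inE in gL.
Qed.

End Transfer.

Section HermitianVariety.
Variables (q : nat) (F : finFieldType) (A : 'M[F]_5).
Hypotheses (hq : prime_power q) (cardF : #|F| = (q ^ 2)%N).
Hypothesis Aherm : nonsingular_hermitian q A.
Local Notation Z := (hermitian_variety q A).
Local Notation inc := (@qinc F 5 Z).
Let qf := hermitian_quadrangle_form hq cardF Aherm (leqnn 5).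
Let gq : quadrangle inc (q ^ 2).
Proof. by rewrite -cardF; apply: quadrangle_qinc qf. Qed.
Variable L : {set {vspace 'rV[F]_5}}.
Hypothesis blockL : generator_blocking_set Z L.

Lemma hermitian_s_gt1 : (1 < q ^ 2)%N.
Proof. by rewrite -cardF card_finField_gt1. Qed.

Lemma hermitian_skew_lines : exists g1 g2 : qline Z, ~~ meets inc g1 g2.
Proof.
have [l lZ] := exists_hermitian_line hq cardF Aherm (leqnn 5) isT.
by apply: (exists_skew_lines qf (q_gt0 hq) (mkline lZ)) => e _; apply: sesq_nondeg cardF Aherm _.
Qed.

Lemma hermitian_degree x : #|pencil_in inc setT x| = (q ^ 3).+1.
Proof.
have [g1 [g2 g12]] := hermitian_skew_lines.
have <- : points_in Z fullv = setT by apply/setP => y; rewrite !inE subvf.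
rewrite (card_pencil_points_in qf (subvf _) (subvf _) g12) ?dimvf /= ?dim_matrix ?inE ?subvf //.
by rewrite cardF -expnM -expnS.
Qed.

Let points_gt0 : (0 < #|{: qpoint Z}|)%N.
Proof.
have [g1 _] := hermitian_skew_lines; have [x _ _] := meets_pointP _ _ _ (meets_self gq g1).
by apply/card_gt0P; exists x.
Qed.

Lemma hermitian_lower_bound : (q ^ 3 < #|L|)%N.
Proof.
have [LZ _] := andP blockL; rewrite -(card_qlines LZ).
apply: (card_blocking_ge gq hermitian_s_gt1 hermitian_degree _ points_gt0).
exact: qlines_blocking blockL.
Qed.

Lemma hermitian_pencil d : #|L| = ((q ^ 3).+1 + d)%N -> (d + 3 < q)%N ->
  exists P : {vspace 'rV[F]_5},
    [/\ is_point P, contained_in Z P, #|pencil Z P| = (q ^ 3 + 1)%N & pencil Z P \subset L].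
Proof.
have [LZ _] := andP blockL; rewrite -(card_qlines LZ) => cardL dq.
have block := qlines_blocking blockL; have s_gt1 := hermitian_s_gt1.
have ds : (d.+1 < q ^ 2)%N by rewrite -mulnn; nia.
have [[x xL]|small] := pencil_or_small gq s_gt1 hermitian_degree block cardL ds.
  exists (val x); rewrite addn1; exact: pencil_of_qlines (hermitian_degree x) xL.
have [l [l' [_ _ ll' many]]] := skew_pair_many_full gq s_gt1 hermitian_degree block cardL
  points_gt0 small (ltnW ds) (hermitian_arith_pairs dq).
pose S := (val l + val l')%VS; have dimS : \dim S = 4%N := dim_span_skew qf ll'.
have lS : (val l <= S)%VS := addvSl _ _; have l'S : (val l' <= S)%VS := addvSr _ _.
have degS x : x \in points_in Z S -> #|pencil_in inc (points_in Z S) x| = q.+1.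
  by move=> xS; rewrite (card_pencil_points_in qf lS l'S ll') ?dimS // muln1.
have lD : line_in inc (points_in Z S) l by rewrite (line_inE qf).
have l'D : line_in inc (points_in Z S) l' by rewrite (line_inE qf).
have Ssub := @subspace_points_in _ _ _ _ _ qf S.
have SM := all_covered_of_transversals gq s_gt1 hermitian_degree block cardL Ssub degS lD l'D ll' many.
have S_gt0 : (0 < #|points_in Z S|)%N.
  have [x xl _] := meets_pointP _ _ _ (meets_self gq l); apply/card_gt0P; exists x.
  by rewrite mem_points_in (subvP lS) // -qincE.
case: (@no_small_cover _ _ inc _ gq (q ^ 3) d (qlines Z L) s_gt1 cardL (points_in Z S) q Ssub degS _ S_gt0 SM
  (ltnW ds) q erefl erefl dq small) => // [|g g' r]; first by rewrite -expnSr.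
rewrite !(line_inE qf) => gS g'S rS gg' rg rg'; apply: (many_centers hq cardF Aherm (leqnn 5)) => //.
suff <- : S = (val g + val g')%VS by [].
by apply/eqP; rewrite eq_sym eqEdim subv_add gS g'S dimS (dim_span_skew qf gg').
Qed.

End HermitianVariety.

Section EllipticQuadricBlocking.
Variables (q : nat) (F : finFieldType) (A : 'M[F]_6).
Hypothesis cardF : #|F| = q.
Hypothesis ellA : elliptic_quadric A.
Local Notation Z := (quadric A).
Local Notation inc := (@qinc F 6 Z).
Let witt2 : witt_index A = 2%N.
Proof. by have [_ _ ->] := ellA. Qed.
Let qf := quadric_quadrangle_form witt2.
Let gq : quadrangle inc #|F| := quadrangle_qinc qf.
Variable L : {set {vspace 'rV[F]_6}}.
Hypothesis blockL : generator_blocking_set Z L.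

Lemma elliptic_nondeg e : Z e -> e != 0 -> exists w, polar_form A w e != 0.
Proof.
move=> Ze e0; have [_ /forallP/(_ e) + _] := ellA.
by rewrite memvf e0 Ze /= => /existsP[w /andP[_ bew]]; exists w; rewrite polarC.
Qed.

Lemma elliptic_skew_lines : exists g1 g2 : qline Z, ~~ meets inc g1 g2.
Proof.
have [l lZ] := exists_quadric_line witt2.
exact: (exists_skew_lines qf (ltnSn 0) (mkline lZ) elliptic_nondeg).
Qed.

Lemma elliptic_degree x : #|pencil_in inc setT x| = (#|F| * #|F|).+1.
Proof.
have [g1 [g2 g12]] := elliptic_skew_lines.
have <- : points_in Z fullv = setT by apply/setP => y; rewrite !inE subvf.
rewrite (card_pencil_points_in qf (subvf _) (subvf _) g12) ?dimvf /= ?dim_matrix ?inE ?subvf //.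
by rewrite mul1n mulnn.
Qed.

Let points_gt0 : (0 < #|{: qpoint Z}|)%N.
Proof.
have [g1 _] := elliptic_skew_lines; have [x _ _] := meets_pointP _ _ _ (meets_self gq g1).
by apply/card_gt0P; exists x.
Qed.

Lemma elliptic_lower_bound : (#|F| * #|F| < #|L|)%N.
Proof.
have [LZ _] := andP blockL; rewrite -(card_qlines LZ).
apply: (card_blocking_ge gq (card_finField_gt1 F) elliptic_degree _ points_gt0).
exact: qlines_blocking blockL.
Qed.

(** A singular vector perpendicular to H would be on both lines, since a line and a point
    perpendicular to it and off it span a singular plane. *)
Lemma nonsingular_over_skew (l1 l2 : qline Z) H : ~~ meets inc l1 l2 ->
  (val l1 <= H)%VS -> (val l2 <= H)%VS -> nonsingular_on A H.
Proof.
move=> l12 l1H l2H; apply/forallP => v; apply/implyP => vH; apply/implyP => /andP[v0 Zv].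
have polar_on (l : qline Z) : (val l <= H)%VS -> v \notin val l ->
    [exists w in H, polar_form A v w != 0].
  move=> /subvP lH vl; have [w wl bw] := not_perp_line qf (valP l) Zv vl.
  by apply/existsP; exists w; rewrite lH // polarC.
have [v1|] := boolP (v \in val l1); last exact: polar_on.
have [v2|] := boolP (v \in val l2); last exact: polar_on.
by rewrite (skew_lineP qf l12 v1 v2) eqxx in v0.
Qed.

Lemma elliptic_pencil_or_cover d : #|L| = ((#|F| * #|F|).+1 + d)%N -> (2 * d < q)%N ->
  (2 * q + 1 + 12 * (q * d) <= 4 * (q * q) + 4 * (d * d))%N ->
  (exists P : {vspace 'rV[F]_6},
     [/\ is_point P, contained_in Z P, #|pencil Z P| = (q ^ 2 + 1)%N & pencil Z P \subset L])
  \/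
  (exists (H : {vspace 'rV[F]_6}) (C : {set {vspace 'rV[F]_6}}),
     [/\ parabolic_section A H, is_cover (subspace_section Z H) C & C \subset L]).
Proof.
have [LZ _] := andP blockL; rewrite -(card_qlines LZ) => cardL d2 bound.
have block := qlines_blocking blockL; have s_gt1 := card_finField_gt1 F.
have q_gt1 : (1 < q)%N by rewrite -cardF.
have ds : (d.+1 < #|F|)%N by rewrite cardF; lia.
have [[x xL]|small] := pencil_or_small gq s_gt1 elliptic_degree block cardL ds.
  left; exists (val x); rewrite addn1 -cardF -mulnn.
  exact: pencil_of_qlines (elliptic_degree x) xL.
right; have [|l1 [l2 [_ _ l12 many]]] := skew_pair_many_full (F := d.+1) gq s_gt1 elliptic_degree
  block cardL points_gt0 small (ltnW ds); first by rewrite cardF; exact: elliptic_arith_pairs.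
have [||H [dimH SH cover]] := quadric_inner_cover witt2 cardL block l12 (ltnW ds) many.
- by rewrite cardF; apply: elliptic_arith_points.
- by rewrite cardF; apply: elliptic_arith_hyperplane.
have [l1H l2H] : (val l1 <= H)%VS /\ (val l2 <= H)%VS by apply/andP; rewrite -subv_add.
exists H, [set l in L | (l <= H)%VS]; split.
- by split=> //; [rewrite /is_hyperplane dimH | apply: nonsingular_over_skew l12 l1H l2H].
- apply/andP; split.
    apply/subsetP => l; rewrite inE => /andP[/(subsetP LZ)/lineP[diml /(containedP _ _) Zl] /subvP lH].
    apply/lineP; split=> //; apply/(containedP _ _) => v vl.
    by apply/andP; split; [exact: lH | exact: Zl].
  apply/forallP => P; apply/implyP => /andP[Pp /(containedP _ _) PZ].
  have PZ' : is_point P && contained_in Z P.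
    by rewrite Pp; apply/(containedP _ _) => v /PZ/andP[].
  pose x : qpoint Z := exist (fun P => is_point P && contained_in Z P) P PZ'.
  have xH : x \in points_in Z H by rewrite inE /=; apply/subvP => v /PZ/andP[].
  have [l [lL lH xl]] := cover x xH; apply/existsP; exists (val l).
  by rewrite inE in lL; rewrite inE lL lH.
- by apply/subsetP => l; rewrite inE => /andP[].
Qed.

End EllipticQuadricBlocking.

Theorem theorem1p3 (R : rcfType) (q : nat) (hq : prime_power q) :
  (forall (F : finFieldType) (A : 'M[F]_6)
     (L : {set {vspace 'rV[F]_6}}) (delta : int),
     #|F| = q ->
     elliptic_quadric A ->
     generator_blocking_set (quadric A) L ->
     #|L|%:Z = q%:Z ^+ 2 + delta + 1 ->
     delta%:~R <=
       2^-1 * (3 * q%:R - Num.sqrt (5 * q%:R ^+ 2 + 2 * q%:R + 1)) :> R ->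
     (exists P : {vspace 'rV[F]_6},
        [/\ is_point P, contained_in (quadric A) P,
            #|pencil (quadric A) P| = (q ^ 2 + 1)%N
          & pencil (quadric A) P \subset L])
     \/
     (exists (H : {vspace 'rV[F]_6}) (C : {set {vspace 'rV[F]_6}}),
        [/\ parabolic_section A H,
            is_cover (subspace_section (quadric A) H) C
          & C \subset L]))
  /\
  (forall (F : finFieldType) (A : 'M[F]_5)
     (L : {set {vspace 'rV[F]_5}}) (delta : int),
     #|F| = (q ^ 2)%N ->
     nonsingular_hermitian q A ->
     generator_blocking_set (hermitian_variety q A) L ->
     #|L|%:Z = q%:Z ^+ 3 + delta + 1 ->
     delta < q%:Z - 3 ->
     exists P : {vspace 'rV[F]_5},
       [/\ is_point P, contained_in (hermitian_variety q A) P,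
           #|pencil (hermitian_variety q A) P| = (q ^ 3 + 1)%N
         & pencil (hermitian_variety q A) P \subset L]).
Proof.
split=> F A L delta cardF hA block cardL le_delta.
  have lower := elliptic_lower_bound hA block; rewrite cardF in lower.
  have [d dE] : exists d : nat, delta = d%:Z.
    by exists (#|L| - (q * q).+1)%N; rewrite expr2 -PoszM in cardL; lia.
  rewrite dE in le_delta cardL; rewrite expr2 -PoszM in cardL.
  have cardL' : #|L| = ((#|F| * #|F|).+1 + d)%N by rewrite cardF; lia.
  set w := Num.sqrt _ in le_delta.
  have le3 : d%:R * 2 + w <= 3 * q%:R :> R.
    move: le_delta; rewrite -[(d%:Z)%:~R]/(d%:R) => le_d.
    by lra.
  have w_ge0 : 0 <= w by apply: sqrtr_ge0.
  have wE : w ^+ 2 = 5 * q%:R ^+ 2 + 2 * q%:R + 1.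
    by apply: sqr_sqrtr; rewrite !addr_ge0 ?mulr_ge0 ?exprn_ge0 ?ler0n.
  have sq : 5 * q%:R ^+ 2 + 2 * q%:R + 1 <= (3 * q%:R - d%:R * 2) ^+ 2 :> R.
    rewrite -wE lerXn2r // ?nnegrE //; lra.
  have bound : (2 * q + 1 + 12 * (q * d) <= 4 * (q * q) + 4 * (d * d))%N.
    rewrite -(ler_nat R) !natrD !natrM; nra.
  have le3q : (2 * d <= 3 * q)%N by rewrite -(ler_nat R) !natrM; lra.
  exact: (elliptic_pencil_or_cover cardF hA block cardL' (elliptic_excess_lt_half le3q bound) bound).
have lower := hermitian_lower_bound hq cardF hA block.
have cardL' : #|L| = ((q ^ 3).+1 + (#|L| - (q ^ 3).+1))%N by rewrite subnKC.
apply: (hermitian_pencil hq cardF hA block cardL'); lia.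
Qed.
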